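(* Let $\lambda\in\mathfrak h^*$ and let $L^{\chi}_I(\lambda)$ be a simple $u_{\chi}(\mathfrak p_I)$-module generated by a maximal vector $v_\lambda$ of weight $\lambda$. Let $Z^{\chi}_I(\lambda)=u_{\chi}(\mathfrak g)\otimes_{u_{\chi}(\mathfrak p_I)}L^{\chi}_I(\lambda)$, and let $R^I_{\mathfrak g}(\lambda)\in\mathbf F$ be the scalar determined by $$e_{\beta_1}^{p-1}\cdots e_{\beta_k}^{p-1}f_{\beta_1}^{p-1}\cdots f_{\beta_k}^{p-1}\otimes v_{\lambda}=R^I_{\mathfrak g}(\lambda)\otimes v_{\lambda}\quad\text{in } Z^{\chi}_I(\lambda).$$ If $R^I_{\mathfrak g}(\lambda)\neq 0$, then the $u_{\chi}(\mathfrak g)$-module $Z^{\chi}_I(\lambda)$ is simple.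
   Context: Let $G$ be a reductive algebraic group over an algebraically closed field $\mathbf F$ of characteristic $p>0$, with Lie algebra $\mathfrak g$ (a restricted Lie algebra with $p$-map $x\mapsto x^{[p]}$). Assume: the derived group $DG$ is simply connected; $p$ is good for $\mathfrak g$; there is a $G$-invariant non-degenerate bilinear form on $\mathfrak g$. Let $T$ be a maximal torus of $G$, $\mathfrak h=\mathrm{Lie}(T)$, $\Phi$ the root system, $\Pi$ a base, $\Phi^+$ the positive roots, $\mathfrak n^{\pm}=\sum_{\alpha\in\Phi^+}\mathfrak g_{\pm\alpha}$, so $\mathfrak g=\mathfrak n^-+\mathfrak h+\mathfrak n^+$. Fix a Chevalley basis $\{e_\alpha,h_\beta: \alpha\in\Phi,\beta\in\Pi\}$ of $\mathrm{Lie}(DG)$ and put $f_\alpha=e_{-\alpha}$ for $\alpha\in\Phi^+$; thus $\mathfrak g_\alpha=\mathbf Fe_\alpha$, $\mathfrak g_{-\alpha}=\mathbf Ff_\alpha$. Fix a proper subset $I\subsetneq\Pi$; put $\Phi_I=\mathbb ZI\cap\Phi$, $\Phi_I^+=\Phi_I\cap\Phi^+$, $\tilde{\mathfrak g}_I=\mathfrak h+\sum_{\alpha\in\Phi_I}\mathfrak g_\alpha$, $\mathfrak u=\sum_{\alpha\in\Phi^+\setminus\Phi_I^+}\mathfrak g_\alpha$, $\mathfrak p_I=\tilde{\mathfrak g}_I+\mathfrak u$ (a parabolic subalgebra). Write $\Phi^+\setminus\Phi_I^+=\{\beta_1,\dots,\beta_k\}$, ordered by ascending height. Fix $\chi\in\mathfrak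 g^*$ with $\chi(\mathfrak n^+)=0$. For a restricted subalgebra $L\subseteq\mathfrak g$, the $\chi$-reduced enveloping algebra $u_\chi(L)$ is the quotient of the universal enveloping algebra $U(L)$ by the two-sided ideal generated by all $x^p-x^{[p]}-\chi(x)^p$, $x\in L$. A maximal vector of weight $\lambda\in\mathfrak h^*$ in a $u_\chi(\mathfrak p_I)$-module is a nonzero vector $v$ with $e_\alpha v=0$ for all $\alpha\in\Phi^+$ and $hv=\lambda(h)v$ for all $h\in\mathfrak h$. The left-hand side of the equation defining $R^I_{\mathfrak g}(\lambda)$ is known to be a scalar multiple of $1\otimes v_\lambda$, and ''$R^I_{\mathfrak g}(\lambda)\otimes v_\lambda$'' denotes that scalar multiple. *)

(* Defs.v *)
From HB Require Import structures.
From mathcomp Require Import all_boot all_order all_algebra.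
From mathcomp Require Import boolp.
From mathcomp Require finmap mpoly monalg.

Set Implicit Arguments.
Unset Strict Implicit.
Unset Printing Implicit Defensive.

Import GRing.Theory.
Local Open Scope ring_scope.
Local Open Scope quotient_scope.

Section IdealQuotient.
Variables (A : pzRingType) (P : A -> Prop).

Definition ideal_span (x : A) : Prop :=
  forall J : A -> Prop,
    J 0 -> (forall y z, J y -> J z -> J (y - z)) ->
    (forall a y, J y -> J (a * y)) -> (forall a y, J y -> J (y * a)) ->
    (forall y, P y -> J y) -> J x.

Definition in_ideal : pred A := fun x => `[< ideal_span x >].

Lemma ideal_span0 : ideal_span 0.
Proof. by []. Qed.

Lemma ideal_spanB x y : ideal_span x -> ideal_span y -> ideal_span (x - y).
Proof.
move=> Sx Sy J J0 JB Jl Jr JP.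
by apply: (JB); [exact: (Sx J J0 JB Jl Jr JP) | exact: (Sy J J0 JB Jl Jr JP)].
Qed.

Lemma in_idealP x : reflect (ideal_span x) (x \in in_ideal).
Proof. exact: asboolP. Qed.

Fact in_ideal_zmod_closed : zmod_closed in_ideal.
Proof.
split; first by apply/in_idealP; exact: ideal_span0.
by move=> x y /in_idealP Sx /in_idealP Sy; apply/in_idealP; exact: (ideal_spanB Sx Sy).
Qed.
HB.instance Definition _ := GRing.isZmodClosed.Build A in_ideal
  in_ideal_zmod_closed.

Lemma ideal_spanMl a x : ideal_span x -> ideal_span (a * x).
Proof. by move=> Sx J J0 JB Jl Jr JP; exact: (Jl _ _ (Sx J J0 JB Jl Jr JP)). Qed.

Lemma ideal_spanMr a x : ideal_span x -> ideal_span (x * a).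
Proof. by move=> Sx J J0 JB Jl Jr JP; exact: (Jr _ _ (Sx J J0 JB Jl Jr JP)). Qed.

Lemma ideal_spanP x : P x -> ideal_span x.
Proof. by move=> Px J _ _ _ _ JP; exact: JP. Qed.

Definition ideal_closed : zmodClosed A := GRing.ZmodClosed.clone A in_ideal _.

Definition ring_quot : Type := Quotient.quot ideal_closed.
HB.instance Definition _ := GRing.Zmodule.on ring_quot.

Definition to_quot (x : A) : ring_quot := \pi_(Quotient.quot ideal_closed) x.

Lemma to_quotP x y : to_quot x = to_quot y <-> ideal_span (x - y).
Proof.
rewrite /to_quot; split=> [/eqP|Sxy].
  by rewrite -Quotient.idealrBE => /in_idealP.
by apply/eqP; rewrite -Quotient.idealrBE; apply/in_idealP.
Qed.

Definition of_quot (x : ring_quot) : A := repr (x : Quotient.quot ideal_closed).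

Lemma of_quotK : cancel of_quot to_quot.
Proof. by move=> x; rewrite /to_quot /of_quot reprK. Qed.

Lemma to_quot_ind (Q : ring_quot -> Prop) :
  (forall x, Q (to_quot x)) -> forall x, Q x.
Proof. by move=> HQ x; rewrite -[x]of_quotK. Qed.

Fact to_quot_is_zmod_morphism : zmod_morphism to_quot.
Proof. by move=> x y; rewrite /to_quot !piE. Qed.
HB.instance Definition _ := GRing.isZmodMorphism.Build A ring_quot to_quot
  to_quot_is_zmod_morphism.

Definition quot_mul (x y : ring_quot) : ring_quot :=
  to_quot (of_quot x * of_quot y).

Lemma quot_mulE x y : quot_mul (to_quot x) (to_quot y) = to_quot (x * y).
Proof.
apply/to_quotP; set x' := of_quot _; set y' := of_quot _.
have Sx : ideal_span (x' - x) by apply/to_quotP; rewrite of_quotK.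
have Sy : ideal_span (y - y') by apply/to_quotP; rewrite of_quotK.
have -> : x' * y' - x * y = (x' - x) * y' - x * (y - y').
  by rewrite mulrBl mulrBr opprB addrA subrK.
apply: ideal_spanB; first exact: ideal_spanMr.
exact: ideal_spanMl.
Qed.

Fact quot_mulA : associative quot_mul.
Proof.
by elim/to_quot_ind=> x; elim/to_quot_ind=> y; elim/to_quot_ind=> z;
  rewrite !quot_mulE mulrA.
Qed.
Fact quot_mul1r : left_id (to_quot 1) quot_mul.
Proof. by elim/to_quot_ind=> x; rewrite quot_mulE mul1r. Qed.
Fact quot_mulr1 : right_id (to_quot 1) quot_mul.
Proof. by elim/to_quot_ind=> x; rewrite quot_mulE mulr1. Qed.
Fact quot_mulDl : left_distributive quot_mul +%R.
Proof.
by elim/to_quot_ind=> x; elim/to_quot_ind=> y; elim/to_quot_ind=> z;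
  rewrite -raddfD !quot_mulE mulrDl raddfD.
Qed.
Fact quot_mulDr : right_distributive quot_mul +%R.
Proof.
by elim/to_quot_ind=> x; elim/to_quot_ind=> y; elim/to_quot_ind=> z;
  rewrite -raddfD !quot_mulE mulrDr raddfD.
Qed.
HB.instance Definition _ := GRing.Zmodule_isPzRing.Build ring_quot
  quot_mulA quot_mul1r quot_mulr1 quot_mulDl quot_mulDr.

Fact to_quot_is_monoid_morphism : monoid_morphism to_quot.
Proof. by split=> // x y; rewrite -quot_mulE. Qed.
HB.instance Definition _ := GRing.isMonoidMorphism.Build A ring_quot to_quot
  to_quot_is_monoid_morphism.

End IdealQuotient.

Section IdealQuotientMap.
Variables (A B : pzRingType) (P : A -> Prop) (Q : B -> Prop).
Variable f : A -> B.

(* The map A/(P) -> B/(Q) induced by f; meaningful when f maps P into (Q). *)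
Definition quot_map (x : ring_quot P) : ring_quot Q := to_quot Q (f (of_quot x)).

End IdealQuotientMap.

Section IdealQuotientMapTheory.
Variables (A B : pzRingType) (P : A -> Prop) (Q : B -> Prop).
Variable f : {rmorphism A -> B}.
Hypothesis fPQ : forall x, P x -> ideal_span Q (f x).

Lemma quot_map_to_quot x : quot_map Q f (to_quot P x) = to_quot Q (f x).
Proof.
apply/to_quotP; rewrite -rmorphB.
have /(_ (fun z => ideal_span Q (f z))) : ideal_span P (of_quot (to_quot P x) - x).
  by apply/to_quotP; rewrite of_quotK.
apply=> //=.
- by rewrite rmorph0; apply: ideal_span0.
- by move=> y z Sy Sz; rewrite rmorphB; apply: ideal_spanB.
- by move=> a y Sy; rewrite rmorphM; apply: ideal_spanMl.
- by move=> a y Sy; rewrite rmorphM; apply: ideal_spanMr.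
Qed.

Lemma quot_map_zmod_morphism : zmod_morphism (quot_map (P := P) Q f).
Proof.
elim/to_quot_ind=> x; elim/to_quot_ind=> y.
by rewrite -rmorphB !quot_map_to_quot !rmorphB.
Qed.

Lemma quot_map_monoid_morphism : monoid_morphism (quot_map (P := P) Q f).
Proof.
split; first by rewrite -(rmorph1 (to_quot P)) quot_map_to_quot !rmorph1.
elim/to_quot_ind=> x; elim/to_quot_ind=> y.
by rewrite -rmorphM !quot_map_to_quot !rmorphM.
Qed.

End IdealQuotientMapTheory.

Section FreeAbelian.
Import finmap monalg.
Variable K : choiceType.

Local Notation free_ab := {malg int[K]}.

Definition fa_gen (k : K) : free_ab := << k >>.

Definition fa_lift (V : zmodType) (h : K -> V) (g : free_ab) : V :=
  \sum_(k <- msupp g) h k *~ g@_k.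

Lemma fa_liftEw (V : zmodType) (h : K -> V) (d : {fset K}) (g : free_ab) :
  (msupp g `<=` d)%fset -> fa_lift h g = \sum_(k <- d) h k *~ g@_k.
Proof.
move=> le; rewrite [LHS](big_fset_incl _ le) => //= x xd /mcoeff_outdom ->.
by rewrite mulr0z.
Qed.

Lemma fa_liftB (V : zmodType) (h : K -> V) : zmod_morphism (fa_lift h).
Proof.
move=> g1 g2; pose d := (msupp g1 `|` msupp g2)%fset.
rewrite (@fa_liftEw _ _ d g1) ?fsubsetUl //.
rewrite (@fa_liftEw _ _ d g2) ?fsubsetUr //.
rewrite (@fa_liftEw _ _ d (g1 - g2)) ?msuppB_le //.
by rewrite -sumrB; apply: eq_bigr => k _; rewrite mcoeffB mulrzBr.
Qed.

Lemma fa_lift_gen (V : zmodType) (h : K -> V) k : fa_lift h (fa_gen k) = h k.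
Proof.
rewrite (@fa_liftEw _ _ [fset k]%fset) ?msuppU_le // big_seq_fset1.
by rewrite mcoeffUU mulr1z.
Qed.

Lemma fa_ind (Q : free_ab -> Prop) :
  Q 0 -> (forall x y, Q x -> Q y -> Q (x - y)) ->
  (forall k, Q (fa_gen k)) -> forall x, Q x.
Proof.
move=> Q0 QB Qg x.
have QN y : Q y -> Q (- y) by move=> Qy; rewrite -sub0r; apply: QB.
have QD y z : Q y -> Q z -> Q (y + z).
  by move=> Qy Qz; rewrite -[z]opprK; apply: (QB _ _ Qy); exact: QN.
have Qn n k : Q (fa_gen k *+ n).
  by elim: n => [|n IHn]; rewrite ?mulr0n // mulrS; exact: (QD _ _ (Qg k) IHn).
rewrite [x]monalgE; apply: big_ind => // k _; case: (x@_k) => n.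
  by have := Qn n k; rewrite /fa_gen -monalgUMn pmulrn intz.
by have := QN _ (Qn n.+1 k); rewrite /fa_gen -monalgUMn -monalgUN pmulrn intz.
Qed.

End FreeAbelian.

Module TensorProduct.
Section TensorProduct.
Import monalg.
Variables (A B : pzRingType) (phi : B -> A) (N : lmodType B).
Local Notation free := (monalg.malg (A * N)%type int).
Local Notation sym a v := (@fa_gen (A * N)%type (a, v)).

(* B acts on A from the right through phi. *)
Inductive tensor_rel : free -> Prop :=
| TensorDl a a' v : tensor_rel (sym (a + a') v - sym a v - sym a' v)
| TensorDr a v v' : tensor_rel (sym a (v + v') - sym a v - sym a v')
| TensorM a b v : tensor_rel (sym (a * phi b) v - sym a (b *: v)).

Definition tensor_span (x : free) : Prop :=
  forall H : free -> Prop,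
    H 0 -> (forall y z, H y -> H z -> H (y - z)) ->
    (forall y, tensor_rel y -> H y) -> H x.

Definition in_tensor_span : pred free := fun x => `[< tensor_span x >].

Lemma tensor_span0 : tensor_span 0.
Proof. by []. Qed.

Lemma tensor_spanB x y : tensor_span x -> tensor_span y -> tensor_span (x - y).
Proof.
by move=> Sx Sy H H0 HB HP; apply: (HB); [exact: (Sx H H0 HB HP)|exact: (Sy H H0 HB HP)].
Qed.

Lemma tensor_spanP x : tensor_rel x -> tensor_span x.
Proof. by move=> Px H _ _ HP; exact: HP. Qed.

Lemma in_tensor_spanP x : reflect (tensor_span x) (x \in in_tensor_span).
Proof. exact: asboolP. Qed.

Fact in_tensor_span_zmod_closed : zmod_closed in_tensor_span.
Proof.
split; first by apply/in_tensor_spanP; exact: tensor_span0.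
move=> x y /in_tensor_spanP Sx /in_tensor_spanP Sy.
by apply/in_tensor_spanP; exact: (tensor_spanB Sx Sy).
Qed.
#[export] HB.instance Definition _ := GRing.isZmodClosed.Build free in_tensor_span
  in_tensor_span_zmod_closed.

Definition tensor_closed : zmodClosed free :=
  GRing.ZmodClosed.clone free in_tensor_span _.

Definition tensor : Type := Quotient.quot tensor_closed.
#[export] HB.instance Definition _ := GRing.Zmodule.copy tensor (Quotient.quot tensor_closed).

Lemma tensor_spanN x : tensor_span x -> tensor_span (- x).
Proof. by rewrite -sub0r; apply: tensor_spanB; apply: tensor_span0. Qed.

Lemma tensor_spanD x y : tensor_span x -> tensor_span y -> tensor_span (x + y).
Proof. by move=> Sx Sy; rewrite -[y]opprK; exact: (tensor_spanB Sx (tensor_spanN Sy)). Qed.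

Definition to_tensor (x : free) : tensor := \pi_(Quotient.quot tensor_closed) x.

Lemma to_tensorP x y : to_tensor x = to_tensor y <-> tensor_span (x - y).
Proof.
rewrite /to_tensor; split=> [/eqP|Sxy].
  by rewrite -Quotient.idealrBE => /in_tensor_spanP.
by apply/eqP; rewrite -Quotient.idealrBE; apply/in_tensor_spanP.
Qed.

Definition of_tensor (x : tensor) : free := repr (x : Quotient.quot tensor_closed).

Lemma of_tensorK : cancel of_tensor to_tensor.
Proof. by move=> x; rewrite /to_tensor /of_tensor reprK. Qed.

Lemma to_tensor_ind (Q : tensor -> Prop) :
  (forall x, Q (to_tensor x)) -> forall x, Q x.
Proof. by move=> HQ x; rewrite -[x]of_tensorK. Qed.

Lemma to_tensorB x y : to_tensor (x - y) = to_tensor x - to_tensor y.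
Proof. by rewrite /to_tensor !piE. Qed.

Lemma to_tensor0 : to_tensor 0 = 0.
Proof. by rewrite -(subrr 0) to_tensorB subrr. Qed.

Lemma to_tensorD x y : to_tensor (x + y) = to_tensor x + to_tensor y.
Proof. by rewrite /to_tensor !piE. Qed.

Definition tens (a : A) (v : N) : tensor := to_tensor (sym a v).

Definition free_scale (c : A) : free -> free :=
  fa_lift (fun av => sym (c * av.1) av.2).

Lemma free_scale_sym c a v : free_scale c (sym a v) = sym (c * a) v.
Proof. by rewrite /free_scale fa_lift_gen. Qed.

Lemma free_scaleB c x y : free_scale c (x - y) = free_scale c x - free_scale c y.
Proof. exact: fa_liftB. Qed.

Lemma free_scale0 c : free_scale c 0 = 0.
Proof. by rewrite -(subrr 0) free_scaleB !subrr. Qed.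

Lemma free_scale_span c x : tensor_span x -> tensor_span (free_scale c x).
Proof.
move=> /(_ (fun y => tensor_span (free_scale c y))); apply.
- by rewrite free_scale0; exact: tensor_span0.
- by move=> y z Sy Sz; rewrite free_scaleB; exact: tensor_spanB.
- move=> y [a a' v|a v v'|a b v].
  + rewrite !free_scaleB !free_scale_sym mulrDr.
    exact: (tensor_spanP (TensorDl _ _ _)).
  + rewrite !free_scaleB !free_scale_sym.
    exact: (tensor_spanP (TensorDr _ _ _)).
  + rewrite !free_scaleB !free_scale_sym mulrA.
    exact: (tensor_spanP (TensorM _ _ _)).
Qed.

Definition tensor_scale (c : A) (x : tensor) : tensor :=
  to_tensor (free_scale c (of_tensor x)).

Lemma tensor_scaleE c x : tensor_scale c (to_tensor x) = to_tensor (free_scale c x).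
Proof.
apply/to_tensorP; rewrite -free_scaleB; apply: free_scale_span.
by apply/to_tensorP; rewrite of_tensorK.
Qed.

Lemma tensor_scaleB c x y :
  tensor_scale c (x - y) = tensor_scale c x - tensor_scale c y.
Proof.
elim/to_tensor_ind: x => x; elim/to_tensor_ind: y => y.
by rewrite -to_tensorB !tensor_scaleE free_scaleB to_tensorB.
Qed.

Lemma tensor_ind (Q : tensor -> Prop) :
  Q 0 -> (forall x y, Q x -> Q y -> Q (x - y)) ->
  (forall a v, Q (tens a v)) -> forall x, Q x.
Proof.
move=> Q0 QB Qt; elim/to_tensor_ind; elim/fa_ind => [|x y Qx Qy|[a v]].
- by rewrite to_tensor0.
- by rewrite to_tensorB; exact: QB.
- exact: Qt.
Qed.

Lemma tensor_scale_tens c a v : tensor_scale c (tens a v) = tens (c * a) v.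
Proof. by rewrite tensor_scaleE free_scale_sym. Qed.

Lemma tensor_scale0 c : tensor_scale c 0 = 0.
Proof. by rewrite -(subrr 0) tensor_scaleB !subrr. Qed.

Lemma tensDl a a' v : tens (a + a') v = tens a v + tens a' v.
Proof.
rewrite /tens -to_tensorD; apply/to_tensorP; rewrite opprD addrA.
exact: (tensor_spanP (TensorDl _ _ _)).
Qed.

Lemma tensDr a v v' : tens a (v + v') = tens a v + tens a v'.
Proof.
rewrite /tens -to_tensorD; apply/to_tensorP; rewrite opprD addrA.
exact: (tensor_spanP (TensorDr _ _ _)).
Qed.

Lemma tensM a b v : tens (a * phi b) v = tens a (b *: v).
Proof. by apply/to_tensorP; exact: (tensor_spanP (TensorM _ _ _)). Qed.

Fact tensor_scaleA c d x :
  tensor_scale c (tensor_scale d x) = tensor_scale (c * d) x.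
Proof.
elim/tensor_ind: x => [|x y Hx Hy|a v]; first by rewrite !tensor_scale0.
  by rewrite !tensor_scaleB Hx Hy.
by rewrite !tensor_scale_tens mulrA.
Qed.

Fact tensor_scale1 : left_id 1 tensor_scale.
Proof.
elim/tensor_ind => [|x y Hx Hy|a v]; first by rewrite !tensor_scale0.
  by rewrite !tensor_scaleB Hx Hy.
by rewrite !tensor_scale_tens mul1r.
Qed.

Fact tensor_scaleDr : right_distributive tensor_scale +%R.
Proof.
move=> c x y; have H0 : tensor_scale c (- y) = - tensor_scale c y.
  by rewrite -sub0r tensor_scaleB tensor_scale0 sub0r.
by rewrite -[y in LHS]opprK tensor_scaleB -sub0r tensor_scaleB tensor_scale0 sub0r opprK.
Qed.

Fact tensor_scaleDl x : {morph tensor_scale^~ x : c d / c + d}.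
Proof.
move=> c d; elim/tensor_ind: x => [|x y Hx Hy|a v].
- by rewrite !tensor_scale0 addr0.
- by rewrite !tensor_scaleB Hx Hy opprD addrACA.
- by rewrite !tensor_scale_tens mulrDl tensDl.
Qed.

#[export] HB.instance Definition _ := GRing.Zmodule_isLmodule.Build A tensor
  tensor_scaleA tensor_scale1 tensor_scaleDr tensor_scaleDl.

End TensorProduct.
Module Exports. HB.reexport. End Exports.
End TensorProduct.
Export TensorProduct.Exports.
Export TensorProduct.

Module FreeAlgebra.
Section FreeAlgebra.
Import finmap monalg.
Variable F : fieldType.

Definition free_alg (X : choiceType) : nzRingType := {malg F[{fmonom X}]}.
Definition fvar (X : choiceType) (x : X) : free_alg X := << fmu x >>.
Definition fconst (X : choiceType) (c : F) : free_alg X := c%:MP.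

Variables (X Y : choiceType) (i : X -> Y).

Definition fword (m : {fmonom X}) : free_alg Y :=
  \prod_(x <- (m : seq X)) fvar (i x).

Definition free_map (a : free_alg X) : free_alg Y := mmap (@fconst Y) fword a.

Fact fword_mmorphism : mmorphism fword.
Proof.
by split=> [m1 m2|]; rewrite /fword ?fmM ?big_cat // fm1 big_nil.
Qed.
#[export] HB.instance Definition _ := isMultiplicative.Build _ _ fword fword_mmorphism.

#[export] HB.instance Definition _ :=
  GRing.RMorphism.copy (@fconst Y) (@mkmalgU _ F (@mone {fmonom Y})).

Fact free_map_is_zmod_morphism : zmod_morphism free_map.
Proof. by move=> a b; rewrite /free_map mmapB. Qed.

Lemma fconst_comm (Z : choiceType) c (a : free_alg Z) : GRing.comm (fconst Z c) a.
Proof.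
rewrite /GRing.comm /fconst {1 2}[a]monalgE mulr_sumr mulr_suml.
by apply: eq_bigr => k _; rewrite !malgM_def !fgmulUU mulm1 mul1m mulrC.
Qed.

Fact free_map_is_monoid_morphism : monoid_morphism free_map.
Proof.
have [M1 M2] : multiplicative free_map.
  by apply: commr_mmap_is_multiplicative => g m m'; apply: fconst_comm.
by [].
Qed.

#[export] HB.instance Definition _ :=
  GRing.isZmodMorphism.Build (free_alg X) (free_alg Y) free_map
    free_map_is_zmod_morphism.
#[export] HB.instance Definition _ :=
  GRing.isMonoidMorphism.Build (free_alg X) (free_alg Y) free_map
    free_map_is_monoid_morphism.

Lemma free_mapB a b : free_map (a - b) = free_map a - free_map b.
Proof. exact: rmorphB. Qed.

Lemma free_mapD a b : free_map (a + b) = free_map a + free_map b.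
Proof. exact: rmorphD. Qed.

Lemma free_mapM a b : free_map (a * b) = free_map a * free_map b.
Proof. exact: rmorphM. Qed.

Lemma free_map_fvar x : free_map (fvar x) = fvar (i x).
Proof.
transitivity (fconst Y 1 * fword (fmu x)); first exact: mmapU.
have -> : fconst Y 1 = 1 by exact: rmorph1.
by rewrite mul1r /fword fmU big_seq1.
Qed.

Lemma free_map_fconst c : free_map (fconst X c) = fconst Y c.
Proof. exact: mmapC. Qed.

Lemma free_map_lin c x y z :
  free_map (fvar z - (fconst X c * fvar x + fvar y)) =
  fvar (i z) - (fconst Y c * fvar (i x) + fvar (i y)).
Proof.
apply: etrans (free_mapB _ _) _; apply: congr2; first exact: free_map_fvar.
apply: congr1; apply: etrans (free_mapD _ _) _; apply: congr2; last exact: free_map_fvar.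
apply: etrans (free_mapM _ _) _; apply: congr2; last exact: free_map_fvar.
exact: free_map_fconst.
Qed.

Lemma free_map_bracket x y z :
  free_map (fvar x * fvar y - fvar y * fvar x - fvar z) =
  fvar (i x) * fvar (i y) - fvar (i y) * fvar (i x) - fvar (i z).
Proof.
have fM u w : free_map (fvar u * fvar w) = fvar (i u) * fvar (i w).
  apply: etrans (free_mapM _ _) _; apply: congr2; exact: free_map_fvar.
apply: etrans (free_mapB _ _) _; apply: congr2.
  apply: etrans (free_mapB _ _) _; apply: congr2; first exact: fM.
  by apply: congr1; exact: fM.
by apply: congr1; exact: free_map_fvar.
Qed.

End FreeAlgebra.
Module Exports. HB.reexport. End Exports.
End FreeAlgebra.
Export FreeAlgebra.Exports.
Export FreeAlgebra.

Section Enveloping.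
Variables (F : fieldType) (n : nat).
Implicit Types L K : {vspace 'M[F]_n}.

(* The bracket and the p-map of gl_n are [x, y] = xy - yx and x^[p] = x^p;    *)
(* L is a (restricted) Lie subalgebra of gl_n.                                *)
Definition lie_bracket (x y : 'M[F]_n) : 'M[F]_n := x *m y - y *m x.

Inductive univ_rel L : free_alg F (subvs_of L) -> Prop :=
| UnivLin c (x y : subvs_of L) :
    univ_rel (fvar F (c *: x + y) - (fconst _ c * fvar F x + fvar F y))
| UnivBracket (x y z : subvs_of L) : vsval z = lie_bracket (vsval x) (vsval y) ->
    univ_rel (fvar F x * fvar F y - fvar F y * fvar F x - fvar F z).

Definition univ_env L : pzRingType := ring_quot (@univ_rel L).

Definition uvar L (x : subvs_of L) : univ_env L := to_quot _ (fvar F x).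
Definition uconst L (c : F) : univ_env L := to_quot _ (fconst _ c).

Variables (p : nat) (psi : 'M[F]_n -> F).

Inductive reduced_rel L : univ_env L -> Prop :=
| ReducedPower (x y : subvs_of L) : vsval y = vsval x ^+ p ->
    reduced_rel (uvar x ^+ p - uvar y - uconst L (psi (vsval x) ^+ p)).

Definition reduced_env L : pzRingType := ring_quot (@reduced_rel L).

(* The image of x in u_psi(L), for x in L. *)
Definition rvar L (x : 'M[F]_n) : reduced_env L := to_quot _ (uvar (vsproj L x)).
Definition rconst L (c : F) : reduced_env L := to_quot _ (uconst L c).

(* The algebra map u_psi(K) -> u_psi(L) induced by an inclusion K <= L. *)
Definition univ_incl K L : univ_env K -> univ_env L :=
  quot_map (@univ_rel L) (@free_map F _ _ (fun x : subvs_of K => vsproj L (vsval x))).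
Definition reduced_incl K L : reduced_env K -> reduced_env L :=
  quot_map (@reduced_rel L) (@univ_incl K L).

Section Inclusion.
Variables (K L : {vspace 'M[F]_n}).
Hypothesis sKL : (K <= L)%VS.

Let vsprojKL (x : subvs_of K) : vsval (vsproj L (vsval x)) = vsval x.
Proof. by apply: vsprojK; apply: (subvP sKL); apply: subvsP. Qed.

Let univ_relKL a : univ_rel a ->
  ideal_span (@univ_rel L) (@free_map F _ _ (fun x : subvs_of K => vsproj L (vsval x)) a).
Proof.
case=> [c x y|x y z xyz]; apply: ideal_spanP.
  rewrite free_map_lin !linearP.
  exact: UnivLin.
rewrite free_map_bracket.
by apply: UnivBracket; rewrite !vsprojKL.
Qed.

Lemma univ_incl_is_zmod_morphism : zmod_morphism (@univ_incl K L).
Proof. exact: quot_map_zmod_morphism univ_relKL. Qed.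

Lemma univ_incl_is_monoid_morphism : monoid_morphism (@univ_incl K L).
Proof. exact: quot_map_monoid_morphism univ_relKL. Qed.

Lemma univ_incl_uvar (x : subvs_of K) :
  univ_incl L (uvar x) = uvar (vsproj L (vsval x)).
Proof. by rewrite /univ_incl quot_map_to_quot /= ?free_map_fvar. Qed.

Lemma univ_incl_uconst c : univ_incl L (uconst K c) = uconst L c.
Proof. by rewrite /univ_incl quot_map_to_quot /= ?free_map_fconst. Qed.

Let univ_inclM : {rmorphism univ_env K -> univ_env L} :=
  HB.pack (@univ_incl K L)
    (GRing.isZmodMorphism.Build _ _ _ univ_incl_is_zmod_morphism)
    (GRing.isMonoidMorphism.Build _ _ _ univ_incl_is_monoid_morphism).

Let reduced_relKL a : reduced_rel a -> ideal_span (@reduced_rel L) (univ_inclM a).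
Proof.
case=> x y xy; apply: ideal_spanP.
rewrite !rmorphB rmorphXn /= !univ_incl_uvar univ_incl_uconst.
have := @ReducedPower L (vsproj L (vsval x)) (vsproj L (vsval y)).
by rewrite !vsprojKL => /(_ xy).
Qed.

Lemma reduced_incl_is_zmod_morphism : zmod_morphism (@reduced_incl K L).
Proof. exact: quot_map_zmod_morphism reduced_relKL. Qed.

Lemma reduced_incl_is_monoid_morphism : monoid_morphism (@reduced_incl K L).
Proof. exact: quot_map_monoid_morphism reduced_relKL. Qed.

Lemma reduced_incl_rvar x : x \in K -> reduced_incl L (rvar K x) = rvar L x.
Proof.
move=> xK; rewrite /reduced_incl (quot_map_to_quot reduced_relKL) /=.
by rewrite univ_incl_uvar vsprojK.
Qed.

Lemma reduced_incl_rconst c : reduced_incl L (rconst K c) = rconst L c.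
Proof.
rewrite /reduced_incl (quot_map_to_quot reduced_relKL) /=.
by rewrite univ_incl_uconst.
Qed.

End Inclusion.
End Enveloping.

Definition submodule (A : pzRingType) (M : lmodType A) (N : M -> Prop) : Prop :=
  [/\ N 0, forall x y, N x -> N y -> N (x + y) & forall a x, N x -> N (a *: x)].

Definition simple_module (A : pzRingType) (M : lmodType A) : Prop :=
  (exists x : M, x != 0) /\
  forall N : M -> Prop, submodule N -> (forall x, N x -> x = 0) \/ (forall x, N x).

Definition generated_by (A : pzRingType) (M : lmodType A) (v : M) : Prop :=
  forall N : M -> Prop, submodule N -> N v -> forall x, N x.

Section SubspaceOf.
Variables (F : fieldType) (V : vectType F).

(* The subspace whose elements are the vectors satisfying P (0 if there is    *)
(* none, i.e. if P is not closed under linear combinations).                  *)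
Definition vspace_of (P : V -> Prop) : {vspace V} :=
  if pselect (exists U : {vspace V}, forall x, x \in U <-> P x) is left exU
  then projT1 (cid exU) else 0%VS.

Lemma vspace_ofP (P : V -> Prop) :
  P 0 -> (forall a x y, P x -> P y -> P (a *: x + y)) ->
  forall x, x \in vspace_of P <-> P x.
Proof.
move=> P0 PL; rewrite /vspace_of; case: pselect => [exU | []].
  by case: (cid exU).
have [U [sUP maxU]] : exists U : {vspace V}, (forall x, x \in U -> P x) /\
    (forall x, P x -> x \in U).
  pose Q d := `[< exists U : {vspace V}, \dim U = d /\ forall x, x \in U -> P x >].
  have exQ : exists d, Q d.
    exists 0%N; apply/asboolP; exists 0%VS; rewrite dimv0; split=> // x.
    by rewrite memv0 => /eqP ->.
  have ubQ d : Q d -> (d <= \dim (fullv : {vspace V}))%N.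
    by move/asboolP=> [U [<- _]]; apply/dimvS/subvf.
  have [d /asboolP[U [dU sUP]] maxd] := ex_maxnP exQ ubQ.
  exists U; split=> // x Px.
  have sUxP y : y \in (<[x]> + U)%VS -> P y.
    case/memv_addP=> _ /vlineP[a ->] [u uU ->].
    by apply: PL => //; apply: sUP.
  have : (\dim (<[x]> + U) <= d)%N by apply: maxd; apply/asboolP; exists (<[x]> + U)%VS.
  rewrite -dU => le_dim; have sU : (U <= <[x]> + U)%VS by apply: addvSr.
  have /eqP <- : (<[x]> + U)%VS == U by rewrite eq_sym eqEdim sU.
  by apply: (subvP (addvSl _ _)); apply: memv_line.
by exists U => x; split; [apply: sUP | apply: maxU].
Qed.

End SubspaceOf.

(* A linear form on U, extended to V; only its values on U are ever used. *)
Definition on_ambient (F : fieldType) (V : vectType F) (U : {vspace V})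
    (chi : {scalar subvs_of U}) (x : V) : F := chi (vsproj U x).

Section Polynomials.
Import mpoly.
Variables (F : fieldType) (n : nat).

Definition mx_poly : Type := {mpoly F[n * n]}.

Definition mx_eval (f : mx_poly) (g : 'M[F]_n) : F := f.@[fun k => mxvec g 0 k].

(* d f_1 (X), the differential of f at the identity. *)
Definition mx_diff1 (f : mx_poly) (X : 'M[F]_n) : F :=
  \sum_k (f^`M(k)).@[fun l => mxvec (1%:M : 'M[F]_n) 0 l] * mxvec X 0 k.

Lemma mx_diff1P f a X Y : mx_diff1 f (a *: X + Y) = a * mx_diff1 f X + mx_diff1 f Y.
Proof.
rewrite /mx_diff1 mulr_sumr -big_split /=; apply: eq_bigr => k _.
by rewrite linearP !mxE mulrDr mulrCA.
Qed.

End Polynomials.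

Section AlgebraicGroups.
Variable F : fieldType.

Section InGL.
Variable n : nat.
Implicit Types (X Y T U : 'M[F]_n -> Prop) (f : mx_poly F n) (g h x y t : 'M[F]_n).

Definition subset_of X Y : Prop := forall g, X g -> Y g.

Definition zariski_closed X : Prop :=
  exists S : mx_poly F n -> Prop,
    forall g, X g <-> g \in unitmx /\ (forall f, S f -> mx_eval f g = 0).

Definition is_subgroup X : Prop :=
  [/\ X 1%:M, forall g h, X g -> X h -> X (g *m h) & forall g, X g -> X (invmx g)].

Definition alg_group X : Prop := zariski_closed X /\ is_subgroup X.

Definition zariski_connected X : Prop :=
  forall C D, zariski_closed C -> zariski_closed D ->
    (forall g, X g -> C g \/ D g) -> (forall g, X g -> C g -> D g -> False) ->
    subset_of X C \/ subset_of X D.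

Definition identity_component X : 'M[F]_n -> Prop := fun g =>
  exists Y, [/\ subset_of Y X, zariski_connected Y, Y 1%:M & Y g].

Definition unipotent X : Prop := forall g, X g -> exists k, (g - 1%:M) ^+ k = 0.

Definition normal_in U X : Prop :=
  forall g u, X g -> U u -> U (g *m u *m invmx g).

(* Reductive groups are taken to be connected; the last clause says that the  *)
(* unipotent radical is trivial.                                              *)
Definition reductive X : Prop :=
  [/\ alg_group X, zariski_connected X &
      forall U, alg_group U -> zariski_connected U -> unipotent U -> subset_of U X ->
        normal_in U X -> forall u, U u -> u = 1%:M].

Definition derived_group X : 'M[F]_n -> Prop := fun g =>
  forall H, is_subgroup H ->
    (forall x y, X x -> X y -> H (x *m y *m invmx x *m invmx y)) -> H g.

Definition centralizer X Y : 'M[F]_n -> Prop := fun g =>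
  X g /\ forall h, Y h -> g *m h = h *m g.

Definition regular_fun X (a : 'M[F]_n -> F) : Prop :=
  exists (f : mx_poly F n) (k : nat), forall g, X g -> a g = mx_eval f g / \det g ^+ k.

Definition tangent X (x : 'M[F]_n) : Prop :=
  forall f, (forall g, X g -> mx_eval f g = 0) -> mx_diff1 f x = 0.

Definition lie X : {vspace 'M[F]_n} := vspace_of (tangent X).

Lemma lieP X x : x \in lie X <-> tangent X x.
Proof.
apply: vspace_ofP => [f _ | a y z Ty Tz f fX].
  have := mx_diff1P f (-1) 0 0; rewrite scaler0 addr0 mulN1r addNr.
  exact.
by rewrite mx_diff1P Ty // Tz // mulr0 addr0.
Qed.

End InGL.

Definition group_morphism m n (X : 'M[F]_m -> Prop) (Y : 'M[F]_n -> Prop)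
    (phi : 'M[F]_m -> 'M[F]_n) : Prop :=
  [/\ forall g, X g -> Y (phi g),
      forall g h, X g -> X h -> phi (g *m h) = phi g *m phi h &
      forall i j, regular_fun X (fun g => phi g i j)].

Definition group_isomorphic m n (X : 'M[F]_m -> Prop) (Y : 'M[F]_n -> Prop) : Prop :=
  exists phi psi, [/\ group_morphism X Y phi, group_morphism Y X psi,
    forall g, X g -> psi (phi g) = g & forall g, Y g -> phi (psi g) = g].

Definition diag_group r : 'M[F]_r -> Prop := fun d => is_diag_mx d /\ d \in unitmx.

Definition torus n (T : 'M[F]_n -> Prop) : Prop :=
  alg_group T /\ exists r, group_isomorphic (@diag_group r) T.

Definition maximal_torus n (X T : 'M[F]_n -> Prop) : Prop :=
  [/\ torus T, subset_of T X &
      forall T', torus T' -> subset_of T' X -> subset_of T T' -> subset_of T' T].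

Section Roots.
Variable n : nat.
Implicit Types (X T : 'M[F]_n -> Prop) (a : 'M[F]_n -> F) (phi : F -> 'M[F]_n).

Definition is_character T a : Prop :=
  [/\ forall t, T t -> a t != 0,
      forall s t, T s -> T t -> a (s *m t) = a s * a t & regular_fun T a].

(* Only the values of phi on the nonzero scalars are relevant. *)
Definition is_cocharacter T phi : Prop :=
  [/\ forall c, c != 0 -> T (phi c),
      forall c d, c != 0 -> d != 0 -> phi (c * d) = phi c *m phi d &
      forall i j, exists (q : {poly F}) (k : nat),
        forall c, c != 0 -> phi c i j = q.[c] / c ^+ k].

Definition pairing a phi (m : int) : Prop := forall c, c != 0 -> a (phi c) = c ^ m.

Definition weight_space X T a : {vspace 'M[F]_n} :=
  vspace_of (fun x => x \in lie X /\ forall t, T t -> t *m x *m invmx t = a t *: x).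

Lemma weight_spaceP X T a x : x \in weight_space X T a <->
  x \in lie X /\ forall t, T t -> t *m x *m invmx t = a t *: x.
Proof.
apply: vspace_ofP => [|c y z [Xy Ty] [Xz Tz]].
  by split=> [|t _]; rewrite ?mem0v // mulmx0 mul0mx scaler0.
split=> [|t Tt]; first by rewrite memvD ?memvZ.
rewrite mulmxDr mulmxDl -scalemxAr -scalemxAl Ty // Tz //.
by rewrite scalerDr !scalerA mulrC.
Qed.

Definition is_root X T a : Prop :=
  [/\ is_character T a, ~ (forall t, T t -> a t = 1) & weight_space X T a <> 0%VS].

(* The coroot of a is the cocharacter phi of T with <a, phi> = 2 and image in *)
(* the derived group of the centralizer of (ker a)^0.                         *)
Definition is_coroot X T a phi : Prop :=
  [/\ is_cocharacter T phi, pairing a phi 2 &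
      forall c, c != 0 ->
        derived_group (centralizer X (identity_component (fun t => T t /\ a t = 1))) (phi c)].

(* A semisimple group is simply connected when the coroots generate the       *)
(* cocharacter lattice of its maximal tori.                                   *)
Definition simply_connected X : Prop :=
  forall T phi, maximal_torus X T -> is_cocharacter T phi ->
    exists (r : nat) (co : 'I_r -> F -> 'M[F]_n) (m : 'I_r -> int),
      (forall k, exists2 a, is_root X T a & is_coroot X T a (co k)) /\
      forall c, c != 0 -> phi c = \prod_(k < r) co k (c ^ m k).

Definition has_invariant_form X : Prop :=
  exists B : subvs_of (lie X) -> subvs_of (lie X) -> F,
    [/\ forall x, scalar (B x), forall y, scalar (B^~ y),
        forall g x y x' y', X g ->
          vsval x' = g *m vsval x *m invmx g -> vsval y' = g *m vsval y *m invmx g ->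
          B x' y' = B x y &
        forall x, (forall y, B x y = 0) -> x = 0].

End Roots.
End AlgebraicGroups.

Section RootSystem.
Variables (F : fieldType) (n : nat) (G T : 'M[F]_n -> Prop).
(* The roots of G with respect to T are the restrictions to T of the rt a,    *)
(* for a : Phi; characters are written multiplicatively. The coroot of rt a   *)
(* is co a, and rt (opp a) is the opposite root.                              *)
Variables (Phi : finType) (rt : Phi -> 'M[F]_n -> F) (co : Phi -> F -> 'M[F]_n).
Variable opp : Phi -> Phi.

Definition root_system : Prop :=
  [/\ forall a, is_root G T (rt a) /\ is_coroot G T (rt a) (co a),
      forall a b, (forall t, T t -> rt a t = rt b t) -> a = b,
      forall a, is_root G T a -> exists b, forall t, T t -> rt b t = a t &
      forall a t, T t -> rt (opp a) t = (rt a t)^-1].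

Definition root_space (a : Phi) : {vspace 'M[F]_n} := weight_space G T (rt a).

Variables (Pi : {set Phi}) (cf : Phi -> Phi -> int).

(* Additively, a = \sum_(b in Pi) cf a b * b for each root a. *)
Definition root_base : Prop :=
  [/\ forall m : Phi -> int, (forall t, T t -> \prod_(b in Pi) rt b t ^ m b = 1) ->
        forall b, b \in Pi -> m b = 0,
      forall a t, T t -> rt a t = \prod_(b in Pi) rt b t ^ cf a b &
      forall a, (forall b, b \in Pi -> 0 <= cf a b) \/
                (forall b, b \in Pi -> cf a b <= 0)].

Definition pos_roots : {set Phi} := [set a | [forall b in Pi, 0 <= cf a b]].

Definition root_height (a : Phi) : int := \sum_(b in Pi) cf a b.

(* The maximal roots are the highest roots of the irreducible components of   *)
(* Phi; such a root involves exactly the simple roots of its component.       *)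
Definition maximal_root (a : Phi) : Prop :=
  forall b, (forall c, c \in Pi -> cf a c <= cf b c) -> b = a.

Definition good_prime (p : nat) : Prop :=
  forall a b, maximal_root a -> b \in Pi -> cf a b != 0 -> ~~ (p %| `|cf a b|)%N.

(* rt b - r rt a, ..., rt b are roots and rt b - (r + 1) rt a is not. *)
Definition string_length (a b : Phi) (r : nat) : Prop :=
  (forall i, (i <= r)%N -> exists d, forall t, T t -> rt d t = rt b t / rt a t ^+ i) /\
  ~ exists d, forall t, T t -> rt d t = rt b t / rt a t ^+ r.+1.

Variables e h : Phi -> 'M[F]_n.

(* The h b are indexed by b in Pi, and s records the signs of the structure   *)
(* constants. The element h_a of a general root a is the combination of the   *)
(* h b in which a^\vee is a combination of the simple coroots.                *)
Record chevalley_basis : Prop := ChevalleyBasis {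
  chevalley_basis_of : basis_of (lie (derived_group G))
    ([seq e a | a <- enum Phi] ++ [seq h b | b <- enum Pi]);
  chevalley_root_space : forall a, root_space a = <[e a]>%VS;
  chevalley_hh : forall b c, b \in Pi -> c \in Pi -> lie_bracket (h b) (h c) = 0;
  chevalley_he : forall b a m, b \in Pi -> pairing (rt a) (co b) m ->
    lie_bracket (h b) (e a) = m%:~R *: e a;
  chevalley_ef : forall a (m : Phi -> int),
    (forall c, c != 0 -> co a c = \prod_(b in Pi) co b (c ^ m b)) ->
    lie_bracket (e a) (e (opp a)) = \sum_(b in Pi) (m b)%:~R *: h b;
  chevalley_ee : exists s : Phi -> Phi -> bool,
    (forall a b, s (opp a) (opp b) = ~~ s a b) /\
    forall a b c r, (forall t, T t -> rt c t = rt a t * rt b t) ->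
      string_length a b r ->
      lie_bracket (e a) (e b) = ((-1) ^+ s a b * r.+1%:R) *: e c }.

Definition nilrad_pos : {vspace 'M[F]_n} :=
  (\sum_(a in pos_roots) root_space a)%VS.

Definition nilrad_neg : {vspace 'M[F]_n} :=
  (\sum_(a in pos_roots) root_space (opp a))%VS.

Variable I : {set Phi}.

(* ZI \cap Phi *)
Definition levi_roots : {set Phi} :=
  [set a | `[< exists m : Phi -> int,
                 forall t, T t -> rt a t = \prod_(b in I) rt b t ^ m b >]].

(* Phi^+ \ Phi_I^+ *)
Definition unip_roots : {set Phi} := pos_roots :\: (levi_roots :&: pos_roots).

Definition parabolic : {vspace 'M[F]_n} :=
  (lie T + \sum_(a in levi_roots) root_space a
         + \sum_(a in unip_roots) root_space a)%VS.

Variables (p : nat) (psi : 'M[F]_n -> F) (lam : {scalar subvs_of (lie T)}).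
Variables (K : {vspace 'M[F]_n}) (L : lmodType (reduced_env p psi K)).

Definition maximal_vector (v : L) : Prop :=
  [/\ v != 0,
      forall a, a \in pos_roots -> rvar p psi K (e a) *: v = 0 &
      forall x : subvs_of (lie T),
        rvar p psi K (vsval x) *: v = rconst p psi K (lam x) *: v].

(* u_psi(g) (x)_(u_psi(K)) L, for a restricted subalgebra K of g = Lie(G) *)
Definition induced_module : lmodType (reduced_env p psi (lie G)) :=
  tensor (@reduced_incl F n p psi K (lie G)) L.

End RootSystem.

(* Main.v *)
(* Grade g by the coefficients of the simple roots outside I, so that p_I is  *)
(* the part of degree >= 0; write E and F for the products of the e^(p-1) and  *)
(* of the f^(p-1). A product of homogeneous elements of positive total degree  *)
(* kills 1 (x) L, so E kills f^a (x) L for every reduced monomial f^a other    *)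
(* than F. Let N be a nonzero submodule and x = sum_a f^a (x) w_a a nonzero    *)
(* element of N; if w_a <> 0 with |a| maximal, then E f^(p-1-a) x = EF (x) w_a.*)
(* Elements of degree 0 commute with E and F up to scalars and terms killed by *)
(* E, so {w in L | EF (x) w in N} is a submodule of L. It is nonzero, hence    *)
(* contains v, and R (x) v = EF (x) v lies in N.                               *)
(* That the induced module is nonzero is an instance of the PBW theorem. Here  *)
(* linear independence of the reduced monomials comes from letting u_psi(g)    *)
(* act on the polynomial functions on matrices by left invariant vector fields *)
(* y, each corrected by the function X |-> psi (X y), and evaluating at 1.     *)

(* Grade g by the total coefficient of the simple roots outside [I]: p_I is the part of degree at
   least 0, [betas] lists the roots of positive degree, and [opp] reverses the degree. The positive
   part kills v, hence all of L ([pos_kills]), so a product of homogeneous elements of positive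
   total degree kills 1 (x) L ([positive_degree_tens]). The induced module Z is the sum of the f^a
   (x) L, where f^a runs over the monomials in the negative root vectors with exponents below p. Let
   E and Fn be the top monomials of the two sides. Their degrees are opposite, so E f^a kills 1 (x)
   L unless f^a = Fn ([nontop_killed]): multiplication by E isolates the coefficient of Fn.

   Take a nonzero element of a submodule N and a longest f^d that occurs in it, with coefficient w.
   Multiplication by the complementary monomial brings this term to the top and all others below it
   ([complementary_monomial]), so applying E gives E Fn (x) w in N. The vectors w with E Fn (x) w in
   N form a submodule of L ([preimage_submodule]), since elements of degree 0 commute with E up to a
   multiple of E and with Fn up to a multiple of Fn and lower monomials ([commutes_E],
   [commutes_Fn]). By simplicity of L it contains v, and E Fn (x) v = R (x) v with R invertible, so
   N contains the generator 1 (x) v and is everything ([graded_induction_simple]). The two sides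
   differ in one respect: psi vanishes in positive degree, so e^p stays homogeneous, whereas f^p may
   acquire the scalar psi(f)^p; the negative side is therefore only filtered by length.

   That 1 (x) v is nonzero rests on the independence of the reduced monomials ([pbw_independent]),
   which yields a right-linear projection of u_psi(g) onto u_psi(p_I) and so a map from Z to L
   ([tens1_neq0]). Independence is proved by letting g act on functions by first-order differential
   operators ([rep_bracket], [iter_rep]) and pairing words with products of coordinates at the
   identity. The p-th power relation holds there only up to multiplication by a function that
   vanishes at 1 and commutes with the action ([pdefect]); evaluation at 1 removes it.

   The grading is compatible with bracket and p-map because a vector of a given T-weight involves
   only basis vectors of that weight ([weight_lincomb]). *)
From HB Require Import structures.
Require Import Defs.
From mathcomp Require Import all_boot all_order all_algebra.
From mathcomp Require Import ring zify.
From mathcomp Require finmap mpoly monalg boolp.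

Set Implicit Arguments.
Unset Strict Implicit.
Unset Printing Implicit Defensive.

Import Order.TTheory GRing.Theory Num.Theory.
Local Open Scope ring_scope.

(** * Straightening words in a ring with central scalars *)

Section Span.
Variables (F : fieldType) (A : pzRingType) (c : {rmorphism F -> A}).
Hypothesis cC : forall s x, c s * x = x * c s.
Implicit Types (S : A -> Prop) (x y z : A).

Inductive linspan S : A -> Prop :=
| linspan0 : linspan S 0
| linspanD x y : linspan S x -> linspan S y -> linspan S (x + y)
| linspanZ s x : linspan S x -> linspan S (c s * x)
| linspan_gen x : S x -> linspan S x.

Lemma linspan_sum S (K : Type) (r : seq K) (Q : pred K) (f : K -> A) :
  (forall k, Q k -> linspan S (f k)) -> linspan S (\sum_(k <- r | Q k) f k).
Proof. by move=> Sf; apply: big_ind => //; [apply: linspan0 | apply: linspanD]. Qed.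

Lemma linspan_bind S S' (f : A -> A) x :
  f 0 = 0 -> {morph f : y z / y + z} -> (forall s y, f (c s * y) = c s * f y) ->
  (forall y, S y -> linspan S' (f y)) -> linspan S x -> linspan S' (f x).
Proof.
move=> f0 fD fZ Sf; elim=> {x} [|x y _ Sx _ Sy|s x _ Sx|//].
- by rewrite f0; apply: linspan0.
- by rewrite fD; apply: linspanD.
- by rewrite fZ; apply: linspanZ.
Qed.

Lemma linspan_sub S S' x : (forall y, S y -> linspan S' y) -> linspan S x -> linspan S' x.
Proof. by move=> SS'; apply: (@linspan_bind S S' id). Qed.

Lemma linspan_sandwich S S' u v x :
  (forall y, S y -> linspan S' (u * y * v)) -> linspan S x -> linspan S' (u * x * v).
Proof.
move=> H; apply: (@linspan_bind S S' (fun y => u * y * v)) => //.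
- by rewrite mulr0 mul0r.
- by move=> y z; rewrite mulrDr mulrDl.
- by move=> s y; rewrite !mulrA -cC.
Qed.

Lemma linspan_mull S S' u x :
  (forall y, S y -> linspan S' (u * y)) -> linspan S x -> linspan S' (u * x).
Proof.
move=> H Sx; rewrite -[_ * _]mulr1; apply: linspan_sandwich Sx => y Sy.
by rewrite mulr1; apply: H.
Qed.

Lemma linspan_mulr S S' v x :
  (forall y, S y -> linspan S' (y * v)) -> linspan S x -> linspan S' (x * v).
Proof.
move=> H Sx; rewrite -[x]mul1r; apply: linspan_sandwich Sx => y Sy.
by rewrite mul1r; apply: H.
Qed.

Lemma linspan_family (D : finType) (f : D -> A) x :
  linspan (fun y => exists d, y = f d) x -> exists a : D -> F, x = \sum_d c (a d) * f d.
Proof.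
elim=> {x} [|_ _ _ [a ->] _ [b ->]|s _ _ [a ->]|_ [d ->]].
- exists (fun=> 0); rewrite big1 // => d _; by rewrite rmorph0 mul0r.
- exists (fun d => a d + b d).
  by rewrite -big_split; apply: eq_bigr => d _; rewrite rmorphD mulrDl.
- exists (fun d => s * a d).
  by rewrite mulr_sumr; apply: eq_bigr => d _; rewrite rmorphM mulrA.
- exists (fun d' => (d' == d)%:R).
  rewrite (bigD1 d) //= eqxx rmorph1 mul1r big1 ?addr0 // => d' /negPf ->.
  by rewrite rmorph0 mul0r.
Qed.

Section Straightening.
Variables (p : nat) (p_gt1 : (1 < p)%N) (I : eqType) (idx : seq I).
Hypothesis uniq_idx : uniq idx.
Variables (x : I -> A) (wt : I -> nat).

Definition word (s : seq I) : A := \prod_(i <- s) x i.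
Definition mono (a : I -> nat) : A := \prod_(i <- idx) x i ^+ a i.
Definition weight (s : seq I) : nat := \sum_(i <- s) wt i.

Hypothesis bracket_letters : forall i j, i \in idx -> j \in idx ->
  linspan (fun y => exists k, [/\ k \in idx, wt k = (wt i + wt j)%N & y = x k])
    (x i * x j - x j * x i).
Hypothesis power_letter : forall i, i \in idx ->
  linspan (fun y => (exists k, [/\ k \in idx, wt k = (p * wt i)%N & y = x k]) \/
                 (p * wt i = 0)%N /\ y = 1)
    (x i ^+ p).

(** The error terms of straightening. The length bound drives the induction; a nontrivial weight is
    tracked only for [commutes_E], all other uses take weight 0. *)
Definition low (n w : nat) : A -> Prop :=
  linspan (fun y => exists a : I -> nat, [/\ y = mono a,
    forall i, i \in idx -> (a i < p)%N,
    (\sum_(i <- idx) a i < n)%N & \sum_(i <- idx) a i * wt i = w]%N).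

Lemma low_leq m n w y : (m <= n)%N -> low m w y -> low n w y.
Proof.
move=> le_mn; apply: linspan_sub => z [a [-> ared az aw]]; apply: linspan_gen.
by exists a; split=> //; apply: leq_trans le_mn.
Qed.

Lemma word_cat s t : word (s ++ t) = word s * word t.
Proof. by rewrite /word big_cat. Qed.

Lemma word_cons i s : word (i :: s) = x i * word s.
Proof. by rewrite /word big_cons. Qed.

Lemma weight_cat s t : weight (s ++ t) = (weight s + weight t)%N.
Proof. by rewrite /weight big_cat. Qed.

Lemma weight_cons i s : weight (i :: s) = (wt i + weight s)%N.
Proof. by rewrite /weight big_cons. Qed.

Definition flat (a : I -> nat) : seq I := flatten [seq nseq (a i) i | i <- idx].

Lemma word_flat a : word (flat a) = mono a.
Proof.
rewrite /flat /mono; elim: idx => [|i r IHr]; first by rewrite /word !big_nil.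
by rewrite big_cons /= word_cat IHr /word big_nseq -Monoid.iteropE.
Qed.

Lemma count_flat a i : i \in idx -> count_mem i (flat a) = a i.
Proof.
rewrite /flat; elim: idx uniq_idx => //= j r IHr /andP[jr Ur].
rewrite in_cons count_cat count_nseq /= => /orP[/eqP ->|ir].
  rewrite eqxx mul1n; suff -> : count_mem j (flatten [seq nseq (a k) k | k <- r]) = 0%N.
    by rewrite addn0.
  apply/count_memPn; apply: contra jr => /flattenP[_ /mapP[k kr ->]].
  by rewrite mem_nseq => /andP[_ /eqP ->].
case: eqP => [ji|_]; first by rewrite ji ir in jr.
by rewrite IHr.
Qed.

Lemma mem_flat a i : i \in flat a -> i \in idx.
Proof.
case/flattenP=> _ /mapP[k kr ->]; by rewrite mem_nseq => /andP[_ /eqP ->].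
Qed.

Lemma perm_flat s : all (mem idx) s -> perm_eq s (flat (fun i => count_mem i s)).
Proof.
move=> /allP s_idx; apply/allP => i _ /=; apply/eqP.
case idx_i: (i \in idx); first by rewrite count_flat.
rewrite (count_memPn _) ?(count_memPn _) //.
  by apply/negP=> /mem_flat; rewrite idx_i.
by apply/negP=> /s_idx; rewrite /= idx_i.
Qed.

Lemma size_flat a : size (flat a) = (\sum_(i <- idx) a i)%N.
Proof.
rewrite /flat; elim: idx => [|i r IHr]; first by rewrite big_nil.
by rewrite /= size_cat size_nseq IHr big_cons.
Qed.

Lemma weight_flat a : weight (flat a) = (\sum_(i <- idx) a i * wt i)%N.
Proof.
rewrite /flat; elim: idx => [|i r IHr]; first by rewrite /weight !big_nil.
rewrite /= weight_cat IHr big_cons; congr addn.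
by rewrite /weight big_nseq iter_addn addn0 mulnC.
Qed.

Lemma weight_perm s t : perm_eq s t -> weight s = weight t.
Proof. by move=> st; apply: perm_big. Qed.

Section Step.
Variable m : nat.
Hypothesis IH : forall s, all (mem idx) s -> (size s < m)%N ->
  low (size s).+1 (weight s) (word s).

Let IHm s w : all (mem idx) s -> (size s < m)%N -> weight s = w -> low m w (word s).
Proof. by move=> s_idx ltm <-; apply: low_leq (IH s_idx ltm). Qed.

Let swap s i j t : all (mem idx) (s ++ i :: j :: t) -> size (s ++ i :: j :: t) = m ->
  low m (weight (s ++ i :: j :: t)) (word (s ++ i :: j :: t) - word (s ++ j :: i :: t)).
Proof.
rewrite all_cat => /= /and4P[s_idx i_idx j_idx t_idx]; rewrite size_cat /= => sz.
have -> : word (s ++ i :: j :: t) - word (s ++ j :: i :: t)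
    = word s * (x i * x j - x j * x i) * word t.
  by rewrite !word_cat !word_cons mulrBr mulrBl !mulrA.
apply: linspan_sandwich (bracket_letters i_idx j_idx) => _ [k [k_idx wk ->]].
rewrite -mulrA -word_cons -word_cat; apply: IHm.
- by rewrite all_cat s_idx /= k_idx.
- by rewrite size_cat /=; lia.
- by rewrite !weight_cat !weight_cons wk; lia.
Qed.

Let move_front r s i t : all (mem idx) (r ++ s ++ i :: t) -> size (r ++ s ++ i :: t) = m ->
  low m (weight (r ++ s ++ i :: t)) (word (r ++ s ++ i :: t) - word (r ++ i :: s ++ t)).
Proof.
elim: s r => [|j s IHs] r all_s sz; first by rewrite subrr; apply: linspan0.
have w1 : weight (r ++ (j :: s) ++ i :: t) = weight (r ++ j :: i :: s ++ t).
  by rewrite !(weight_cat, weight_cons); lia.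
rewrite -(subrK (word (r ++ j :: i :: s ++ t)) (word (r ++ (j :: s) ++ i :: t))) -addrA.
apply: linspanD.
  by have := IHs (rcons r j); rewrite !cat_rcons; apply.
rewrite w1; apply: swap; last by move: sz; rewrite /= !size_cat /= !size_cat /=; lia.
move: all_s; rewrite !all_cat /= all_cat /=.
by case: (all _ r); case: (all _ s); case: (all _ t); case: (i \in idx); case: (j \in idx).
Qed.

(** Each adjacent transposition costs a bracket, that is, a combination of words one letter shorter
    and of the same weight, to which [IH] applies; the letters of [t] are moved to the front one
    after another. *)
Lemma low_perm r s t : perm_eq s t -> all (mem idx) (r ++ s) -> size (r ++ s) = m ->
  low m (weight (r ++ s)) (word (r ++ s) - word (r ++ t)).
Proof.
elim: t r s => [|i t IHt] r s st all_s sz.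
  by rewrite (perm_nilP st) subrr; apply: linspan0.
have i_s : i \in s by rewrite (perm_mem st) mem_head.
case/splitPr: i_s st all_s sz => s1 s2 st all_s sz.
have st' : perm_eq (s1 ++ s2) t.
  by move: st; rewrite perm_catC /= perm_cons perm_catC.
rewrite -(subrK (word (r ++ i :: s1 ++ s2)) (word (r ++ s1 ++ i :: s2))) -addrA.
apply: linspanD; first exact: move_front.
have -> : weight (r ++ s1 ++ i :: s2) = weight (r ++ i :: s1 ++ s2).
  by rewrite !(weight_cat, weight_cons); lia.
have := IHt (rcons r i) _ st'; rewrite !cat_rcons; apply.
  by move: all_s; rewrite !all_cat /= all_cat => /and4P[-> -> -> ->].
by move: sz; rewrite !size_cat /= !size_cat; lia.
Qed.

End Step.

(* Modulo shorter reduced monomials, letters commute and a p-th power vanishes. *)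
Lemma straighten s : all (mem idx) s ->
  low (size s) (weight s) (word s - (if all (fun i => count_mem i s < p)%N idx
                                     then mono (fun i => count_mem i s) else 0)).
Proof.
have [m sz] : exists m, size s = m by exists (size s).
elim/ltn_ind: m s sz => m IHm s sz s_idx.
have IH t : all (mem idx) t -> (size t < m)%N -> low (size t).+1 (weight t) (word t).
  move=> t_idx t_lt; have := IHm _ t_lt t erefl t_idx.
  case: ifP => [/allP red|_]; last by rewrite subr0; apply: low_leq.
  move/(low_leq (leqnSn _)) => Lt; rewrite -[word t](subrK (mono (fun i => count_mem i t))).
  apply: linspanD => //; apply: linspan_gen; exists (fun i => count_mem i t).
  have pt := perm_flat t_idx.
  split=> //; last by rewrite -weight_flat (weight_perm pt).
  by rewrite -size_flat (perm_size pt).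
rewrite sz; case: ifP => [_|/negbT].
  rewrite -word_flat; exact: (@low_perm m IH [::] _ _ (perm_flat s_idx)).
case/allPn=> i i_idx /=; rewrite -leqNgt => ge_p; rewrite subr0.
(* Gather p copies of an overfull letter in front. Their product is a combination of single letters
   and perhaps 1, and p > 1 makes the resulting words shorter. *)
pose t := nseq (count_mem i s - p) i ++ filter (predC1 i) s.
have st : perm_eq s (nseq p i ++ t).
  rewrite /t catA -nseqD subnKC // perm_sym.
  have -> : nseq (count_mem i s) i = filter (pred1 i) s.
    by rewrite -size_filter; apply/esym/all_pred1P/filter_all.
  by rewrite perm_filterC.
have t_idx : all (mem idx) t.
  rewrite all_cat all_nseq /= i_idx orbT /=.
  by apply/allP=> j; rewrite mem_filter => /andP[_ js]; apply: (allP s_idx).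
have sz_t : (size t + p = m)%N.
  by rewrite -sz (perm_size st) size_cat size_nseq addnC.
have wst : weight s = (p * wt i + weight t)%N.
  by rewrite (weight_perm st) weight_cat /weight big_nseq iter_addn addn0 mulnC.
rewrite -(subrK (word (nseq p i ++ t)) (word s)).
apply: linspanD; first exact: (@low_perm m IH [::] _ _ st).
rewrite word_cat {1}/word big_nseq -Monoid.iteropE.
apply: linspan_mulr (power_letter i_idx) => _ [[k [k_idx wk ->]]|[w0 ->]].
  rewrite -word_cons wst -wk -weight_cons.
  apply: low_leq (IH (k :: t) _ _) => //=; first by rewrite /= -sz_t; lia.
    by rewrite k_idx.
  by rewrite -sz_t; lia.
rewrite mul1r wst w0 add0n.
by apply: low_leq (IH t t_idx _) => //; rewrite -sz_t; lia.
Qed.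

Lemma straighten_low s : all (mem idx) s -> low (size s).+1 (weight s) (word s).
Proof.
move=> s_idx; have := straighten s_idx; case: ifP => [/allP red|_]; last first.
  by rewrite subr0; apply: low_leq.
move/(low_leq (leqnSn _)) => low_s; rewrite -[word s](subrK (mono (fun i => count_mem i s))).
apply: linspanD => //; apply: linspan_gen; exists (fun i => count_mem i s).
have ps := perm_flat s_idx; split=> //; last by rewrite -weight_flat (weight_perm ps).
by rewrite -size_flat (perm_size ps).
Qed.

(** The commutator with y is a derivation, so it changes one letter of the word at a time. *)
Lemma commutator_word y : (forall i, i \in idx ->
    linspan (fun a => exists k, [/\ k \in idx, wt k = wt i & a = x k]) (y * x i - x i * y)) ->
  forall s, all (mem idx) s ->
  linspan (fun a => exists t, [/\ all (mem idx) t, size t = size s, weight t = weight s &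
    a = word t]) (y * word s - word s * y).
Proof.
move=> comm_y; elim=> [|i s IHs] /=.
  by rewrite /word big_nil mulr1 mul1r subrr => _; apply: linspan0.
case/andP=> i_idx s_idx; rewrite word_cons.
have -> : y * (x i * word s) - x i * word s * y =
    (y * x i - x i * y) * word s + x i * (y * word s - word s * y).
  by rewrite mulrBl mulrBr !mulrA addrA subrK.
apply: linspanD.
  apply: linspan_mulr (comm_y i i_idx) => _ [k [k_idx wk ->]]; apply: linspan_gen.
  by exists (k :: s); rewrite /= k_idx s_idx word_cons !weight_cons wk.
apply: linspan_mull (IHs s_idx) => _ [t [t_idx st wt_t ->]]; apply: linspan_gen.
by exists (i :: t); rewrite /= i_idx t_idx st word_cons !weight_cons wt_t.
Qed.

End Straightening.

Lemma linspan_line e a : linspan (fun y => y = e) a -> exists s, a = c s * e.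
Proof.
elim=> [|_ _ _ [s ->] _ [t ->]|s _ _ [t ->]|_ ->].
- by exists 0; rewrite rmorph0 mul0r.
- by exists (s + t); rewrite rmorphD mulrDl.
- by exists (s * t); rewrite rmorphM mulrA.
- by exists 1; rewrite rmorph1 mul1r.
Qed.

End Span.

(** * Vector fields on matrices, and the Lie algebra of an algebraic group *)

Section IteratedLeibniz.
Variables (O : comNzRingType) (D d : {additive O -> O}).
Hypothesis leibniz : forall h g, D (h * g) = D h * g + h * d g.

(** Keeping D and d distinct covers both a derivation (D = d) and its twist by a multiplication
    operator, where D = d + l. *)
Lemma iter_leibniz m h g : iter m D (h * g) =
  \sum_(i < m.+1) iter i D h * iter (m - i) d g *+ 'C(m, i).
Proof.
elim: m => [|m IHm]; first by rewrite big_ord1 bin0.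
rewrite iterS IHm raddf_sum.
under eq_bigr => i _ do rewrite raddfMn leibniz mulrnDl.
rewrite big_split [RHS]big_ord_recl bin0 mulr1n.
under [in RHS]eq_bigr => i _ do rewrite lift0 binS subSS mulrnDr.
rewrite big_split [\sum_(i < m.+1) _ *+ 'C(m, i.+1)]big_ord_recr /=.
rewrite bin_small ?mulr0n ?addr0 // addrC addrA; congr (_ + _).
rewrite big_ord_recl bin0 mulr1n subn0; congr (_ + _).
apply: eq_bigr => i _; rewrite lift0 -[d (iter _ _ _)]iterS.
by rewrite -subSn ?ltn_ord ?subSS.
Qed.

Variables (p : nat) (charOp : p \in [pchar O]).

Lemma iter_leibniz_pchar h g : iter p D (h * g) = iter p D h * g + h * iter p d g.
Proof.
case: p charOp (pcharf_prime charOp) => // q char_q q_pr.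
rewrite iter_leibniz big_ord_recl big_ord_recr lift0 subnn bin0 binn !mulr1n.
rewrite big1 => [|i _]; first by rewrite /= add0r addrC.
rewrite lift0.
have /dvdnP[k ->] : (q.+1 %| 'C(q.+1, i.+1))%N by apply: prime_dvd_bin; rewrite //= ltnS.
by rewrite mulrnA -[_ *+ q.+1]mulr_natr (pcharf0 char_q) mulr0.
Qed.
End IteratedLeibniz.

Lemma cross_terms_cancel (R : comNzRingType) (a b c d r s : R) :
  a + b + (c + d) + (- (r + c) - (b + s)) = a - r + (d - s).
Proof. ring. Qed.

Section GenericMatrix.
Import mpoly.
Variables (F : fieldType) (n : nat).
Local Notation P := {mpoly F[n * n]}.
Implicit Types (f : P) (x y g : 'M[F]_n).

Definition generic_mx : 'M[P]_n := vec_mx (\row_k 'X_k).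
Local Notation mxC := (map_mx (@mpolyC (n * n) F)).

(* The left invariant vector field on matrices with value x at the identity. *)
Definition vfield x f : P := \sum_k f^`M(k) * mxvec (generic_mx *m mxC x) 0 k.

Lemma mpoly_gen_ind (Q : P -> Prop) :
  (forall c, Q c%:MP) -> (forall k, Q 'X_k) ->
  (forall f h, Q f -> Q h -> Q (f + h)) -> (forall f h, Q f -> Q h -> Q (f * h)) ->
  forall f, Q f.
Proof.
move=> QC QX QD QM; elim/mpolyind => [|c m f _ _ Qf]; first by rewrite -mpolyC0.
apply: (QD) => //; rewrite -mul_mpolyC; apply: (QM) => //; rewrite mpolyXE_id.
apply: big_ind => [||i _]; [by rewrite -mpolyC1 | exact: QM |].
by elim: (m i) => [|k Qk]; rewrite ?expr0 -?mpolyC1 // exprS; apply: (QM).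
Qed.

(** The map [s] lets this serve for ordinary derivations ([s] the identity) and for their composites
    with a left translation ([s] equal to [ltrans g]). *)
Lemma derivation_ext (d1 d2 s : P -> P) :
  (forall c, d1 c%:MP = d2 c%:MP) -> (forall k, d1 'X_k = d2 'X_k) ->
  {morph d1 : f h / f + h} -> {morph d2 : f h / f + h} ->
  (forall f h, d1 (f * h) = d1 f * s h + s f * d1 h) ->
  (forall f h, d2 (f * h) = d2 f * s h + s f * d2 h) -> d1 =1 d2.
Proof.
move=> eqC eqX D1 D2 M1 M2; elim/mpoly_gen_ind => // f h e1 e2.
  by rewrite D1 D2 e1 e2.
by rewrite M1 M2 e1 e2.
Qed.

Fact vfield_is_zmod_morphism x : zmod_morphism (vfield x).
Proof.
move=> f h; rewrite /vfield -sumrB; apply: eq_bigr => k _.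
by rewrite mderivB mulrBl.
Qed.
HB.instance Definition _ x :=
  GRing.isZmodMorphism.Build P P (vfield x) (vfield_is_zmod_morphism x).

Lemma vfieldM x f h : vfield x (f * h) = vfield x f * h + f * vfield x h.
Proof.
rewrite /vfield mulr_suml mulr_sumr -big_split; apply: eq_bigr => k _ /=.
by rewrite mderivM mulrDl mulrA mulrAC.
Qed.

Lemma vfieldC x c : vfield x c%:MP = 0.
Proof. by rewrite /vfield big1 // => k _; rewrite mderivC mul0r. Qed.

Lemma vfieldZ x c f : vfield x (c *: f) = c *: vfield x f.
Proof. by rewrite -!mul_mpolyC vfieldM vfieldC mul0r add0r. Qed.

Lemma vfieldX x k : vfield x 'X_k = mxvec (generic_mx *m mxC x) 0 k.
Proof.
rewrite /vfield (bigD1 k) //= big1 => [|l lk].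
  rewrite mderivX mnm1E eqxx scale1r.
  have -> : (U_(k) - U_(k) = 0)%MM by apply/mnmP=> i; rewrite mnmBE mnm0E subnn.
  by rewrite mpolyX0 mul1r addr0.
by rewrite mderivX mnm1E eq_sym (negPf lk) scale0r mul0r.
Qed.

Lemma generic_mxE i j : generic_mx i j = 'X_(mxvec_index i j).
Proof. by rewrite !mxE. Qed.

Lemma vfield_gen x i j : vfield x 'X_(mxvec_index i j) = (generic_mx *m mxC x) i j.
Proof. by rewrite vfieldX mxvecE. Qed.

Lemma vfield_generic x (y : 'M[F]_n) i j :
  vfield x ((generic_mx *m mxC y) i j) = (generic_mx *m mxC (x *m y)) i j.
Proof.
rewrite map_mxM mulmxA [RHS]mxE [X in vfield x X]mxE raddf_sum.
apply: eq_bigr => l _ /=; rewrite vfieldM [map_mx _ y l j]mxE vfieldC mulr0 addr0.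
by rewrite generic_mxE vfield_gen.
Qed.

(** Both sides are derivations, and on the entries of the generic matrix X the field of x sends X y
    to X x y. *)
Lemma vfield_comm x y f :
  vfield x (vfield y f) - vfield y (vfield x f) = vfield (lie_bracket x y) f.
Proof.
apply: (@derivation_ext (fun f => vfield x (vfield y f) - vfield y (vfield x f)) _ id).
- by move=> c; rewrite !vfieldC !raddf0 addr0.
- move=> k; case/mxvec_indexP: k => i j; rewrite (vfield_gen y) (vfield_gen x) (vfield_gen (_ x y)).
  rewrite (vfield_generic x y) (vfield_generic y x).
  by rewrite /lie_bracket map_mxB mulmxBr [RHS]mxE; congr (_ + _); rewrite [RHS]mxE.
- by move=> f1 f2; rewrite !raddfD /= addrACA.
- by move=> f1 f2; rewrite !raddfD.
- move=> f1 f2; rewrite !vfieldM !raddfD /= !vfieldM mulrBl mulrBr.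
  exact: cross_terms_cancel.
- by move=> f1 f2; rewrite vfieldM.
Qed.

Lemma iter_vfieldC m x c : iter m.+1 (vfield x) c%:MP = 0.
Proof. by elim: m => [|m IHm]; [exact: vfieldC | rewrite iterS IHm raddf0]. Qed.

Lemma iter_vfield_generic m x i j :
  iter m (vfield x) (generic_mx i j) = (generic_mx *m mxC (x ^+ m)) i j.
Proof.
elim: m => [|m IHm] /=; first by rewrite map_mx1 mulmx1.
by rewrite IHm (vfield_generic x (x ^+ m)) -[x *m _]/(x * _) -exprS.
Qed.

Lemma iter_vfieldD m x f h : 
  iter m (vfield x) (f + h) = iter m (vfield x) f + iter m (vfield x) h.
Proof. by elim: m => //= m ->; rewrite raddfD. Qed.

(** In characteristic p the p-th power of a derivation is a derivation; both sides send the generic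
    matrix X to X x^p. *)
Lemma iter_vfield_pchar p x f : p \in [pchar F] -> iter p (vfield x) f = vfield (x ^+ p) f.
Proof.
move=> char_p; have char_p' : p \in [pchar P].
  by rewrite pchar_lalg.
apply: (@derivation_ext (iter p (vfield x)) _ id).
- by move=> c; rewrite vfieldC -(prednK (prime_gt0 (pcharf_prime char_p))) iter_vfieldC.
- move=> k; case/mxvec_indexP: k => i j.
  by rewrite vfield_gen -iter_vfield_generic generic_mxE.
- exact: iter_vfieldD.
- by move=> f1 f2; rewrite raddfD.
- move=> f1 f2; apply: iter_leibniz_pchar char_p' _ _ => a b; exact: vfieldM.
- by move=> f1 f2; rewrite vfieldM.
Qed.

Definition ltrans g f : P := f \mPo [tuple mxvec (mxC g *m generic_mx) 0 k | k < n * n].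

Lemma mx_eval_ltrans g h f : mx_eval (ltrans g f) h = mx_eval f (g *m h).
Proof.
rewrite /mx_eval /ltrans comp_mpoly_meval; apply: meval_eq => k.
rewrite tnth_mktuple; case/mxvec_indexP: k => i j.
rewrite (mxvecE (mxC g *m generic_mx)) (mxvecE (g *m h)) mxE [RHS]mxE raddf_sum.
apply: eq_bigr => l _ /=.
by rewrite mevalM generic_mxE mevalXU mxvecE mxE mevalC.
Qed.

Lemma ltrans_gen g i j : ltrans g 'X_(mxvec_index i j) = (mxC g *m generic_mx) i j.
Proof. by rewrite /ltrans comp_mpolyXU -tnth_nth tnth_mktuple mxvecE. Qed.

Lemma vfield_mulmx x g i j :
  vfield x ((mxC g *m generic_mx) i j) = (mxC g *m generic_mx *m mxC x) i j.
Proof.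
rewrite -mulmxA mxE [RHS]mxE raddf_sum; apply: eq_bigr => l _ /=.
rewrite vfieldM [map_mx _ g i l]mxE vfieldC mul0r add0r; congr (_ * _).
by rewrite generic_mxE vfield_gen.
Qed.

Lemma ltrans_mulmx g x i j :
  ltrans g ((generic_mx *m mxC x) i j) = (mxC g *m generic_mx *m mxC x) i j.
Proof.
rewrite mxE [RHS]mxE /ltrans raddf_sum; apply: eq_bigr => l _ /=.
rewrite rmorphM [mxC x l j]mxE /= comp_mpolyC; congr (_ * _).
by rewrite generic_mxE -/(ltrans g _) ltrans_gen.
Qed.

Lemma vfield_ltrans x g f : vfield x (ltrans g f) = ltrans g (vfield x f).
Proof.
apply: (@derivation_ext (fun f => vfield x (ltrans g f)) (fun f => ltrans g (vfield x f))
  (ltrans g)).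
- by move=> c; rewrite /ltrans comp_mpolyC !vfieldC raddf0.
- move=> k; case/mxvec_indexP: k => i j; rewrite ltrans_gen vfield_gen.
  by rewrite (vfield_mulmx x g) (ltrans_mulmx g x).
- by move=> f1 f2; rewrite /ltrans comp_mpolyD raddfD.
- by move=> f1 f2; rewrite /ltrans raddfD comp_mpolyD.
- by move=> f1 f2; rewrite /ltrans rmorphM vfieldM.
- by move=> f1 f2; rewrite /ltrans vfieldM comp_mpolyD !rmorphM.
Qed.

Lemma mx_eval_generic (g y : 'M[F]_n) i j : mx_eval ((generic_mx *m mxC y) i j) g = (g *m y) i j.
Proof.
rewrite /mx_eval mxE [RHS]mxE raddf_sum; apply: eq_bigr => l _ /=.
by rewrite mevalM generic_mxE mevalXU mxvecE mxE mevalC.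
Qed.

Lemma mx_evalB f h g : mx_eval (f - h) g = mx_eval f g - mx_eval h g.
Proof. exact: mevalB. Qed.

Lemma mx_diff1E f x : mx_diff1 f x = mx_eval (vfield x f) 1%:M.
Proof.
rewrite /mx_eval raddf_sum; apply: eq_bigr => k _ /=; rewrite mevalM; congr (_ * _).
case/mxvec_indexP: k => i j.
by rewrite (mxvecE x) (mxvecE (generic_mx *m mxC x)) [RHS]mx_eval_generic mul1mx.
Qed.

Section AlgebraicGroup.
Variable X : 'M[F]_n -> Prop.
Hypothesis X_mul : forall g h, X g -> X h -> X (g *m h).

(** Tangency at 1 spreads over the group: by left invariance the value of the field at g is the
    differential at 1 of the translate of f by g, and this translate vanishes on [X] too. *)
Lemma vfield_vanishing x f : x \in lie X ->
  (forall g, X g -> mx_eval f g = 0) -> forall g, X g -> mx_eval (vfield x f) g = 0.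
Proof.
move/lieP=> tx fX g Xg; rewrite -[g]mulmx1 -mx_eval_ltrans -vfield_ltrans -mx_diff1E.
by apply: tx => h Xh; rewrite mx_eval_ltrans; apply: fX; apply: X_mul.
Qed.

Hypothesis X1 : X 1%:M.

Lemma lie_bracket_mem x y : x \in lie X -> y \in lie X -> lie_bracket x y \in lie X.
Proof.
move=> Xx Xy; apply/lieP => f fX; rewrite mx_diff1E -vfield_comm mx_evalB.
have vanish u w : u \in lie X -> w \in lie X -> mx_eval (vfield u (vfield w f)) 1%:M = 0.
  move=> Xu Xw; apply: (vfield_vanishing Xu _ X1) => g Xg.
  exact: (vfield_vanishing Xw fX Xg).
exact: etrans (congr2 _ (vanish x y Xx Xy) (congr1 _ (vanish y x Xy Xx))) (subr0 _).
Qed.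

Lemma lie_pchar_mem p x : p \in [pchar F] -> x \in lie X -> x ^+ p \in lie X.
Proof.
move=> char_p Xx; apply/lieP => f fX; rewrite mx_diff1E -(iter_vfield_pchar _ _ char_p).
have vanish m g : X g -> mx_eval (iter m (vfield x) f) g = 0.
  by elim: m g => [|m IHm] g Xg; [exact: fX | exact: (vfield_vanishing Xx IHm Xg)].
exact: vanish.
Qed.
End AlgebraicGroup.

End GenericMatrix.

(** * A representation with p-character psi *)

Section Jacobson.
Variables (O : comNzRingType) (d : {additive O -> O}) (l : O).
Hypothesis derM : forall h g, d (h * g) = d h * g + h * d g.

Definition twist (h : O) : O := d h + l * h.

Fact twist_is_zmod_morphism : zmod_morphism twist.
Proof. by move=> h g; rewrite /twist raddfB mulrBr /= opprD addrACA. Qed.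
HB.instance Definition _ :=
  GRing.isZmodMorphism.Build O O twist twist_is_zmod_morphism.

Lemma twistM h g : twist (h * g) = twist h * g + h * d g.
Proof. by rewrite /twist derM mulrDl mulrA addrAC. Qed.

Lemma der1 : d 1 = 0.
Proof. by apply: (@addrI _ (d 1)); rewrite addr0 -{3}(mulr1 1) derM mulr1 mul1r. Qed.

(* The twist by the multiple s l of l, with s an indeterminate. *)
Let Dp (q : {poly O}) : {poly O} := map_poly d q + (l *: q) * 'X.

Let coefDp q i : (Dp q)`_i = d q`_i + (if i is j.+1 then l * q`_j else 0).
Proof. by rewrite coefD coef_map coefMX; case: i => //= i; rewrite coefZ. Qed.

Let Dp_additive : {morph Dp : q r / q + r}.
Proof. by move=> q r; apply/polyP=> -[|i]; rewrite !(coefDp, coefD) raddfD ?addr0 //=; ring. Qed.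

Let DpZ a q : Dp (a *: q) = d a *: q + a *: Dp q.
Proof.
apply/polyP=> -[|i]; rewrite !(coefDp, coefD, coefZ) derM ?addr0 //.
by rewrite mulrDr !addrA mulrCA.
Qed.

Let deriv_Dp q : (Dp q)^`() = Dp q^`() + l *: q.
Proof.
apply/polyP=> i; rewrite !(coefDp, coefD, coef_deriv, coefZ) raddfMn mulrnDl -addrA.
congr (_ + _); case: i => [|i]; first by rewrite add0r.
by rewrite coef_deriv mulrnAr [in LHS]mulrS addrC.
Qed.

(** The operator (d + s l)^m applied to 1, as a polynomial in s. *)
Let B m := iter m Dp 1.

(** Differentiation in s commutes with d + s l up to multiplication by l ([deriv_Dp]), and Pascal's
    rule collects the terms. For m = p only j = p - 1 survives, leaving the constant d^(p-1) l. *)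
Let deriv_B m : (B m)^`() = \sum_(j < m) (iter j d l *: B (m.-1 - j)) *+ 'C(m, j.+1).
Proof.
elim: m => [|m IHm]; first by rewrite big_ord0 /B derivC.
have DpMn q k : Dp (q *+ k) = Dp q *+ k.
  elim: k => [|k IHk]; last by rewrite !mulrS Dp_additive IHk.
  by apply: (@addrI _ (Dp 0)); rewrite -Dp_additive !addr0.
have Dp0 : Dp 0 = 0 by rewrite -(mulr0n 1) DpMn.
rewrite [B _]/= deriv_Dp IHm (big_morph Dp Dp_additive Dp0).
under eq_bigr => j _ do rewrite DpMn DpZ mulrnDl.
under [in RHS]eq_bigr => j _ do rewrite binS mulrnDr.
rewrite !big_split /= [\sum_(j < m.+1) _ *+ 'C(m, j.+1)]big_ord_recr /=.
rewrite bin_small // mulr0n addr0 [\sum_(j < m.+1) _]big_ord_recl /= bin0 mulr1n subn0.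
rewrite [LHS]addrC addrA [RHS]addrC; congr (_ + _ + _).
  by apply: eq_bigr => j _; rewrite /bump add1n add0n subnS predn_sub.
apply: eq_bigr => j _; have lt_jm := ltn_ord j.
have -> : (m - j = (m.-1 - j).+1)%N by rewrite -predn_sub prednK // subn_gt0.
by [].
Qed.

Let coefB0 m : (0 < m)%N -> (B m)`_0 = 0.
Proof.
case: m => // m _; elim: m => [|m IHm]; rewrite coefDp addr0.
  by rewrite coef1 der1.
by rewrite IHm raddf0.
Qed.

Let coefB_lead m : (B m)`_m = l ^+ m /\ forall i, (m < i)%N -> (B m)`_i = 0.
Proof.
elim: m => [|m [IHm IHi]].
  by rewrite coef1; split=> // -[|i] // _; rewrite coef1.
split=> [|[|i]] //; rewrite coefDp.
  by rewrite IHi // raddf0 add0r IHm exprS.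
by rewrite ltnS => mi; rewrite !IHi ?raddf0 ?mulr0 ?addr0 // ltnW.
Qed.

Let hornerB m : (B m).[1] = iter m twist 1.
Proof.
elim: m => [|m IHm]; first by rewrite hornerC.
rewrite /= -IHm /twist hornerD hornerMX mulr1 hornerZ; congr (_ + _).
rewrite (horner_coef_wide _ (size_poly _ _)) horner_coef raddf_sum.
by apply: eq_bigr => i _; rewrite coef_map !expr1n !mulr1.
Qed.

Variables (p : nat) (charOp : p \in [pchar O]).

Lemma mulrn_coprime_eq0 k (a : O) : coprime k p -> a *+ k = 0 -> a = 0.
Proof.
move=> kp ak; have k_gt0 : (0 < k)%N.
  by case: k kp {ak} => //; rewrite /coprime gcd0n; case: p (pcharf_prime charOp) => [|[]].
have [u v eq_uv _] := egcdnP p k_gt0; move: eq_uv; rewrite (eqP kp) => eq_uv.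
have : a *+ (u * k) = 0 by rewrite mulnC mulrnA ak mul0rn.
rewrite eq_uv mulrnDr mulr1n mulrnA -[_ *+ p]mulr_natr (pcharf0 charOp) mulr0.
by rewrite add0r.
Qed.

(* Jacobson's formula for (d + l)^p: the coefficients of s^2, ..., s^(p-1) in *)
(* (d + s l)^p vanish, because its derivative in s is constant.               *)
Lemma iter_twist_pchar h :
  iter p twist h = iter p d h + iter p.-1 d l * h + l ^+ p * h.
Proof.
(* Writing h as 1 h leaves only the p-th power of the twist at 1 to compute, which is [B p] at s =
   1. *)
rewrite -{1}[h]mul1r (iter_leibniz_pchar twistM charOp) mul1r addrC -addrA -mulrDl.
congr (_ + _ * _); rewrite -hornerB.
have p_pr := pcharf_prime charOp; have p_gt1 := prime_gt1 p_pr.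
have size_B : (size (B p) <= p.+1)%N.
  by apply/leq_sizeP => i lt_pi; have [_ ->] := coefB_lead p.
have derB i : (B p)`_i.+1 *+ i.+1 = if i == 0 then iter p.-1 d l else 0.
  have lt_p1 : (p.-1 < p)%N by rewrite (prednK (ltnW p_gt1)).
  rewrite -coef_deriv deriv_B coef_sum (bigD1 (Ordinal lt_p1)) //= big1 => [|j neq_j].
    rewrite addr0 (prednK (ltnW p_gt1)) subnn binn mulr1n coefZ -[B 0]/(1 : {poly O}) coef1.
    by case: (i == 0); rewrite ?mulr1 ?mulr0.
  have /dvdnP[k ->] : (p %| 'C(p, j.+1))%N.
    apply: prime_dvd_bin => //=; rewrite ltn_neqAle ltn_ord andbT.
    by apply: contra neq_j => /eqP jp; apply/eqP/val_inj; exact: (congr1 predn jp).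
  by rewrite coefMn mulrnA -[_ *+ p]mulr_natr (pcharf0 charOp) mulr0.
have coefB1 : (B p)`_1 = iter p.-1 d l by rewrite -[LHS]mulr1n derB.
have coefBi i : (1 < i < p)%N -> (B p)`_i = 0.
  case: i => [|[|i]] // lt_ip; apply: (@mulrn_coprime_eq0 i.+2); last by rewrite derB.
  by rewrite coprime_sym prime_coprime // gtnNdvd.
have [coefBp _] := coefB_lead p.
rewrite (horner_coef_wide _ size_B) big_ord_recr expr1n mulr1 coefBp; congr (_ + _).
rewrite -(big_mkord xpredT (fun i => (B p)`_i * 1 ^+ i)) big_ltn 1?ltnW //.
rewrite coefB0 1?ltnW // mul0r /= add0r big_ltn // coefB1 expr1n mulr1.
rewrite big_nat big1 ?addr0 // => i lt_ip; rewrite coefBi ?mul0r //.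
Qed.
End Jacobson.

(** * Modules over a free algebra *)

Section FreeAlgebraAction.
Import finmap monalg.
Variables (F : fieldType) (X : choiceType) (V : lmodType F) (op : X -> V -> V).
Hypothesis op_linear : forall x, linear (op x).

Definition word_action (m : seq X) (v : V) : V := foldr op v m.

Definition free_action (a : free_alg F X) (v : V) : V :=
  \sum_(m <- msupp a) a@_m *: word_action m v.

Lemma word_action_linear m : linear (word_action m).
Proof.
elim: m => [//|x m IHm] c u v.
exact: etrans (congr1 (op x) (IHm c u v)) (op_linear _ _ _ _).
Qed.

Lemma free_actionEw (d : {fset {fmonom X}}) a v : (msupp a `<=` d)%fset ->
  free_action a v = \sum_(m <- d) a@_m *: word_action m v.
Proof.
move=> le; rewrite [LHS](big_fset_incl _ le) => //= m _ /mcoeff_outdom ->.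
by rewrite scale0r.
Qed.

Lemma free_actionBl a b v : free_action (a - b) v = free_action a v - free_action b v.
Proof.
pose d := (msupp a `|` msupp b)%fset.
rewrite (@free_actionEw d a) ?fsubsetUl // (@free_actionEw d b) ?fsubsetUr //.
rewrite (@free_actionEw d (a - b)) ?msuppB_le // -sumrB.
by apply: eq_bigr => m _; rewrite mcoeffB scalerBl.
Qed.

Lemma free_action_linear a : linear (free_action a).
Proof.
move=> c u v; rewrite scaler_sumr -big_split; apply: eq_bigr => m _ /=.
by rewrite word_action_linear scalerDr !scalerA mulrC.
Qed.

Lemma free_actionr0 a : free_action a 0 = 0.
Proof.
apply: (@addrI _ (free_action a 0)).
by rewrite -{1}[free_action a 0]scale1r -free_action_linear scale1r !addr0.
Qed.

Lemma free_actionU c m v : free_action << c *g m >> v = c *: word_action m v.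
Proof. by rewrite (@free_actionEw [fset m]%fset) ?msuppU_le // big_seq_fset1 mcoeffUU. Qed.

Lemma free_action0l v : free_action 0 v = 0.
Proof. by rewrite -(subrr 0) free_actionBl subrr. Qed.

Lemma free_actionDl a b v : free_action (a + b) v = free_action a v + free_action b v.
Proof.
by rewrite -[b in LHS]opprK free_actionBl -(sub0r b) free_actionBl free_action0l sub0r opprK.
Qed.

Lemma free_action_suml (K : Type) (r : seq K) (f : K -> free_alg F X) v :
  free_action (\sum_(k <- r) f k) v = \sum_(k <- r) free_action (f k) v.
Proof.
exact: (big_morph (fun a => free_action a v)
  (fun a b => free_actionDl a b v) (free_action0l v)).
Qed.

Lemma free_actionM a b v : free_action (a * b) v = free_action a (free_action b v).
Proof.
rewrite [in LHS](monalgE a) [in RHS](monalgE a) mulr_suml !free_action_suml.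
apply: eq_bigr => m _; rewrite [RHS]free_actionU.
rewrite [in LHS](monalgE b) [in RHS](monalgE b) mulr_sumr !free_action_suml.
have wD u w : word_action m (u + w) = word_action m u + word_action m w.
  by rewrite -[u in LHS]scale1r word_action_linear scale1r.
have w0 : word_action m 0 = 0 by apply: (@addrI _ (word_action m 0)); rewrite -wD !addr0.
rewrite (big_morph _ wD w0) scaler_sumr; apply: eq_bigr => k _.
rewrite malgM_def fgmulUU !free_actionU fmM /word_action foldr_cat -!/(word_action _ _).
by rewrite -[_ *: word_action k v]addr0 word_action_linear w0 addr0 scalerA.
Qed.

Lemma free_action_fvar x v : free_action (fvar F x) v = op x v.
Proof. by rewrite /fvar free_actionU scale1r /word_action fmU. Qed.

Lemma free_action_fconst c v : free_action (fconst X c) v = c *: v.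
Proof. by rewrite /fconst free_actionU /word_action fm1. Qed.

Lemma free_alg_ind (Q : free_alg F X -> Prop) :
  (forall c, Q (fconst X c)) -> (forall x, Q (fvar F x)) ->
  (forall a b, Q a -> Q b -> Q (a + b)) -> (forall a b, Q a -> Q b -> Q (a * b)) ->
  forall a, Q a.
Proof.
move=> Qc Qx QD QM a; rewrite (monalgE a); apply: big_ind => [|//|m _].
  by have := Qc 0; rewrite rmorph0.
have -> : << a@_m *g m >> = fconst X a@_m * \prod_(x <- (m : seq X)) fvar F x.
  move: a@_m => c; rewrite -[m in LHS]fmK; elim: (m : seq X) c => [|x s IHs] c.
    by rewrite big_nil mulr1 -fmoneE.
  rewrite big_cons mulrA [fconst X c * _]fconst_comm -mulrA -IHs malgM_def fgmulUU mul1r.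
  by congr << _ *g _ >>; apply/eqP; rewrite fmP fmM fmU.
apply: (QM) => //; apply: big_ind => [|//|//].
by have := Qc 1; rewrite rmorph1.
Qed.

End FreeAlgebraAction.

Lemma twist_comm_identity (R : comNzRingType) (ab ba lab lba la lb a b f : R) :
  ab + (lab * f + lb * a) + la * (b + lb * f) -
    (ba + (lba * f + la * b) + lb * (a + la * f)) =
  ab - ba + (lab - lba) * f.
Proof. ring. Qed.

(** * Twisted vector fields acting on polynomial functions *)

Section FunctionRepresentation.
Import mpoly.
Variables (F : fieldType) (n : nat).
Local Notation P := {mpoly F[n * n]}.
Local Notation mxC := (map_mx (@mpolyC (n * n) F)).
Implicit Types (f g : P) (x y z : 'M[F]_n).

Definition at1 f : F := mx_eval f 1%:M.

Lemma at1D f g : at1 (f + g) = at1 f + at1 g. Proof. exact: mevalD. Qed.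
Lemma at1B f g : at1 (f - g) = at1 f - at1 g. Proof. exact: mevalB. Qed.
Lemma at1M f g : at1 (f * g) = at1 f * at1 g. Proof. exact: mevalM. Qed.
Lemma at1Z c f : at1 (c *: f) = c * at1 f. Proof. exact: mevalZ. Qed.
Lemma at1C c : at1 c%:MP = c. Proof. exact: mevalC. Qed.
Lemma at10 : at1 0 = 0. Proof. exact: meval0. Qed.
Lemma at1X f m : at1 (f ^+ m) = at1 f ^+ m. Proof. exact: rmorphXn. Qed.
Lemma at1_sum (I : Type) (r : seq I) (Q : pred I) (f : I -> P) :
  at1 (\sum_(i <- r | Q i) f i) = \sum_(i <- r | Q i) at1 (f i).
Proof. exact: raddf_sum. Qed.

Lemma generic_mulmx_linear c x y i j : (generic_mx F n *m mxC (c *: x + y)) i j =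
  c *: (generic_mx F n *m mxC x) i j + (generic_mx F n *m mxC y) i j.
Proof.
rewrite [LHS]mxE [(_ *m mxC x) i j]mxE [(_ *m mxC y) i j]mxE scaler_sumr -big_split.
apply: eq_bigr => l _ /=.
have e w : mxC w l j = (w l j)%:MP by rewrite mxE.
by rewrite !e [(c *: x + y) l j]mxE [(c *: x) l j]mxE mpolyCD mpolyCM mulrDr mulrCA mul_mpolyC.
Qed.

Lemma vfield_linear c x y f : vfield (c *: x + y) f = c *: vfield x f + vfield y f.
Proof.
rewrite /vfield scaler_sumr -big_split; apply: eq_bigr => k _ /=.
case/mxvec_indexP: k => i j; rewrite !(mxvecE (generic_mx F n *m _)).
by rewrite generic_mulmx_linear mulrDr scalerAr.
Qed.

Lemma vfieldXn x f m : vfield x (f ^+ m) = (f ^+ m.-1 * vfield x f) *+ m.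
Proof.
elim: m => [|m IHm]; first by rewrite mulr0n expr0 -[1]mpolyC1 vfieldC.
rewrite exprS vfieldM IHm mulrS mulrC -mulrnAr; congr (_ + _).
case: m {IHm} => [|m]; first by rewrite !mulr0n !mulr0.
by rewrite -mulrnAr mulrA -exprS.
Qed.

Section LinearForm.
Variable tau : 'M[F]_n -> F.
Hypothesis tau_linear : scalar tau.

(* The function X |-> tau (X y) on matrices. *)
Definition linform y : P :=
  \sum_i \sum_j tau (delta_mx i j) *: (generic_mx F n *m mxC y) i j.

Lemma linform_linear c x y : linform (c *: x + y) = c *: linform x + linform y.
Proof.
rewrite /linform scaler_sumr -big_split; apply: eq_bigr => i _ /=.
rewrite scaler_sumr -big_split; apply: eq_bigr => j _ /=.
by rewrite generic_mulmx_linear scalerDr !scalerA mulrC.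
Qed.

Lemma linformB x y : linform (x - y) = linform x - linform y.
Proof. by rewrite addrC -scaleN1r linform_linear scaleN1r addrC. Qed.

Lemma vfield_linform x y : vfield x (linform y) = linform (x *m y).
Proof.
rewrite /linform raddf_sum; apply: eq_bigr => i _ /=.
rewrite raddf_sum; apply: eq_bigr => j _ /=.
by rewrite vfieldZ vfield_generic.
Qed.

Let tauD : {morph tau : x y / x + y}.
Proof. by move=> x y; rewrite -[x in LHS]scale1r tau_linear mul1r. Qed.
Let tau0 : tau 0 = 0.
Proof. by apply: (@addrI _ (tau 0)); rewrite -tauD !addr0. Qed.
Let tauZ c x : tau (c *: x) = c * tau x.
Proof. by rewrite -[c *: x]addr0 tau_linear tau0 addr0. Qed.

Lemma mx_eval_linform y (x : 'M[F]_n) : mx_eval (linform y) x = tau (x *m y).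
Proof.
rewrite (matrix_sum_delta (x *m y)) (big_morph _ tauD tau0) /linform /mx_eval raddf_sum.
apply: eq_bigr => i _; rewrite (big_morph _ tauD tau0) raddf_sum.
apply: eq_bigr => j _; rewrite /= mevalZ tauZ mulrC; congr (_ * _).
exact: mx_eval_generic.
Qed.

Lemma at1_linform y : at1 (linform y) = tau y.
Proof. by rewrite /at1 mx_eval_linform mul1mx. Qed.

(** A local coordinate at the identity matrix, normalized to vanish there, with differential
    [tau]. *)
Definition coordinate : P := linform 1%:M - (tau 1%:M)%:MP.

Lemma at1_coordinate : at1 coordinate = 0.
Proof. by rewrite at1B at1_linform at1C subrr. Qed.

Lemma vfield_coordinate y : at1 (vfield y coordinate) = tau y.
Proof. by rewrite raddfB /= vfieldC subr0 vfield_linform mulmx1 at1_linform. Qed.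

End LinearForm.

Section Operators.
Variables (p : nat) (char_p : p \in [pchar F]).
Variable psi : 'M[F]_n -> F.
Hypothesis psi_linear : scalar psi.

(* The correction by psi changes the p-character from 0 to psi. *)
Definition rep y f : P := twist (vfield y) (linform psi y) f.

Lemma rep_linear y : linear (rep y).
Proof.
move=> c f g; rewrite /rep /twist raddfD /= vfieldZ mulrDr scalerDr addrACA; congr (_ + _).
by rewrite -scalerAr.
Qed.

Lemma repD y f g : rep y (f + g) = rep y f + rep y g.
Proof. by rewrite -[f in LHS]scale1r rep_linear scale1r. Qed.

Lemma rep0 y : rep y 0 = 0.
Proof. by apply: (@addrI _ (rep y 0)); rewrite -repD !addr0. Qed.

Lemma rep_linearl c x y f : rep (c *: x + y) f = c *: rep x f + rep y f.
Proof.
by rewrite /rep /twist /= vfield_linear linform_linear mulrDl scalerDr addrACA scalerAl.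
Qed.

(** The field of x turns the function psi(X y) into psi(X x y), so the cross terms add up to psi(X
    [x, y]), the correction that belongs to the bracket. *)
Lemma rep_bracket x y f : rep x (rep y f) - rep y (rep x f) = rep (lie_bracket x y) f.
Proof.
have vD u w : vfield u (vfield w f + linform psi w * f) = vfield u (vfield w f) +
    (linform psi (u *m w) * f + linform psi w * vfield u f).
  by rewrite raddfD /= vfieldM vfield_linform.
rewrite /rep /twist /= (vD x y) (vD y x) linformB -(vfield_comm x y f).
exact: (twist_comm_identity (vfield x (vfield y f)) (vfield y (vfield x f))
  (linform psi (x *m y)) (linform psi (y *m x)) (linform psi x) (linform psi y)
  (vfield x f) (vfield y f) f).
Qed.

Lemma iter_vfield_linform m y : iter m (vfield y) (linform psi y) = linform psi (y ^+ m.+1).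
Proof.
elim: m => [|m IHm]; first by rewrite expr1.
rewrite iterS IHm (vfield_linform psi y (y ^+ m.+1)).
exact: (congr1 (linform psi) (esym (exprS y m.+1))).
Qed.

Let char_P : p \in [pchar P]. Proof. by rewrite pchar_lalg. Qed.

(** In Jacobson's formula the middle term d^(p-1) l is psi(X y^p), exactly the correction built into
    [rep] at y^p. The last term is the function psi(X y)^p instead of the scalar psi(y)^p. *)
Lemma iter_rep y f : iter p (rep y) f = rep (y ^+ p) f + linform psi y ^+ p * f.
Proof.
rewrite (@iter_twist_pchar P (vfield y) (linform psi y) (vfieldM y) p char_P).
rewrite (iter_vfield_pchar _ _ char_p) iter_vfield_linform.
by rewrite (prednK (prime_gt0 (pcharf_prime char_p))).
Qed.

(** The amount by which [rep] misses the p-character psi. Being a p-th power minus a constant it is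
    killed by all vector fields, so multiplication by it commutes with [rep]; moreover it vanishes
    at 1. *)
Definition pdefect y : P := linform psi y ^+ p - (psi y ^+ p)%:MP.

Lemma at1_pdefect y : at1 (pdefect y) = 0.
Proof. by rewrite at1B at1X at1_linform // at1C subrr. Qed.

Lemma vfield_pdefect x y : vfield x (pdefect y) = 0.
Proof.
rewrite raddfB /= vfieldC subr0.
by rewrite vfieldXn -[_ *+ p]mulr_natr (pcharf0 char_P) mulr0.
Qed.

Lemma rep_pdefect x y f : rep x (pdefect y * f) = pdefect y * rep x f.
Proof. rewrite /rep /twist /= vfieldM vfield_pdefect mul0r add0r mulrDr; congr (_ + _).
exact: mulrCA. Qed.

End Operators.
End FunctionRepresentation.

(** * Linear independence of the reduced monomials *)

Section PBWIndependence.
Import mpoly.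
Variables (F : fieldType) (n : nat).
Local Notation P := {mpoly F[n * n]}.
Variables (p : nat) (char_p : p \in [pchar F]).
Variable psi : 'M[F]_n -> F.
Hypothesis psi_linear : scalar psi.
Implicit Types (f g h : P) (y : 'M[F]_n).

Local Notation rep := (rep psi).

(* vanish r is the r-th power of the maximal ideal at the identity matrix. *)
Inductive vanish : nat -> P -> Prop :=
| VanishProd r h s : {in s, forall g, at1 g = 0} -> size s = r ->
    vanish r (h * \prod_(g <- s) g)
| Vanish0 r : vanish r 0
| VanishD r f g : vanish r f -> vanish r g -> vanish r (f + g).

Lemma vanish_at1 r f : vanish r.+1 f -> at1 f = 0.
Proof.
move er : r.+1 => q v; elim: v er => {q f} [q h s s0 ss er|//|q f g _ f0 _ g0 er].
- case: s s0 ss => [|g s] s0 ss; first by rewrite -er in ss.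
  by rewrite big_cons !at1M (s0 g (mem_head _ _)) mul0r mulr0.
- by move=> *; exact: at10.
- by rewrite at1D f0 // g0 // addr0.
Qed.

Lemma vanishM r h f : vanish r f -> vanish r (h * f).
Proof.
elim=> {r f} [r f s s0 ss|r|r f g _ vf _ vg]; first by rewrite mulrA; apply: VanishProd.
  by rewrite mulr0; apply: Vanish0.
by rewrite mulrDr; apply: VanishD.
Qed.

Lemma vanishMS r h f : at1 h = 0 -> vanish r f -> vanish r.+1 (h * f).
Proof.
move=> h0; elim=> {r f} [r f s s0 ss|r|r f g _ vf _ vg].
- rewrite mulrCA -(big_cons _ _ h s xpredT id); apply: VanishProd; last by rewrite /= ss.
  by move=> g; rewrite in_cons => /orP[/eqP ->|/s0].
- by rewrite mulr0; apply: Vanish0.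
- by rewrite mulrDr; apply: VanishD.
Qed.

Lemma vanishS r f : vanish r.+1 f -> vanish r f.
Proof.
move er : r.+1 => q v; elim: v r er => {q f} [q h s s0 ss|q|q f g _ IHf _ IHg] r er.
- case: s s0 ss => [|g s] s0 ss; first by rewrite -er in ss.
  rewrite big_cons mulrA; apply: VanishProd.
    by move=> g' gs; apply: s0; rewrite in_cons gs orbT.
  by move: ss; rewrite -er => -[].
- exact: Vanish0.
- by apply: VanishD; [apply: IHf | apply: IHg].
Qed.

Lemma vanish_const f : vanish 0 f.
Proof. by rewrite -[f]mulr1 -(big_nil 1 *%R xpredT id); apply: VanishProd. Qed.

Lemma vanish_prod s : {in s, forall g, at1 g = 0} -> vanish (size s) (\prod_(g <- s) g).
Proof. by rewrite -[\prod_(g <- s) g]mul1r => s0; apply: VanishProd. Qed.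

Lemma vanish_vfield_prod y s : {in s, forall g, at1 g = 0} ->
  vanish (size s).-1 (vfield y (\prod_(g <- s) g)).
Proof.
elim: s => [|g s IHs] s0; first exact: vanish_const.
have s0' : {in s, forall g, at1 g = 0} by move=> g' gs; apply: s0; rewrite in_cons gs orbT.
rewrite big_cons vfieldM; apply: VanishD; first by apply: vanishM; apply: vanish_prod.
case: s s0 s0' IHs => [|g' s] s0 s0' IHs; first exact: vanish_const.
by apply: vanishMS; [apply: s0; rewrite mem_head | apply: IHs].
Qed.

(** The operator has order one: its vector field lowers the order of vanishing at 1 by at most one,
    and its multiplication part does not lower it. *)
Lemma vanish_rep r y f : vanish r.+1 f -> vanish r (rep y f).
Proof.
move er : r.+1 => q v; elim: v r er => {q f} [q h s s0 ss|q|q f g _ IHf _ IHg] r er.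
- rewrite /rep /twist /= vfieldM; apply: VanishD; first apply: VanishD.
  + by apply: vanishS; apply: VanishProd; rewrite // er.
  + by apply: vanishM; have := vanish_vfield_prod y s0; rewrite ss -er.
  + by apply: vanishM; apply: vanishM; apply: vanishS; rewrite er -ss; apply: vanish_prod.
- rewrite (rep0 psi); exact: Vanish0.
- by rewrite (repD psi); apply: VanishD; [apply: IHf | apply: IHg].
Qed.

Definition rep_word (u : seq 'M[F]_n) f : P := foldr rep f u.

Lemma vanish_rep_word r u f : (size u <= r)%N -> vanish r f -> vanish (r - size u) (rep_word u f).
Proof.
elim: u r => [|y u IHu] r /=; first by rewrite subn0.
move=> lt_ur vf; apply: vanish_rep; rewrite -subSn //; apply: IHu => //; exact: ltnW.
Qed.

Lemma rep_word_at1 r u f : (size u < r)%N -> vanish r f -> at1 (rep_word u f) = 0.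
Proof.
move=> lt_ur /(vanish_rep_word (ltnW lt_ur)); rewrite -(subnKC lt_ur) addSnnS addKn.
exact: vanish_at1.
Qed.

Lemma rep_wordD u f g : rep_word u (f + g) = rep_word u f + rep_word u g.
Proof. by elim: u => //= y u ->; rewrite (repD psi). Qed.

Lemma rep_wordZ u c f : rep_word u (c *: f) = c *: rep_word u f.
Proof.
elim: u => //= y u ->; rewrite -[_ *: rep_word u f]addr0 (rep_linear psi) (rep0 psi).
exact: addr0.
Qed.

Section TestFunctions.
Variables (J : eqType) (z : J -> 'M[F]_n) (tau : J -> 'M[F]_n -> F).
Hypothesis tau_linear : forall j, scalar (tau j).
Hypothesis tau_dual : forall i j, tau j (z i) = (i == j)%:R.

Definition test (s : seq J) : P := \prod_(j <- s) coordinate (tau j).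

Lemma test_perm s s' : perm_eq s s' -> test s = test s'.
Proof. exact: perm_big. Qed.

Lemma vanish_test s : vanish (size s) (test s).
Proof.
rewrite /test -(big_map (fun j => coordinate (tau j)) xpredT id).
rewrite -(size_map (fun j => coordinate (tau j))).
by apply: vanish_prod => g /mapP[j _ ->]; apply: at1_coordinate.
Qed.

(** To leading order at the identity the field of z_i is the partial derivative along the i-th
    coordinate. The derivative has order [size s - 1], and the error is one order better. *)
Lemma vfield_test i s : vanish (size s)
  (vfield (z i) (test s) - (count_mem i s)%:R *: test (rem i s)).
Proof.
elim: s => [|j s IHs]; first exact: vanish_const.
rewrite /test big_cons vfieldM -/(test s) -/(test (rem i (j :: s))).
have rem_j : (count_mem i (j :: s))%:R *: test (rem i (j :: s)) =
    (j == i)%:R *: test s + (count_mem i s)%:R *: (coordinate (tau j) * test (rem i s)).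
  rewrite /= natrD scalerDl; case: eqVneq => [->|ij]; last by rewrite !scale0r /test big_cons.
  congr (_ + _); case i_s: (i \in s); last by rewrite (count_memPn _) ?i_s // !scale0r.
  by rewrite (test_perm (perm_to_rem i_s)) /test big_cons.
have -> : vfield (z i) (coordinate (tau j)) * test s +
      coordinate (tau j) * vfield (z i) (test s) -
      (count_mem i (j :: s))%:R *: test (rem i (j :: s)) =
    (vfield (z i) (coordinate (tau j)) - (j == i)%:R%:MP) * test s +
    coordinate (tau j) * (vfield (z i) (test s) - (count_mem i s)%:R *: test (rem i s)).
  rewrite rem_j [X in _ = X + _]mulrBl [X in _ = _ + X]mulrBr mul_mpolyC opprD addrACA.
  by rewrite scalerAr.
apply: VanishD; last by apply: vanishMS => //; apply: at1_coordinate.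
apply: vanishMS; last exact: vanish_test.
by rewrite at1B at1C vfield_coordinate // tau_dual eq_sym subrr.
Qed.

(* When s and s' have the same size, only the first order parts of the operators *)
(* matter, and this is the permanent of the matrix of the tau_(s'_k) (z_(s_i)).   *)
Definition pairing_value (s s' : seq J) : F := at1 (rep_word (map z s) (test s')).

(** The last letter acts first and differentiates the test function. The error vanishes to order
    [size s'], more than the remaining [size s] operators can undo before evaluation at 1. *)
Lemma pairing_value_rcons s i s' : size s' = (size s).+1 ->
  pairing_value (rcons s i) s' = (count_mem i s')%:R * pairing_value s (rem i s').
Proof.
move=> sz; rewrite /pairing_value map_rcons /rep_word foldr_rcons -!/(rep_word _ _).
rewrite -at1Z -rep_wordZ; apply/eqP; rewrite -subr_eq0; apply/eqP.
set f := rep _ _; set g := _ *: _.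
have -> : at1 (rep_word (map z s) f) - at1 (rep_word (map z s) g) =
    at1 (rep_word (map z s) (f - g)).
  by rewrite rep_wordD at1D -[- g]scaleN1r (rep_wordZ _ (-1)) (at1Z (-1)) mulN1r.
apply: (@rep_word_at1 (size s')); first by rewrite size_map sz.
rewrite /f /rep /twist /= addrAC; apply: VanishD; first exact: vfield_test.
by apply: vanishM; apply: vanish_test.
Qed.

Lemma pairing_value_eq0 s s' : size s = size s' -> ~~ perm_eq s s' -> pairing_value s s' = 0.
Proof.
elim/last_ind: s s' => [|s i IHs] s' sz; first by move/esym/size0nil: sz => ->.
rewrite size_rcons in sz; rewrite (pairing_value_rcons _ (esym sz)) => not_perm.
have [i_s'|] := boolP (i \in s'); last by move/count_memPn => ->; rewrite mul0r.
rewrite IHs ?mulr0 //; first by rewrite size_rem // -sz.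
apply: contra not_perm; rewrite perm_rcons (permPr (perm_to_rem i_s')).
by rewrite perm_cons.
Qed.

(** The value is the product of the factorials of the multiplicities, all of which are below p. *)
Lemma pairing_value_neq0 s s' : perm_eq s s' -> (forall i, count_mem i s' < p)%N ->
  pairing_value s s' != 0.
Proof.
elim/last_ind: s s' => [|s i IHs] s' ss' lt_p.
  have -> : s' = [::] by apply/perm_nilP; rewrite perm_sym.
  by rewrite /pairing_value /test big_nil /= -mpolyC1 at1C oner_eq0.
have i_s' : i \in s' by rewrite -(perm_mem ss') mem_rcons mem_head.
rewrite pairing_value_rcons; last by rewrite -(perm_size ss') size_rcons.
rewrite mulf_neq0 //.
  by rewrite -(dvdn_pcharf char_p) gtnNdvd // -has_count has_pred1.
apply: IHs; first by move: ss'; rewrite perm_rcons (permPr (perm_to_rem i_s')) perm_cons.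
by move=> j; apply: leq_ltn_trans (lt_p j); rewrite count_rem leq_subr.
Qed.

End TestFunctions.

Section Pairing.
Variable K : {vspace 'M[F]_n}.
Local Notation act := (free_action (fun x : subvs_of K => rep (vsval x))).

Let act_linear x : linear (rep (vsval (x : subvs_of K))).
Proof. exact: rep_linear. Qed.

Lemma act_univ_ideal a f : ideal_span (@univ_rel F n K) a -> act a f = 0.
Proof.
move=> /(_ (fun a => forall f, act a f = 0)) H; apply: H => {a f}.
- exact: free_action0l.
- by move=> a b a0 b0 f; rewrite free_actionBl a0 b0 subr0.
- by move=> a b b0 f; rewrite free_actionM // b0 free_actionr0.
- by move=> a b b0 f; rewrite free_actionM // b0.
move=> a [c x y|x y w eq_w] f.
  by rewrite free_actionBl free_actionDl free_actionM // !free_action_fvar free_action_fconst linearP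
    rep_linearl subrr.
rewrite !free_actionBl !free_actionM // !free_action_fvar.
by rewrite eq_w -(rep_bracket psi) subrr.
Qed.

Let uact (u : univ_env K) f : P := act (of_quot u) f.

Let uact_to_quot a f : uact (to_quot _ a) f = act a f.
Proof.
apply/eqP; rewrite -subr_eq0 -free_actionBl; apply/eqP.
by apply: act_univ_ideal; apply/to_quotP; rewrite of_quotK.
Qed.

Let uactB u w f : uact (u - w) f = uact u f - uact w f.
Proof.
elim/to_quot_ind: u => a; elim/to_quot_ind: w => b.
by rewrite -rmorphB !uact_to_quot free_actionBl.
Qed.

Let uactM u w f : uact (u * w) f = uact u (uact w f).
Proof.
elim/to_quot_ind: u => a; elim/to_quot_ind: w => b.
by rewrite -rmorphM !uact_to_quot free_actionM.
Qed.

Let uact0r u : uact u 0 = 0. Proof. exact: free_actionr0. Qed.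

Let uactBr u f g : uact u (f - g) = uact u f - uact u g.
Proof.
rewrite -[- g]scaleN1r addrC /uact free_action_linear; last exact: act_linear.
by rewrite scaleN1r addrC.
Qed.

Let uact_pdefect u y f : uact u (pdefect p psi y * f) = pdefect p psi y * uact u f.
Proof.
elim/to_quot_ind: u => a; rewrite !uact_to_quot /free_action mulr_sumr.
apply: eq_bigr => m _; rewrite -scalerAr; congr (_ *: _); rewrite /word_action.
by elim: (monalg.fmonom_val m) => //= x s ->; rewrite rep_pdefect.
Qed.

(** A defining relation acts by multiplication by the defect, not by 0. Quantifying over an operator
    w on the left and a function f on the right gives a property that is stable on both sides; for
    the relations, the defect moves past w and vanishes at 1. *)
Lemma uact_reduced_ideal u : ideal_span (@reduced_rel F n p psi K) u ->
  forall w f, at1 (uact w (uact u f)) = 0.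
Proof.
move=> /(_ (fun u => forall w f, at1 (uact w (uact u f)) = 0)) H; apply: H => {u}.
- by move=> w f; rewrite -(subrr 0) uactB subrr uact0r at10.
- by move=> u v Hu Hv w f; rewrite uactB uactBr at1B Hu Hv subr0.
- by move=> a u Hu w f; rewrite uactM -uactM Hu.
- by move=> a u Hu w f; rewrite uactM Hu.
move=> u [x y eq_y] w f; rewrite !uactB.
have uact_uvar m g : uact (uvar x ^+ m) g = iter m (rep (vsval x)) g.
  elim: m => [|m IHm].
    rewrite expr0 -(rmorph1 (to_quot _)) uact_to_quot -(rmorph1 (fconst _)).
    by rewrite free_action_fconst scale1r.
  by rewrite exprS uactM IHm uact_to_quot free_action_fvar.
rewrite uact_uvar !uact_to_quot free_action_fvar // free_action_fconst.
rewrite (iter_rep char_p) eq_y [rep _ _ + _]addrC addrK -mul_mpolyC -mulrBl.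
by rewrite uact_pdefect at1M at1_pdefect // mul0r.
Qed.

Lemma pairing_reduced_eq0 a f : to_quot (@reduced_rel F n p psi K) (to_quot _ a) = 0 ->
  at1 (act a f) = 0.
Proof.
rewrite -(rmorph0 (to_quot _)) => /to_quotP; rewrite subr0 => /uact_reduced_ideal H.
have := H 1 f; rewrite uact_to_quot -(rmorph1 (to_quot _)) uact_to_quot.
by rewrite -(rmorph1 (fconst _)) free_action_fconst scale1r.
Qed.

Variables (J : eqType) (z : J -> 'M[F]_n) (tau : J -> 'M[F]_n -> F).
Hypothesis tau_linear : forall j, scalar (tau j).
Hypothesis tau_dual : forall i j, tau j (z i) = (i == j)%:R.
Variables (D : finType) (s : D -> seq J).
Hypothesis s_mem : forall d j, j \in s d -> z j \in K.
Hypothesis s_lt : forall d j, (count_mem j (s d) < p)%N.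
Hypothesis s_inj : forall d d', perm_eq (s d) (s d') -> d = d'.

(** Pair the relation with the test function of a longest word that has a nonzero coefficient:
    shorter words contain too few operators, other words of equal length have another multiset of
    letters, and only that word itself contributes. *)
Lemma pbw_independent (c : D -> F) :
  \sum_d rconst p psi K (c d) * \prod_(j <- s d) rvar p psi K (z j) = 0 ->
  forall d, c d = 0.
Proof.
pose a := \sum_d fconst (subvs_of K) (c d) * \prod_(j <- s d) fvar F (vsproj K (z j)).
have -> : \sum_d rconst p psi K (c d) * \prod_(j <- s d) rvar p psi K (z j) =
    to_quot (@reduced_rel F n p psi K) (to_quot (@univ_rel F n K) a).
  rewrite /a !rmorph_sum; apply: eq_bigr => d _; rewrite !rmorphM; congr (_ * _).
  by rewrite !rmorph_prod.
move=> /pairing_reduced_eq0 a0 d; apply/eqP/negPn/negP => cd0.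
pose Q d := c d != 0.
have [e Qe max_e] := @arg_maxnP _ d Q (fun d => size (s d)) cd0.
have act_word t f : {subset t <= K} -> act (\prod_(y <- t) fvar F (vsproj K y)) f = rep_word t f.
  elim: t => [|y t IHt] tK.
    by rewrite big_nil -(rmorph1 (fconst _)) free_action_fconst scale1r.
  rewrite big_cons free_actionM // free_action_fvar // IHt ?vsprojK //.
    by apply: tK; rewrite mem_head.
  by move=> y' yt; apply: tK; rewrite in_cons yt orbT.
have := a0 (test tau (s e)); rewrite /a free_action_suml at1_sum (bigD1 e) //= big1 => [|d' ne_d'].
  rewrite addr0 free_actionM // free_action_fconst at1Z.
  rewrite -(big_map z xpredT (fun y => fvar F (vsproj K y))) act_word; last first.
    by move=> y /mapP[j js ->]; apply: (@s_mem e).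
  apply/eqP; rewrite mulf_neq0 //; apply: pairing_value_neq0 => //.
rewrite free_actionM // free_action_fconst at1Z.
rewrite -(big_map z xpredT (fun y => fvar F (vsproj K y))) act_word; last first.
  by move=> y /mapP[j js ->]; apply: (@s_mem d').
have [->|cd'] := eqVneq (c d') 0; first by rewrite mul0r.
have : (size (s d') <= size (s e))%N by exact: max_e.
rewrite leq_eqVlt => /orP[/eqP sz|lt].
  rewrite -/(pairing_value z tau (s d') (s e)) (@pairing_value_eq0 _ z tau) ?mulr0 //.
  by apply: contra ne_d' => /s_inj ->.
rewrite (rep_word_at1 _ (vanish_test tau_linear _)) ?mulr0 //.
by rewrite size_map.
Qed.

End Pairing.
End PBWIndependence.

(** * Computation rules in the reduced enveloping algebra *)

Section ReducedEnvelope.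
Variables (F : fieldType) (n p : nat) (psi : 'M[F]_n -> F) (K : {vspace 'M[F]_n}).
Implicit Types (x y : 'M[F]_n) (c : F).
Local Notation A := (reduced_env p psi K).
Local Notation rvar := (rvar p psi K).
Local Notation rconst := (rconst p psi K).

Local Notation qu := (to_quot (@univ_rel F n K)).
Local Notation qr := (to_quot (@reduced_rel F n p psi K)).

Fact rconst_is_zmod_morphism : zmod_morphism rconst.
Proof. by move=> c d; rewrite /rconst /uconst !rmorphB. Qed.
Fact rconst_is_monoid_morphism : monoid_morphism rconst.
Proof.
split=> [|c d].
  exact: (congr1 (fun a => to_quot _ (to_quot _ a)) (rmorph1 (fconst (subvs_of K)))).
have fM : fconst (subvs_of K) (c * d) = fconst _ c * fconst _ d := rmorphM (fconst (subvs_of K)) c d.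
rewrite /rconst /uconst fM.
rewrite (rmorphM qu).
by rewrite (rmorphM qr).
Qed.
HB.instance Definition _ := GRing.isZmodMorphism.Build F A rconst rconst_is_zmod_morphism.
HB.instance Definition _ := GRing.isMonoidMorphism.Build F A rconst rconst_is_monoid_morphism.

Lemma rconst_central c (a : A) : rconst c * a = a * rconst c.
Proof.
elim/to_quot_ind: a; elim/to_quot_ind=> a.
by rewrite /rconst /uconst -!(rmorphM qr) -!(rmorphM qu) (fconst_comm c a).
Qed.

Lemma rvar_linear c x y : rvar (c *: x + y) = rconst c * rvar x + rvar y.
Proof.
have e (x' y' : subvs_of K) : qu (fvar F (c *: x' + y')) = qu (fconst _ c * fvar F x' + fvar F y').
  by apply/to_quotP; apply: ideal_spanP; apply: UnivLin.
by rewrite /rvar linearP /uvar e (rmorphD qu) (rmorphM qu) (rmorphD qr) (rmorphM qr).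
Qed.

Lemma rvarD x y : rvar (x + y) = rvar x + rvar y.
Proof. by rewrite -[x in LHS]scale1r rvar_linear rmorph1 mul1r. Qed.

Lemma rvar0 : rvar 0 = 0.
Proof. by apply: (@addrI _ (rvar 0)); rewrite -rvarD !addr0. Qed.

Lemma rvarZ c x : rvar (c *: x) = rconst c * rvar x.
Proof. by rewrite -[c *: x]addr0 rvar_linear rvar0 addr0. Qed.

Lemma rvar_sum (I : Type) (r : seq I) (Q : pred I) (f : I -> 'M[F]_n) :
  rvar (\sum_(i <- r | Q i) f i) = \sum_(i <- r | Q i) rvar (f i).
Proof. exact: (big_morph _ rvarD rvar0). Qed.

Lemma rvar_bracket x y : x \in K -> y \in K -> lie_bracket x y \in K ->
  rvar x * rvar y - rvar y * rvar x = rvar (lie_bracket x y).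
Proof.
move=> xK yK xyK; rewrite /rvar -!(rmorphM qr) -(rmorphB qr); congr qr.
rewrite /uvar -!(rmorphM qu) -(rmorphB qu); apply/to_quotP; apply: ideal_spanP.
by apply: UnivBracket; rewrite !vsprojK.
Qed.

Lemma rvar_pow x : x \in K -> x ^+ p \in K ->
  rvar x ^+ p = rvar (x ^+ p) + rconst (psi x ^+ p).
Proof.
move=> xK xpK.
have e : vsval (vsproj K (x ^+ p)) = vsval (vsproj K x) ^+ p by rewrite !vsprojK.
have := ideal_spanP (@ReducedPower F n p psi K _ _ e); rewrite vsprojK // -addrA -opprD.
by move/to_quotP; rewrite (rmorphXn qr) (rmorphD qr).
Qed.

Lemma reduced_env_ind (Q : A -> Prop) :
  (forall c, Q (rconst c)) -> (forall x, x \in K -> Q (rvar x)) ->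
  (forall a b, Q a -> Q b -> Q (a + b)) -> (forall a b, Q a -> Q b -> Q (a * b)) ->
  forall a, Q a.
Proof.
move=> Qc Qx QD QM; elim/to_quot_ind; elim/to_quot_ind.
elim/free_alg_ind => [c|x|a b Qa Qb|a b Qa Qb]; first exact: Qc.
- by have := Qx (vsval x) (subvsP x); rewrite /rvar vsvalK.
- by rewrite (rmorphD qu) (rmorphD qr); apply: QD.
- by rewrite (rmorphM qu) (rmorphM qr); apply: QM.
Qed.

End ReducedEnvelope.

(** * Reduced monomials in a basis span the reduced enveloping algebra *)

Section GradedBasis.
Variables (F : fieldType) (n p : nat) (char_p : p \in [pchar F]).
Variable psi : 'M[F]_n -> F.
Variables (J : finType) (z : J -> 'M[F]_n).

Definition lincomb (Q : pred J) (x : 'M[F]_n) : Prop :=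
  exists c : J -> F, x = \sum_(j | Q j) c j *: z j.

Lemma lincomb_gen (Q : pred J) j : Q j -> lincomb Q (z j).
Proof.
move=> Qj; exists (fun k => (k == j)%:R); rewrite (bigD1 j) //= eqxx scale1r.
by rewrite big1 ?addr0 // => k /andP[_ /negPf ->]; rewrite scale0r.
Qed.

Lemma lincombP (Q : pred J) (a : F) x y : lincomb Q x -> lincomb Q y -> lincomb Q (a *: x + y).
Proof.
move=> [c ->] [d ->]; exists (fun j => a * c j + d j).
rewrite scaler_sumr -big_split; apply: eq_bigr => j _ /=.
by rewrite scalerDl scalerA.
Qed.

Lemma lincomb0 (Q : pred J) : lincomb Q 0.
Proof. by exists (fun=> 0); rewrite big1 // => j _; rewrite scale0r. Qed.

Lemma lincomb_sub (Q Q' : pred J) x : (forall j, Q j -> Q' j) -> lincomb Q x -> lincomb Q' x.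
Proof.
move=> QQ' [c ->]; elim/big_ind: _ => [|u w cu cw|j Qj]; first exact: lincomb0.
  by rewrite -[u]scale1r; apply: lincombP.
by rewrite -[_ *: _]addr0; apply: lincombP; [apply/lincomb_gen/QQ' | apply: lincomb0].
Qed.

Section Letters.
Variable K : {vspace 'M[F]_n}.
Local Notation A := (reduced_env p psi K).
Local Notation rc := (rconst p psi K : {rmorphism F -> A}).
Local Notation rx := (fun j => rvar p psi K (z j)).

Lemma rvar_lincomb (Q : pred J) x : lincomb Q x ->
  linspan rc (fun a => exists2 j, Q j & a = rx j) (rvar p psi K x).
Proof.
move=> [c ->]; rewrite rvar_sum; apply: linspan_sum => j Qj.
by rewrite rvarZ; apply: linspanZ; apply: linspan_gen; exists j.
Qed.

Variable idx : seq J.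
Hypothesis uniq_idx : uniq idx.
Hypothesis idx_K : forall j, j \in idx -> z j \in K.

Lemma bracket_lettersP (wt : J -> nat) i j : i \in idx -> j \in idx ->
  lie_bracket (z i) (z j) \in K ->
  lincomb (fun k => (k \in idx) && (wt k == wt i + wt j)%N) (lie_bracket (z i) (z j)) ->
  linspan rc (fun y => exists k, [/\ k \in idx, wt k = (wt i + wt j)%N & y = rx k])
    (rx i * rx j - rx j * rx i).
Proof.
move=> i_idx j_idx ijK /rvar_lincomb; rewrite rvar_bracket ?idx_K //.
apply: linspan_sub => _ [k /andP[k_idx /eqP wk] ->]; apply: linspan_gen.
by exists k.
Qed.

(** The scalar psi(z)^p has weight 0, so the relation is homogeneous when either the weight or the
    scalar is zero. *)
Lemma power_letterP (wt : J -> nat) i : i \in idx -> z i ^+ p \in K ->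
  (p * wt i = 0)%N \/ psi (z i) = 0 ->
  lincomb (fun k => (k \in idx) && (wt k == p * wt i)%N) (z i ^+ p) ->
  linspan rc (fun y => (exists k, [/\ k \in idx, wt k = (p * wt i)%N & y = rx k]) \/
                    (p * wt i = 0)%N /\ y = 1) (rx i ^+ p).
Proof.
move=> i_idx ipK w0 /rvar_lincomb S; rewrite rvar_pow ?idx_K //; apply: linspanD.
  apply: linspan_sub S => _ [k /andP[k_idx /eqP wk] ->]; apply: linspan_gen.
  by left; exists k.
case: w0 => [w0 | ->]; last first.
  rewrite expr0n -(prednK (prime_gt0 (pcharf_prime char_p))) rmorph0; exact: linspan0.
by rewrite -[rconst _ _ _ _]mulr1; apply: linspanZ; apply: linspan_gen; right.
Qed.

Hypothesis K_lincomb : forall x, x \in K -> lincomb [in idx] x.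
Hypothesis K_bracket : forall i j, i \in idx -> j \in idx -> lie_bracket (z i) (z j) \in K.
Hypothesis K_pow : forall j, j \in idx -> z j ^+ p \in K.

Lemma reduced_env_words (a : A) :
  linspan rc (fun y => exists s, all (mem idx) s /\ y = word rx s) a.
Proof.
elim/reduced_env_ind: a => [c|x xK|a b Sa Sb|a b Sa Sb].
- rewrite -[rconst _ _ _ _]mulr1; apply: linspanZ; apply: linspan_gen; exists [::].
  by rewrite /word big_nil.
- apply: linspan_sub (rvar_lincomb (K_lincomb xK)) => _ [j j_idx ->]; apply: linspan_gen.
  by exists [:: j]; rewrite /word big_seq1 /= j_idx.
- exact: linspanD.
apply: linspan_mulr Sa => [|_ [s [s_idx ->]]]; first exact: rconst_central.
apply: linspan_mull Sb => [|_ [t [t_idx ->]]]; first exact: rconst_central.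
by apply: linspan_gen; exists (s ++ t); rewrite all_cat s_idx word_cat.
Qed.

(** The spanning half of the PBW theorem. Only the bound on the exponents matters, so straightening
    is used with all weights 0. *)
Lemma reduced_env_monomials (a : A) : exists c : {ffun J -> 'I_p} -> F,
  a = \sum_d rc (c d) * mono idx rx (fun j => d j).
Proof.
have p_gt1 := prime_gt1 (pcharf_prime char_p); have p_gt0 := ltnW p_gt1.
apply: linspan_family; apply: linspan_sub (reduced_env_words a) => _ [s [s_idx ->]].
have Hb i j : i \in idx -> j \in idx -> linspan rc
    (fun y => exists k, [/\ k \in idx, 0 = 0 + 0 & y = rx k]%N) (rx i * rx j - rx j * rx i).
  move=> i_idx j_idx; apply: (@bracket_lettersP (fun=> 0%N)) => //; first exact: K_bracket.
  by apply: lincomb_sub (K_lincomb (K_bracket i_idx j_idx)) => k /= ->.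
have Hp i : i \in idx -> linspan rc (fun y => (exists k, [/\ k \in idx, 0 = p * 0 & y = rx k]%N) \/
    (p * 0 = 0)%N /\ y = 1) (rx i ^+ p).
  move=> i_idx; apply: (@power_letterP (fun=> 0%N)) => //; first exact: K_pow.
    by left; rewrite muln0.
  by apply: lincomb_sub (K_lincomb (K_pow i_idx)) => k /= ->; rewrite muln0.
have := straighten_low (@rconst_central _ _ _ _ _) p_gt1 uniq_idx Hb Hp s_idx.
apply: linspan_sub => _ [b [-> b_lt _ _]]; apply: linspan_gen.
(* Outside [idx] nothing bounds the exponents; values that are too large are replaced by 0, which
   the monomial does not see. *)
exists [ffun j => insubd (Ordinal p_gt0) (b j)]; apply: eq_big_seq => j j_idx.
by rewrite ffunE val_insubd b_lt.
Qed.

End Letters.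

End GradedBasis.

(** * A right-linear projection of u_psi(g) onto u_psi(p_I) *)

Section Retraction.
Import monalg.
Variables (F : fieldType) (A B : pzRingType) (incl : {rmorphism B -> A}).
Variables (rcg : {rmorphism F -> A}) (rcq : {rmorphism F -> B}).
Hypothesis rcg_central : forall s a, rcg s * a = a * rcg s.
Hypothesis incl_rc : forall s, incl (rcq s) = rcg s.
Variables (J : finType) (p : nat) (rn rq : seq J) (xg : J -> A) (xq : J -> B).
Hypothesis uniq_r : uniq (rn ++ rq).
Hypothesis incl_x : forall j, j \in rq -> incl (xq j) = xg j.

Local Notation expo := {ffun J -> 'I_p}.

Hypothesis p_gt0 : (0 < p)%N.
Hypothesis g_monomials : forall a : A, exists c : expo -> F,
  a = \sum_d rcg (c d) * mono (rn ++ rq) xg (fun j => d j).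
Hypothesis q_monomials : forall b : B, exists c : expo -> F,
  b = \sum_d rcq (c d) * mono rq xq (fun j => d j).

Lemma incl_mono (r : seq J) (a : J -> nat) : {subset r <= rq} ->
  incl (mono r xq a) = mono r xg a.
Proof.
move=> rrq; rewrite /mono rmorph_prod; apply: eq_big_seq => j jr.
by rewrite rmorphXn /= incl_x //; apply: rrq.
Qed.

Let incl_mono_rq (a : J -> nat) : incl (mono rq xq a) = mono rq xg a.
Proof. by apply: incl_mono. Qed.

Let mono_cat (d : J -> nat) : mono (rn ++ rq) xg d = mono rn xg d * mono rq xg d.
Proof. by rewrite /mono big_cat. Qed.

(** With the negative letters ordered first, each monomial splits into a negative part followed by
    an element of the subalgebra. *)
Lemma right_module_span (a : A) : exists b : expo -> B,
  a = \sum_(d : expo) mono rn xg (fun j => d j) * incl (b d).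
Proof.
have [c ->] := g_monomials a.
exists (fun d => rcq (c d) * mono rq xq (fun j => d j)); apply: eq_bigr => d _.
rewrite rmorphM incl_rc incl_mono_rq.
by rewrite mono_cat mulrA [in RHS]mulrA -[in RHS](rcg_central (c d)).
Qed.

Hypothesis independent : forall c : expo -> F,
  \sum_d rcg (c d) * mono (rn ++ rq) xg (fun j => d j) = 0 -> forall d, c d = 0.

Let coef (a : A) : expo -> F := projT1 (boolp.cid (g_monomials a)).

Let coefP a : a = \sum_d rcg (coef a d) * mono (rn ++ rq) xg (fun j => d j).
Proof. exact: projT2 (boolp.cid (g_monomials a)). Qed.

Let coef_unique a (c : expo -> F) :
  a = \sum_d rcg (c d) * mono (rn ++ rq) xg (fun j => d j) -> forall d, coef a d = c d.
Proof.
move=> a_c d; apply/eqP; rewrite -subr_eq0; apply/eqP.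
apply: (independent (c := fun e => coef a e - c e)).
transitivity (\sum_d rcg (coef a d) * mono (rn ++ rq) xg (fun j => d j) -
              \sum_d rcg (c d) * mono (rn ++ rq) xg (fun j => d j)); last first.
  by rewrite -coefP -a_c subrr.
rewrite -sumrB; apply: eq_bigr => e _.
by rewrite rmorphB mulrBl.
Qed.

Let rq_rn j : j \in rq -> j \notin rn.
Proof.
by move: uniq_r; rewrite cat_uniq => /and3P[_ /hasPn rq_rn _] /rq_rn.
Qed.

Let free_of_n (d : expo) : bool := [forall j in rn, d j == 0 :> nat].

(** The projection along the monomials that contain a negative letter. *)
Let retract (a : A) : B := \sum_(d | free_of_n d) rcq (coef a d) * mono rq xq (fun j => d j).

Let retract_lin s a b : retract (rcg s * a + b) = rcq s * retract a + retract b.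
Proof.
have coefD d : coef (rcg s * a + b) d = s * coef a d + coef b d.
  apply: (@coef_unique _ (fun d => s * coef a d + coef b d)).
  rewrite [in LHS](coefP a) [in LHS](coefP b) mulr_sumr -big_split.
  by apply: eq_bigr => e _ /=; rewrite mulrA -rmorphM -mulrDl -rmorphD.
rewrite /retract mulr_sumr -big_split; apply: eq_bigr => d _ /=.
by rewrite coefD rmorphD rmorphM mulrDl mulrA.
Qed.

Let retractD a b : retract (a + b) = retract a + retract b.
Proof. by rewrite -[a in LHS]mul1r -(rmorph1 rcg) retract_lin rmorph1 mul1r. Qed.

Let retract0 : retract 0 = 0.
Proof. by apply: (@addrI _ (retract 0)); rewrite -retractD !addr0. Qed.

Let retractZ s a : retract (rcg s * a) = rcq s * retract a.
Proof. by rewrite -[_ * a]addr0 retract_lin retract0 addr0. Qed.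

Let retract_sum (I : finType) (f : I -> A) : retract (\sum_i f i) = \sum_i retract (f i).
Proof. exact: (big_morph _ retractD retract0). Qed.

Let retract_mono (d : expo) : retract (mono (rn ++ rq) xg (fun j => d j)) =
  if free_of_n d then mono rq xq (fun j => d j) else 0.
Proof.
have coef_d e : coef (mono (rn ++ rq) xg (fun j => d j)) e = (e == d)%:R.
  apply: (@coef_unique _ (fun e => (e == d)%:R)); rewrite (bigD1 d) //= eqxx rmorph1 mul1r.
  by rewrite big1 ?addr0 // => e' /negPf ->; rewrite rmorph0 mul0r.
rewrite /retract; case: ifP => d_free.
  rewrite (bigD1 d) //= coef_d eqxx rmorph1 mul1r big1 ?addr0 // => e /andP[_ /negPf ed].
  by rewrite coef_d ed rmorph0 mul0r.
rewrite big1 // => e e_free; rewrite coef_d; case: eqP => [ed|_]; last by rewrite rmorph0 mul0r.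
by rewrite ed d_free in e_free.
Qed.

(** Since the negative letters stand on the left, right multiplication by the subalgebra rewrites
    only the other part of a monomial, and whether a negative letter occurs does not change. *)
Let retractM a b : retract (a * incl b) = retract a * b.
Proof.
rewrite {1}(coefP a) mulr_suml retract_sum [in RHS](coefP a) retract_sum mulr_suml.
apply: eq_bigr => d _; rewrite -mulrA !retractZ -mulrA; congr (_ * _).
rewrite retract_mono mono_cat -mulrA -incl_mono_rq.
rewrite -rmorphM.
have [c eq_b] := q_monomials (mono rq xq (fun j => d j) * b).
pose merge (e : expo) : expo := [ffun j => if j \in rn then d j else e j].
have mono_merge (e : expo) : mono rn xg (fun j => d j) * mono rq xg (fun j => e j) =
    mono (rn ++ rq) xg (fun j => merge e j).
  rewrite mono_cat /mono; congr (_ * _); apply: eq_big_seq => j j_r; rewrite ffunE ?j_r //.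
  by rewrite (negPf (rq_rn j_r)).
rewrite eq_b rmorph_sum mulr_sumr retract_sum.
have free_merge (e : expo) : free_of_n (merge e) = free_of_n d.
  by apply/eq_forallb => j; case j_rn: (j \in rn) => //=; rewrite ffunE j_rn.
transitivity (\sum_(e : expo) if free_of_n d then rcq (c e) * mono rq xq (fun j => e j) else 0).
  apply: eq_bigr => e _; rewrite rmorphM incl_rc incl_mono_rq mulrA -rcg_central -mulrA.
  rewrite mono_merge retractZ retract_mono free_merge.
  case: ifP => _; last by rewrite mulr0.
  congr (_ * _); apply: eq_big_seq => j j_rq; rewrite ffunE (negPf (rq_rn j_rq)).
  by [].
by case: ifP => _; rewrite ?eq_b // big1 // mul0r.
Qed.

Let retract1 : retract 1 = 1.
Proof.
pose d0 : expo := [ffun=> Ordinal p_gt0].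
have mono0 (R : pzRingType) (r : seq J) (x : J -> R) : mono r x (fun j => d0 j) = 1.
  by rewrite /mono big1 // => j _; rewrite ffunE.
rewrite -(mono0 _ (rn ++ rq) xg) retract_mono mono0 ifT //.
by apply/forall_inP => j _; rewrite ffunE.
Qed.

Variable L : lmodType B.

(* a (x) w |-> retract a *: w is well defined, since retract is right B-linear. *)
Lemma tens1_neq0 (w : L) : w != 0 -> tens incl 1 w != 0.
Proof.
apply: contra_neq => w0.
pose h (aw : A * L) : L := retract aw.1 *: aw.2.
have /to_tensorP : to_tensor incl (fa_gen ((1, w) : A * L)) =
    to_tensor incl (0 : monalg.malg (A * L)%type int).
  by rewrite to_tensor0.
rewrite subr0 => /(_ (fun x => fa_lift h x = 0)) H.
have : fa_lift h (fa_gen (1, w)) = 0.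
  apply: H => [|x y hx hy|x [a a' u|a u u'|a b u]].
  - by rewrite -[X in fa_lift h X](subrr 0) fa_liftB subrr.
  - by rewrite fa_liftB hx hy subrr.
  - by rewrite !fa_liftB !fa_lift_gen /h /= retractD scalerDl addrAC addrK subrr.
  - by rewrite !fa_liftB !fa_lift_gen /h /= scalerDr addrAC addrK subrr.
  - by rewrite !fa_liftB !fa_lift_gen /h /= retractM scalerA subrr.
by rewrite fa_lift_gen /h /= retract1 scale1r.
Qed.

End Retraction.

(** * Simplicity of the induced module *)

Section GradedInduction.
Variables (F : fieldType) (A B : pzRingType) (incl : {rmorphism B -> A}).
Variables (rcg : {rmorphism F -> A}) (rcq : {rmorphism F -> B}).
Hypothesis rcg_central : forall s a, rcg s * a = a * rcg s.
Hypothesis rcq_central : forall s b, rcq s * b = b * rcq s.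
Hypothesis incl_rc : forall s, incl (rcq s) = rcg s.
Variables (J : finType) (dg : J -> int) (p : nat) (xg : J -> A) (xq : J -> B).
Hypothesis p_gt1 : (1 < p)%N.
Hypothesis incl_x : forall j, 0 <= dg j -> incl (xq j) = xg j.

Definition homog (K : pzRingType) (rc : {rmorphism F -> K}) (x : J -> K) (d : int) : K -> Prop :=
  linspan rc (fun y => exists2 k, dg k = d & y = x k).

Hypothesis bracket_g : forall i j, homog rcg xg (dg i + dg j) (xg i * xg j - xg j * xg i).
Hypothesis bracket_q : forall i j, 0 <= dg i -> 0 <= dg j ->
  homog rcq xq (dg i + dg j) (xq i * xq j - xq j * xq i).
(** The form psi vanishes in positive degree, so p-th powers are homogeneous there; in negative
    degree they may acquire a scalar, whence the extra 1 in [power_neg]. *)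
Hypothesis power_pos : forall i, 0 < dg i -> homog rcg xg (dg i *+ p) (xg i ^+ p).
Hypothesis power_neg : forall i, dg i < 0 ->
  linspan rcg (fun y => (exists2 k, dg k = dg i *+ p & y = xg k) \/ y = 1) (xg i ^+ p).

Variables rp rn : seq J.
Hypotheses (uniq_rp : uniq rp) (uniq_rn : uniq rn).
Hypothesis mem_rp : forall j, (j \in rp) = (0 < dg j).
Hypothesis mem_rn : forall j, (j \in rn) = (dg j < 0).
Hypothesis dg_balance : \sum_(j <- rp) dg j = - \sum_(j <- rn) dg j.

Hypothesis q_ind : forall Q : B -> Prop,
  (forall s, Q (rcq s)) -> (forall j, 0 <= dg j -> Q (xq j)) ->
  (forall a b, Q a -> Q b -> Q (a + b)) -> (forall a b, Q a -> Q b -> Q (a * b)) ->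
  forall b, Q b.
Hypothesis g_span : forall a : A, exists b : {ffun J -> 'I_p} -> B,
  a = \sum_(d : {ffun J -> 'I_p}) mono rn xg (fun j => d j) * incl (b d).

Variable L : lmodType B.
Hypothesis simpleL : simple_module L.
Variable v : L.
Hypothesis gen_v : generated_by v.
Hypothesis max_v : forall j, 0 < dg j -> xq j *: v = 0.

Local Notation Z := (tensor incl L).
Local Notation "a '(x)' w" := (tens incl a (w : L)) (at level 40).

Lemma scale_tens (a b : A) (w : L) : a *: (b (x) w : Z) = (a * b) (x) w.
Proof. exact: tensor_scale_tens. Qed.

(** The vectors killed by all positive letters form a submodule, because the bracket of a positive
    letter with one of degree at least 0 has positive degree; and v generates L. *)
Lemma pos_kills (w : L) j : 0 < dg j -> xq j *: w = 0.
Proof.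
move: w j; apply: (gen_v (N := fun w : L => forall j, 0 < dg j -> xq j *: w = 0)); last exact: max_v.
split=> [j _|u w Hu Hw j j0|b w Hw j j0]; first by rewrite scaler0.
  by rewrite scalerDr Hu // Hw // addr0.
elim/q_ind: b w Hw j j0 => [s|i i0|a b Ha Hb|a b Ha Hb] w Hw j j0.
- by rewrite scalerA -rcq_central -scalerA Hw // scaler0.
- have ji := bracket_q (ltW j0) i0; rewrite scalerA -[xq j * xq i](subrK (xq i * xq j)).
  rewrite scalerDl -scalerA Hw // scaler0 addr0.
  elim: ji => [|a b _ Ha _ Hb|s a _ Ha|_ [k dk ->]].
  + by rewrite scale0r.
  + by rewrite scalerDl Ha Hb addr0.
  + by rewrite -scalerA Ha scaler0.
  + by apply: Hw; rewrite dk; apply: ltr_pwDl.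
- by rewrite scalerDl scalerDr Ha // Hb // addr0.
- by rewrite -scalerA; apply: Ha => // k k0; apply: Hb.
Qed.

Lemma homog_pos_tens d a : homog rcg xg d a -> 0 < d -> forall b w, (b * a) (x) w = 0.
Proof.
move=> ha d0; elim: ha => [|a1 a2 _ H1 _ H2|s a1 _ H1|_ [k dk ->]] b w.
- by rewrite mulr0; apply: (@addrI _ (0 (x) w)); rewrite -tensDl !addr0.
- by rewrite mulrDr tensDl H1 H2 addr0.
- by rewrite mulrA H1.
- rewrite -(incl_x (j := k)) ?dk ?ltW // tensM pos_kills ?dk //.
  by apply: (@addrI _ (b (x) 0)); rewrite -tensDr !addr0.
Qed.

Lemma homog_bracket i j a b : homog rcg xg i a -> homog rcg xg j b ->
  homog rcg xg (i + j) (a * b - b * a).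
Proof.
move=> ha hb.
elim: ha => [|a1 a2 _ H1 _ H2|s a1 _ H1|_ [k <- ->]].
- by rewrite mul0r mulr0 subrr; apply: linspan0.
- by rewrite mulrDl mulrDr opprD addrACA; apply: linspanD.
- by rewrite mulrA -rcg_central -!mulrA -mulrBr; apply: linspanZ.
elim: hb => [|b1 b2 _ H1 _ H2|s b1 _ H1|_ [l <- ->]].
- by rewrite mul0r mulr0 subrr; apply: linspan0.
- by rewrite mulrDl mulrDr opprD addrACA; apply: linspanD.
- by rewrite mulrA -rcg_central -!mulrA -mulrBr; apply: linspanZ.
exact: bracket_g.
Qed.

(* A letter of positive degree can be moved to the right end, where it kills L. *)
Lemma positive_degree_tens (s : seq (A * int)) :
  (forall l, l \in s -> homog rcg xg l.2 l.1) -> 0 < \sum_(l <- s) l.2 ->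
  forall w, (\prod_(l <- s) l.1) (x) w = 0.
Proof.
have [m] := ubnP (size s); elim: m s => // m IHm s le_sm hs d_gt0 w.
have [l l_s l0] : exists2 l, l \in s & 0 < l.2.
  apply/hasP; rewrite -[has _ _]negbK -all_predC; apply/negP => /allP neg.
  move: d_gt0; apply/negP; rewrite -leNgt big_seq; apply: sumr_le0 => l ls.
  by have := neg l ls; rewrite /= -leNgt.
case/splitPr: l_s le_sm hs d_gt0 => s1 s2 le_sm hs d_gt0.
elim: s2 s1 le_sm hs d_gt0 => [|l' s2 IHs] s1 le_sm hs d_gt0.
  rewrite big_cat big_seq1; apply: homog_pos_tens l0 _ _; apply: hs.
  by rewrite mem_cat inE eqxx orbT.
have hl : homog rcg xg l.2 l.1 by apply: hs; rewrite mem_cat !inE eqxx orbT.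
have hl' : homog rcg xg l'.2 l'.1 by apply: hs; rewrite mem_cat !inE eqxx !orbT.
(* Moving [l] past its right neighbour leaves a bracket, which gives a shorter product of the same
   total degree. *)
pose br := (l.1 * l'.1 - l'.1 * l.1, l.2 + l'.2).
have -> : \prod_(l <- s1 ++ [:: l, l' & s2]) l.1 =
    \prod_(l <- s1 ++ br :: s2) l.1 + \prod_(l <- rcons s1 l' ++ l :: s2) l.1.
  rewrite cat_rcons !big_cat !big_cons /= -mulrDr; congr (_ * _).
  by rewrite mulrBl !mulrA subrK.
rewrite tensDl IHm ?add0r.
- apply: IHs.
  + by move: le_sm; rewrite !size_cat size_rcons /= addSnnS.
  + move=> l1 l1s; apply: hs; move: l1s; rewrite !mem_cat mem_rcons !inE.
    by case: (l1 == l); case: (l1 == l'); case: (l1 \in s1).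
  + by move: d_gt0; rewrite cat_rcons !big_cat !big_cons /=; rewrite [l.2 + _]addrCA.
- by move: le_sm; rewrite !size_cat /=; lia.
- move=> l1; rewrite mem_cat inE => /or3P[l1s|/eqP ->|l1s]; last first.
  + by apply: hs; rewrite mem_cat !inE l1s !orbT.
  + exact: homog_bracket.
  + by apply: hs; rewrite mem_cat l1s.
- by move: d_gt0; rewrite !big_cat !big_cons /= !addrA.
Qed.

Local Notation top := (fun=> p.-1).
Local Notation E := (mono rp xg top).
Local Notation Fn := (mono rn xg top).
(** A reduced monomial in the negative letters differs from [Fn] exactly when its total exponent is
    below the maximum, so with trivial weights [low] spans all of them but [Fn]. *)
Local Notation nontop := (low rcg p rn xg (fun=> 0%N) (\sum_(j <- rn) p.-1) 0).

Lemma sum_flat (r : seq J) (a : J -> nat) :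
  \sum_(j <- flat r a) dg j = \sum_(j <- r) dg j *+ a j.
Proof.
rewrite /flat; elim: r => [|j r IHr]; first by rewrite !big_nil.
by rewrite /= big_cat big_cons IHr big_nseq iter_addr addr0.
Qed.

(** By [dg_balance] the degree of E f^a is the sum of (a_j - (p - 1)) dg j over the negative
    letters. All its terms are at least 0, and one is positive if f^a is not the top monomial. *)
Lemma nontop_killed e w : nontop e -> (E * e) (x) w = 0.
Proof.
elim=> [|a b _ Ha _ Hb|s a _ Ha|_ [a [-> a_lt a_top _]]].
- by rewrite mulr0; apply: (@addrI _ (0 (x) w)); rewrite -tensDl !addr0.
- by rewrite mulrDr tensDl Ha Hb addr0.
- by rewrite mulrA -rcg_central -mulrA -scale_tens Ha scaler0.
pose s := [seq (xg j, dg j) | j <- flat rp top ++ flat rn a].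
have := @positive_degree_tens s _ _ w; rewrite {3}/s big_map big_cat /= => <- //.
- by rewrite -!/(word xg _) !word_flat.
- by move=> _ /mapP[j _ ->]; apply: linspan_gen; exists j.
rewrite /s big_map big_cat /= !sum_flat sumrMnl dg_balance mulNrn -sumrMnl addrC -sumrB.
have [j j_rn lt_j] : exists2 j, j \in rn & (a j < p.-1)%N.
  apply/hasP; rewrite -[has _ _]negbK -all_predC; apply/negP => /allP ge_top.
  move: a_top; apply/negP; rewrite -leqNgt 2!big_seq.
  by apply: leq_sum => k k_rn; have := ge_top k k_rn; rewrite /= -leqNgt.
rewrite (bigD1_seq j j_rn uniq_rn) /=; apply: ltr_pwDl.
  by rewrite subr_gt0 ltr_nMn2l // -mem_rn.
rewrite big_seq_cond; apply: sumr_ge0 => k /andP[k_rn _].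
rewrite subr_ge0 ler_wnMn2l //; first by rewrite ltW // -mem_rn.
by rewrite -ltnS prednK ?(ltnW p_gt1) // a_lt.
Qed.

Lemma bracket_rn i j : i \in rn -> j \in rn -> linspan rcg
  (fun y => exists k, [/\ k \in rn, 0 = 0 + 0 & y = xg k]%N) (xg i * xg j - xg j * xg i).
Proof.
move=> i_rn j_rn; apply: linspan_sub (bracket_g i j) => _ [k dk ->]; apply: linspan_gen.
exists k; split=> //; rewrite mem_rn dk -oppr_gt0 opprD; apply: addr_gt0;
  by rewrite oppr_gt0 -mem_rn.
Qed.

Lemma power_rn i : i \in rn -> linspan rcg
  (fun y => (exists k, [/\ k \in rn, 0 = p * 0 & y = xg k]%N) \/ (p * 0 = 0)%N /\ y = 1)
  (xg i ^+ p).
Proof.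
rewrite mem_rn => i0; apply: linspan_sub (power_neg i0) => _ [[k dk ->]|->]; apply: linspan_gen.
  left; exists k; split; rewrite ?muln0 // mem_rn dk -oppr_gt0 -mulNrn.
  by rewrite pmulrn_lgt0 ?(ltnW p_gt1) // oppr_gt0.
by right; rewrite muln0.
Qed.

Let rn_weight (a : J -> nat) : (\sum_(j <- rn) a j * 0 = 0)%N.
Proof. by rewrite big1 // => j _; rewrite muln0. Qed.

Lemma mono_rn_top (a : J -> nat) : (forall j, j \in rn -> (a j < p)%N) ->
  (\sum_(j <- rn) p.-1 <= \sum_(j <- rn) a j)%N -> {in rn, a =1 top}.
Proof.
move=> a_lt a_ge j j_rn; have p_gt0 := ltnW p_gt1.
have a_le k : k \in rn -> (a k <= p.-1)%N by move=> k_rn; rewrite -ltnS prednK ?a_lt.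
apply/eqP; rewrite eqn_leq a_le //= leqNgt; apply/negP => lt_j.
move: a_ge; apply/negP; rewrite -ltnNge !(bigD1_seq j j_rn uniq_rn) /= -addSn leq_add //.
by rewrite big_seq_cond [X in (_ <= X)%N]big_seq_cond; apply: leq_sum => k /andP[/a_le].
Qed.

Lemma mono_rn_span (a : J -> nat) : (forall j, j \in rn -> (a j < p)%N) ->
  linspan rcg (fun y => y = Fn \/ nontop y) (mono rn xg a).
Proof.
move=> a_lt; apply: linspan_gen.
case: (leqP (\sum_(j <- rn) p.-1) (\sum_(j <- rn) a j)) => [le|lt].
  left; have a_top := mono_rn_top a_lt le.
  by apply: eq_big_seq => j /a_top ->.
by right; apply: linspan_gen; exists a; split=> //; exact: rn_weight.
Qed.

Lemma word_rn_span t : all (mem rn) t -> linspan rcg (fun y => y = Fn \/ nontop y) (word xg t).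
Proof.
move=> /(straighten_low rcg_central p_gt1 uniq_rn bracket_rn power_rn); apply: linspan_sub.
by move=> _ [a [-> a_lt _ _]]; apply: mono_rn_span.
Qed.

Lemma bracket_rp i j : i \in rp -> j \in rp -> linspan rcg
  (fun y => exists k, [/\ k \in rp, `|dg k| = `|dg i| + `|dg j| & y = xg k]%N)
  (xg i * xg j - xg j * xg i).
Proof.
rewrite !mem_rp => i0 j0; apply: linspan_sub (bracket_g i j) => _ [k dk ->]; apply: linspan_gen.
by exists k; rewrite mem_rp dk; split=> //; [apply: addr_gt0 | lia].
Qed.

Lemma power_rp i : i \in rp -> linspan rcg
  (fun y => (exists k, [/\ k \in rp, `|dg k| = p * `|dg i| & y = xg k]%N) \/
            (p * `|dg i| = 0)%N /\ y = 1) (xg i ^+ p).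
Proof.
rewrite mem_rp => i0; apply: linspan_sub (power_pos i0) => _ [k dk ->]; apply: linspan_gen.
left; exists k; rewrite mem_rp dk; split=> //; first by rewrite pmulrn_lgt0 // ltnW.
by rewrite -mulr_natl natz abszM.
Qed.

(** Commuting with a letter of degree 0 preserves the degree, and positive letters straighten
    homogeneously. Among reduced monomials only E attains its degree, since every letter has
    positive weight and exponent at most p - 1. *)
Lemma commutes_E k : dg k = 0 -> exists s, xg k * E - E * xg k = rcg s * E.
Proof.
move=> k0; apply: linspan_line.
pose wt j := `|dg j|%N.
have p_gt0 := ltnW p_gt1.
have comm_k i : i \in rp -> linspan rcg (fun a => exists l, [/\ l \in rp, wt l = wt i & a = xg l])
    (xg k * xg i - xg i * xg k).
  rewrite mem_rp => i0; apply: linspan_sub (bracket_g k i) => _ [l dl ->]; apply: linspan_gen.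
  by exists l; rewrite mem_rp /wt dl k0 add0r.
have flat_rp : all (mem rp) (flat rp top) by apply/allP => j /mem_flat.
rewrite -(word_flat rp xg); apply: linspan_sub (commutator_word rcg_central comm_k flat_rp).
move=> _ [t [t_rp _ wt_t ->]].
apply: linspan_sub (straighten_low rcg_central p_gt1 uniq_rp bracket_rp power_rp t_rp).
move=> _ [a [-> a_lt _ wt_a]]; apply: linspan_gen; rewrite word_flat.
apply: eq_big_seq => j j_rp; congr (_ ^+ _).
have a_le i : i \in rp -> (a i * wt i <= p.-1 * wt i)%N.
  by move=> i_rp; rewrite leq_mul2r -ltnS prednK // a_lt // orbT.
have wt_j : (0 < wt j)%N by move: j_rp; rewrite mem_rp /wt; lia.
apply/eqP; rewrite -(eqn_pmul2r wt_j) eqn_leq a_le //= leqNgt; apply/negP => lt_j.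
have : (\sum_(i <- rp) a i * wt i < \sum_(i <- rp) p.-1 * wt i)%N.
  rewrite !(bigD1_seq j j_rp uniq_rp) /= -addSn leq_add //.
  by rewrite big_seq_cond [X in (_ <= X)%N]big_seq_cond; apply: leq_sum => i /andP[/a_le].
by rewrite wt_a wt_t weight_flat ltnn.
Qed.

(** Here p-th powers may produce scalars and break homogeneity, so lower monomials remain; they are
    harmless once E stands in front of them. *)
Lemma commutes_Fn k : dg k = 0 -> linspan rcg (fun y => y = Fn \/ nontop y) (xg k * Fn - Fn * xg k).
Proof.
move=> k0.
have comm_k i : i \in rn -> linspan rcg (fun a => exists l, [/\ l \in rn, 0 = 0 & a = xg l]%N)
    (xg k * xg i - xg i * xg k).
  rewrite mem_rn => i0; apply: linspan_sub (bracket_g k i) => _ [l dl ->]; apply: linspan_gen.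
  by exists l; rewrite mem_rn dl k0 add0r.
have flat_rn : all (mem rn) (flat rn top) by apply/allP => j /mem_flat.
rewrite -(word_flat rn xg); apply: linspan_sub (commutator_word rcg_central (wt := fun=> 0%N) comm_k flat_rn).
by move=> _ [t [t_rn _ _ ->]]; rewrite word_flat; apply: word_rn_span.
Qed.

Lemma nontop_or_Fn_tens a : linspan rcg (fun y => y = Fn \/ nontop y) a ->
  exists s, forall w, (E * a) (x) w = (rcg s * (E * Fn)) (x) w.
Proof.
elim=> [|a1 a2 _ [s1 H1] _ [s2 H2]|s a1 _ [s1 H1]|y [->|y_low]].
- by exists 0 => w; rewrite rmorph0 mulr0 mul0r.
- by exists (s1 + s2) => w; rewrite mulrDr rmorphD mulrDl !tensDl H1 H2.
- by exists (s * s1) => w; rewrite mulrA -rcg_central -mulrA -scale_tens H1 scale_tens mulrA rmorphM.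
- by exists 1 => w; rewrite rmorph1 mul1r.
- exists 0 => w; rewrite rmorph0 mul0r (nontop_killed w y_low).
  by apply: (@addrI _ (0 (x) w)); rewrite -tensDl !addr0.
Qed.

(** Positive letters kill L and scalars are central, so the point is a letter x of degree 0: E Fn x
    (x) w differs from x E Fn (x) w by scalar multiples of E Fn (x) w. *)
Lemma preimage_submodule (N : Z -> Prop) : submodule N ->
  submodule (fun w : L => N ((E * Fn) (x) w)).
Proof.
move=> [N0 ND NZ].
have tens0 a : a (x) 0 = 0 by apply: (@addrI _ (a (x) 0)); rewrite -tensDr !addr0.
have NB y z : N y -> N z -> N (y - z).
  move=> Ny Nz; apply: ND => //; rewrite -scaleN1r; exact: NZ.
split=> [|u w Nu Nw|b w Nw]; first by rewrite tens0.
  by rewrite tensDr; apply: ND.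
elim/q_ind: b w Nw => [s|j j0|a b Na Nb|a b Na Nb] w Nw.
- by rewrite -tensM incl_rc -rcg_central -scale_tens; apply: NZ.
- move: j0; rewrite le_eqVlt => /orP[/eqP j0|j0]; last by rewrite pos_kills // tens0.
  have [s eq_E] := commutes_E (esym j0).
  have [s' eq_F] := nontop_or_Fn_tens (commutes_Fn (esym j0)).
  rewrite -tensM incl_x; last by rewrite -j0.
  (* Move the letter leftwards, first past Fn and then past E. *)
  have -> : E * Fn * xg j = xg j * (E * Fn) - (rcg s * (E * Fn) + E * (xg j * Fn - Fn * xg j)).
    rewrite [rcg s * _]mulrA -eq_E mulrBl mulrBr !mulrA addrA subrK opprB addrCA subrr addr0.
    by [].
  have tensB a c u : (a - c) (x) u = a (x) u - c (x) u.
    by apply: (@addIr _ (c (x) u)); rewrite -tensDl !subrK.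
  rewrite tensB tensDl eq_F -!(scale_tens _ (E * Fn)); apply: (NB); first exact: NZ.
  by apply: ND; apply: NZ.
- by rewrite scalerDl tensDr; apply: ND; [apply: Na | apply: Nb].
- by rewrite -scalerA; apply: Na; apply: Nb.
Qed.

Local Notation expo := {ffun J -> 'I_p}.

Let supported (d : expo) : bool := [forall j, (j \notin rn) ==> (d j == 0 :> nat)].

(** Exponents are functions on all letters; setting them to 0 off [rn] makes distinct exponents
    differ on [rn], so that different terms involve different monomials. *)
Lemma tensor_normal_form (y : Z) : exists w : expo -> L,
  (forall d, ~~ supported d -> w d = 0) /\ y = \sum_(d : expo) mono rn xg (fun j => d j) (x) w d.
Proof.
have tens0r a : a (x) 0 = 0 by apply: (@addrI _ (a (x) 0)); rewrite -tensDr !addr0.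
have tensNr a u : a (x) (- u) = - (a (x) u).
  by apply: (@addrI _ (a (x) u)); rewrite -tensDr !subrr.
have tens_suml (I : finType) (f : I -> A) u : (\sum_i f i) (x) u = \sum_i f i (x) u.
  apply: (big_morph (fun a => a (x) u)) => [a b|]; first exact: tensDl.
  by apply: (@addrI _ (0 (x) u)); rewrite -tensDl !addr0.
have tens_sumr (I : finType) (Q : pred I) a (f : I -> L) :
    a (x) (\sum_(i | Q i) f i) = \sum_(i | Q i) a (x) f i.
  by apply: (big_morph (tens incl a)) => [u w|]; [exact: tensDr | exact: tens0r].
elim/tensor_ind: y => [|y1 y2 [w1 [S1 ->]] [w2 [S2 ->]]|a u].
- by exists (fun=> 0); split=> //; rewrite big1.
- exists (fun d => w1 d - w2 d); split=> [d nd|]; first by rewrite S1 // S2 // subrr.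
  by rewrite -sumrB; apply: eq_bigr => d _; rewrite tensDr tensNr.
have [b ->] := g_span a; rewrite tens_suml.
have p_gt0 := ltnW p_gt1.
pose res (d : expo) : expo := [ffun j => if j \in rn then d j else Ordinal p_gt0].
exists (fun e => \sum_(d | res d == e) b d *: u); split=> [e ne|].
  rewrite big1 // => d /eqP de; case/negP: ne; apply/forallP => j; apply/implyP => j_rn.
  by rewrite -de ffunE (negPf j_rn).
rewrite (partition_big res xpredT) //=; apply: eq_bigr => e _.
rewrite tens_sumr; apply: eq_bigr => d /eqP de; rewrite tensM; congr (_ (x) _).
by apply: eq_big_seq => j j_rn; rewrite -de ffunE j_rn.
Qed.

(** The product has length at most that of Fn. Modulo shorter reduced monomials it is the monomial
    with exponents p - 1 - d + e, or 0 if one of these reaches p; it can be Fn only for e = d. *)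
Lemma complementary_monomial (d e : expo) : supported d -> supported e ->
  (\sum_(j <- rn) e j <= \sum_(j <- rn) d j)%N ->
  nontop (mono rn xg (fun j => p.-1 - d j)%N * mono rn xg (fun j => e j) -
          (if e == d then Fn else 0)).
Proof.
move=> sd se le_ed; set c := (fun j => p.-1 - d j)%N; have p_gt0 := ltnW p_gt1.
have le_d j : (d j <= p.-1)%N by rewrite -ltnS prednK.
have cd : (\sum_(j <- rn) c j + \sum_(j <- rn) d j = \sum_(j <- rn) p.-1)%N.
  by rewrite -big_split; apply: eq_bigr => j _; rewrite /= subnK.
pose s := flat rn c ++ flat rn (fun j => e j).
have s_rn : all (mem rn) s by rewrite all_cat; apply/andP; split; apply/allP => j /mem_flat.
have sz_s : (size s <= \sum_(j <- rn) p.-1)%N.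
  by rewrite size_cat !size_flat -cd leq_add2l.
have count_s j : j \in rn -> count_mem j s = (c j + e j)%N.
  by move=> j_rn; rewrite count_cat !count_flat.
have := straighten rcg_central p_gt1 uniq_rn bracket_rn power_rn s_rn.
rewrite {2}/s word_cat !word_flat => low_s.
have {low_s} : nontop (mono rn xg c * mono rn xg (fun j => e j) -
    (if all (fun i => count_mem i s < p)%N rn then mono rn xg (fun i => count_mem i s) else 0)).
  apply: low_leq sz_s _; move: low_s; rewrite [weight _ s]big1 //.
case: eqP => [eq_ed|ne_ed].
  have count_top j : j \in rn -> count_mem j s = p.-1.
    by move=> j_rn; rewrite count_s // eq_ed /c subnK.
  rewrite ifT; last by apply/allP => j j_rn; rewrite /= count_top // prednK.
  by congr (nontop (_ - _)); apply: eq_big_seq => j j_rn; rewrite count_top.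
rewrite subr0; case: ifP => [/allP lt_s|_]; last by rewrite subr0.
move=> low_s; rewrite -[_ * _](subrK (mono rn xg (fun i => count_mem i s))).
apply: linspanD => //; apply: linspan_gen; exists (fun i => count_mem i s); split=> //.
rewrite ltnNge; apply/negP => ge_top; apply: ne_ed; apply/ffunP => j; apply: val_inj => /=.
case j_rn: (j \in rn); last first.
  have := forallP sd j; have := forallP se j; rewrite j_rn /= => /eqP -> /eqP ->.
  by [].
have := mono_rn_top lt_s ge_top j_rn; rewrite /= count_s // /c; have := le_d j.
lia.
Qed.

Variable R : F.
Hypothesis R_neq0 : R != 0.
Hypothesis top_scalar : (E * Fn) (x) v = rcg R (x) v.
Hypothesis nonzero : 1 (x) v != 0.

Theorem graded_induction_simple : simple_module (Z : lmodType A).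
Proof.
split; first by exists (1 (x) v).
move=> N subN; have [N0 ND NZ] := subN.
have [[y Ny y0]|none] := boolp.pselect (exists2 y, N y & y != 0); last first.
  left=> y Ny; have [//|y0] := eqVneq y 0.
  by case: none; exact: (ex_intro2 _ _ y Ny y0).
right.
have [w [sw eq_y]] := tensor_normal_form y.
have [d0 wd0] : exists d, w d != 0.
  apply: boolp.contrapT => all0; case/negP: y0; rewrite eq_y big1 // => d _.
  have -> : w d = 0 by apply/eqP/negPn/negP => wd; apply: all0; exists d.
  by apply: (@addrI _ (mono rn xg (fun j => d j) (x) 0)); rewrite -tensDr !addr0.
pose size_rn (d : expo) := (\sum_(j <- rn) d j)%N.
have [d wd max_d] := @arg_maxnP _ d0 (fun d => w d != 0) size_rn wd0.
have le_d e : w e != 0 -> (size_rn e <= size_rn d)%N by move=> we; apply: max_d.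
have sd : supported d by apply: contraNT wd => /sw ->.
have tens0r a : a (x) 0 = 0 by apply: (@addrI _ (a (x) 0)); rewrite -tensDr !addr0.
(* Maximality of d lets E f^(p-1-d) annihilate every other term of y. *)
have N_Fd : N ((E * Fn) (x) w d).
  have := NZ (E * mono rn xg (fun j => p.-1 - d j)%N) _ Ny; rewrite eq_y scaler_sumr.
  congr N; rewrite (bigD1 d) //= big1 => [|e ne_ed].
    rewrite addr0 scale_tens -mulrA.
    have := complementary_monomial sd sd (leqnn _); rewrite eqxx => /(nontop_killed (w d)).
    rewrite mulrBr => eq0; apply: (@addIr _ (- ((E * Fn) (x) w d))); rewrite subrr.
    by apply: etrans eq0; apply: (@addIr _ ((E * Fn) (x) w d)); rewrite -tensDl !subrK.
  have [->|we] := eqVneq (w e) 0; first by rewrite tens0r scaler0.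
  have se : supported e by apply: contraNT we => /sw ->.
  have := complementary_monomial sd se (le_d e we); rewrite (negPf ne_ed) subr0.
  by move/(nontop_killed (w e)); rewrite scale_tens mulrA.
(* The submodule contains the nonzero vector [w d], so it is all of L and in particular contains
   v. *)
have [_ /(_ _ (preimage_submodule subN)) [zero|all_L]] := simpleL.
  by rewrite (zero _ N_Fd) eqxx in wd.
have Nv : N (1 (x) v).
  have := NZ (rcg R^-1) _ (all_L v); rewrite top_scalar scale_tens -rmorphM mulVf //.
  by rewrite rmorph1.
have N1 : forall u, N (1 (x) u).
  apply: gen_v Nv; split=> [|u1 u2|b u Nu]; first by rewrite tens0r.
    by rewrite tensDr; apply: ND.
  by rewrite -tensM mul1r -[incl b]mulr1 -scale_tens; apply: NZ.
elim/tensor_ind=> [//|y1 y2 N1' N2'|a u]; last by rewrite -[a]mulr1 -scale_tens; apply: NZ.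
by apply: ND => //; rewrite -scaleN1r; apply: NZ.
Qed.

End GradedInduction.

(** * The grading by roots *)

Section TorusWeights.
Variables (F : fieldType) (n : nat) (T : 'M[F]_n -> Prop).
Hypothesis torusT : torus T.
Implicit Types (x y t : 'M[F]_n) (mu nu : 'M[F]_n -> F).

Lemma torus_unit t : T t -> t \in unitmx.
Proof. by have [[[S TS] _] _] := torusT; move/TS=> []. Qed.

Lemma torus_comm s t : T s -> T t -> s *m t = t *m s.
Proof.
move=> Ts Tt; case: torusT => _ [r [f [g [[fT fM _] [gT _ _] _ fgK]]]].
rewrite -(fgK s Ts) -(fgK t Tt).
have [ds _] := gT s Ts; have [dt _] := gT t Tt.
rewrite -!fM; try exact: gT.
case/diag_mxP: ds => u ->; case/diag_mxP: dt => w ->.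
by rewrite diag_mxC.
Qed.

Definition weight_vector mu x : Prop := forall t, T t -> t *m x *m invmx t = mu t *: x.

Lemma weight_vectorE mu x t : weight_vector mu x -> T t -> t *m x = mu t *: (x *m t).
Proof.
move=> wx Tt; rewrite scalemxAl -wx // mulmxKV //; exact: torus_unit.
Qed.

Lemma weight_vectorM mu nu x y : weight_vector mu x -> weight_vector nu y ->
  weight_vector (fun t => mu t * nu t) (x *m y).
Proof.
move=> wx wy t Tt; have Ut := torus_unit Tt.
have -> : t *m (x *m y) = (mu t * nu t) *: (x *m y *m t).
  rewrite mulmxA (weight_vectorE wx Tt) -scalemxAl -mulmxA (weight_vectorE wy Tt).
  by rewrite -scalemxAr scalerA mulmxA.
by rewrite -scalemxAl -mulmxA mulmxV // mulmx1.
Qed.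

Lemma weight_vectorD mu c x y : weight_vector mu x -> weight_vector mu y ->
  weight_vector mu (c *: x + y).
Proof.
move=> wx wy t Tt; rewrite mulmxDr mulmxDl -scalemxAr -scalemxAl wx // wy //.
by rewrite scalerDr !scalerA mulrC.
Qed.

Lemma weight_vector_ext mu nu x : (forall t, T t -> mu t = nu t) ->
  weight_vector mu x -> weight_vector nu x.
Proof. by move=> eq_mu wx t Tt; rewrite wx // eq_mu. Qed.

Lemma weight_vectorX mu x m : weight_vector mu x -> weight_vector (fun t => mu t ^+ m) (x ^+ m).
Proof.
move=> wx; elim: m => [|m IHm] t Tt.
  by rewrite !expr0 scale1r mulmx1 mulmxV // torus_unit.
by rewrite exprS (weight_vectorM wx IHm Tt) -exprS.
Qed.

Lemma weight_vector_bracket mu nu x y : weight_vector mu x -> weight_vector nu y ->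
  weight_vector (fun t => mu t * nu t) (lie_bracket x y).
Proof.
move=> wx wy; have wxy := weight_vectorM wx wy.
have wyx : weight_vector (fun t => mu t * nu t) (y *m x).
  by apply: weight_vector_ext (weight_vectorM wy wx) => t _; rewrite mulrC.
rewrite /lie_bracket addrC -scaleN1r; exact: weight_vectorD.
Qed.

(** T is commutative, so the linear functions giving the entries of t y - y t vanish on T; their
    differentials then vanish on Lie(T), hence x commutes with t. *)
Lemma weight_vector_lie x : x \in lie T -> weight_vector (fun=> 1) x.
Proof.
move=> /lieP tx t Tt; have Ut := torus_unit Tt.
suff -> : t *m x = x *m t by rewrite -mulmxA mulmxV // mulmx1 scale1r.
apply/matrixP => i j; apply/eqP; rewrite -subr_eq0; apply/eqP.
pose tau (y : 'M[F]_n) := (t *m y) i j - (y *m t) i j.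
have tau_lin : scalar tau.
  move=> c y z; rewrite /tau mulmxDr mulmxDl -scalemxAr -scalemxAl !mxE.
  by rewrite mulrBr opprD addrACA.
have : mx_diff1 (linform tau 1%:M) x = 0.
  apply: tx => g Tg; rewrite mx_eval_linform // mulmx1 /tau.
  by rewrite (torus_comm Tt Tg) subrr.
by rewrite mx_diff1E vfield_linform mulmx1 -/(at1 _) at1_linform.
Qed.

(** Artin's argument: apply conjugation by t minus one of the eigenvalues to shorten the
    relation. *)
Lemma weight_independence (J : finType) (mu : J -> 'M[F]_n -> F) (v : J -> 'M[F]_n) :
  (forall j, weight_vector (mu j) (v j)) ->
  (forall i j, (forall t, T t -> mu i t = mu j t) -> i = j) ->
  \sum_j v j = 0 -> forall j, v j = 0.
Proof.
move=> wv mu_inj sum0.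
suff H m : forall (Q : {set J}) v, #|Q| = m -> (forall j, weight_vector (mu j) (v j)) ->
    \sum_(j in Q) v j = 0 -> forall j, j \in Q -> v j = 0.
  move=> j; apply: (H _ [set: J] v erefl) => //.
  by rewrite -[RHS]sum0; apply: eq_bigl => i; rewrite inE.
elim: m => [|m IHm] {wv sum0 v} Q v cardQ wv sum0 i iQ.
  by move/eqP: cardQ; rewrite cards_eq0 => /eqP Q0; rewrite Q0 inE in iQ.
have [/existsP[k /andP[kQ ki]]|none] := boolP [exists k, (k \in Q) && (k != i)]; last first.
  rewrite -[RHS]sum0 (bigD1 i) //= big1 ?addr0 // => k /andP[kQ ki].
  by case/existsP: none; exists k; rewrite kQ.
have [t Tt mu_t] : exists2 t, T t & mu i t != mu k t.
  apply: boolp.contrapT => all_eq; case/negP: ki; apply/eqP/esym/mu_inj => t Tt.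
  by apply/eqP/negPn/negP => ne; apply: all_eq; exists t.
(* The new relation loses the index [k] and keeps [i] with a nonzero factor. *)
have : (mu i t - mu k t) *: v i = 0.
  apply: (IHm (Q :\ k) (fun j => (mu j t - mu k t) *: v j)).
  - by move: cardQ; rewrite (cardsD1 k) kQ => -[].
  - move=> j; rewrite -[_ *: v j]addr0; apply: weight_vectorD => // s Ts.
    by rewrite mulmx0 mul0mx scaler0.
  - have : t *m (\sum_(j in Q) v j) *m invmx t - mu k t *: (\sum_(j in Q) v j) = 0.
      by rewrite sum0 mulmx0 mul0mx scaler0 subrr.
    rewrite mulmx_sumr mulmx_suml scaler_sumr -sumrB (bigD1 k) //= wv // subrr add0r.
    move=> eq0; apply: etrans eq0; apply: eq_big => [j|j _]; first by rewrite !inE andbC.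
    by rewrite wv // scalerBl.
  - by rewrite !inE iQ eq_sym ki.
by move/eqP; rewrite scaler_eq0 subr_eq0 (negPf mu_t) => /eqP.
Qed.

End TorusWeights.

Lemma dual_functionals (F : fieldType) (V : vectType F) (J : finType) (z : J -> V) :
  (forall c : J -> F, \sum_j c j *: z j = 0 -> forall j, c j = 0) ->
  exists tau : J -> V -> F, (forall j, scalar (tau j)) /\
    forall i j, tau j (z i) = (i == j)%:R.
Proof.
move=> z_free; pose X := [tuple z (enum_val i) | i < #|J|].
have freeX : free X.
  apply/freeP => k sum0 i; rewrite -[i]enum_valK.
  apply: (z_free (fun j => k (enum_rank j))); rewrite -[RHS]sum0 (reindex (fun i : 'I_#|J| => enum_val i)) /=.
    by apply: eq_bigr => l _; rewrite enum_valK nth_mktuple.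
  by exists enum_rank => j _; [rewrite enum_valK | rewrite enum_rankK].
exists (fun j => coord X (enum_rank j)); split=> [j c x y|i j]; first by rewrite linearP.
have -> : z i = X`_(enum_rank i) by rewrite nth_mktuple enum_rankK.
by rewrite coord_free // (inj_eq enum_rank_inj).
Qed.

(** * The grading of Lie(G) by the simple roots outside [I] *)

Section RootGrading.
Variables (F : fieldType) (p : nat) (char_p : p \in [pchar F]).
Variables (n : nat) (G T : 'M[F]_n -> Prop).
Hypotheses (algG : alg_group G) (torusT : torus T) (TG : subset_of T G).
Variables (Phi : finType) (rt : Phi -> 'M[F]_n -> F) (co : Phi -> F -> 'M[F]_n).
Variable opp : Phi -> Phi.
Hypothesis rootsPhi : root_system G T rt co opp.
Variables (Pi : {set Phi}) (cf : Phi -> Phi -> int).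
Hypothesis basePi : root_base T rt Pi cf.
Hypothesis triangular : lie G = (nilrad_neg G T rt opp Pi cf + lie T
                                 + nilrad_pos G T rt Pi cf)%VS.
Variable e : Phi -> 'M[F]_n.
Hypothesis e_space : forall a, root_space G T rt a = <[e a]>%VS.
Variable I : {set Phi}.
Hypothesis IPi : I \subset Pi.
Implicit Types (a b : Phi) (m : Phi -> int) (x y t : 'M[F]_n).

Definition weight_char m t : F := \prod_(b in Pi) rt b t ^ m b.
(** The degree is read off characters of T, which determine m on [Pi] ([weight_char_inj]); weights
    of Lie(T) would see m only modulo p, and the p-map has to multiply degrees by p. *)
Definition weight_degree m : int := \sum_(b in Pi :\: I) m b.

Lemma root_neq0 a t : T t -> rt a t != 0.
Proof. by case: rootsPhi => /(_ a) [[[nz _ _] _ _] _] _ _ _; apply: nz. Qed.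

Lemma weight_char_root a t : T t -> rt a t = weight_char (cf a) t.
Proof. by case: basePi => _ H _; apply: H. Qed.

Lemma weight_charD m m' t : T t ->
  weight_char (fun b => m b + m' b) t = weight_char m t * weight_char m' t.
Proof.
move=> Tt; rewrite /weight_char -big_split; apply: eq_bigr => b _ /=.
by rewrite expfzDr // root_neq0.
Qed.

Lemma weight_charMn m k t : weight_char (fun b => m b *+ k) t = weight_char m t ^+ k.
Proof.
rewrite /weight_char -prodrXl; apply: eq_bigr => b _.
by rewrite -mulr_natr natz -exprz_exp exprnP.
Qed.

Lemma weight_char0 t : weight_char (fun=> 0) t = 1.
Proof. by rewrite /weight_char big1 // => b _; rewrite expr0z. Qed.

Lemma weight_char_inj m m' : (forall t, T t -> weight_char m t = weight_char m' t) ->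
  forall b, b \in Pi -> m b = m' b.
Proof.
move=> eq_mm b bPi; apply/eqP; rewrite -subr_eq0; apply/eqP.
case: basePi => inj _ _; apply: (inj (fun b => m b - m' b)) => // t Tt.
have nz : weight_char m' t != 0.
  by apply/prodf_neq0 => c _; apply: expfz_neq0; apply: root_neq0.
apply: (mulIf nz); rewrite mul1r -[LHS]weight_charD // -[RHS]eq_mm //.
by apply: eq_bigr => c _; rewrite subrK.
Qed.

Lemma weight_degree_inj m m' : (forall t, T t -> weight_char m t = weight_char m' t) ->
  weight_degree m = weight_degree m'.
Proof.
move=> /weight_char_inj eq_mm; apply: eq_bigr => b; rewrite inE => /andP[_]; exact: eq_mm.
Qed.

Definition root_degree a : int := weight_degree (cf a).

Local Notation J := (Phi + 'I_(\dim (lie T)))%type.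

Definition letter (j : J) : 'M[F]_n :=
  match j with inl a => e a | inr i => (vbasis (lie T))`_i end.
Definition letter_weight (j : J) : Phi -> int := if j is inl a then cf a else fun=> 0.
Definition letter_degree (j : J) : int := weight_degree (letter_weight j).

Lemma lie_TG : (lie T <= lie G)%VS.
Proof.
by apply/subvP => x /lieP Tx; apply/lieP => f fG; apply: Tx => g /TG; apply: fG.
Qed.

Lemma e_root_space a : e a \in root_space G T rt a.
Proof. by rewrite e_space memv_line. Qed.

Lemma e_lie a : e a \in lie G.
Proof. by have /weight_spaceP[] := e_root_space a. Qed.

Lemma e_weight a : weight_vector T (rt a) (e a).
Proof. by have /weight_spaceP[] := e_root_space a. Qed.

Lemma e_neq0 a : e a != 0.
Proof.
case: rootsPhi => /(_ a) [[_ _ nz] _] _ _ _; apply/eqP => e0; apply: nz.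
by rewrite -[weight_space _ _ _]/(root_space G T rt a) e_space e0; apply/eqP; rewrite -subv0 -memvE mem0v.
Qed.

Lemma vbasis_lieT i : (vbasis (lie T))`_i \in lie T.
Proof.
have [lt|ge] := ltnP i (size (vbasis (lie T))); first by apply: vbasis_mem; apply: mem_nth.
by rewrite nth_default // mem0v.
Qed.

Lemma letter_lie j : letter j \in lie G.
Proof. by case: j => [a|i] /=; [apply: e_lie | apply/(subvP lie_TG)/vbasis_lieT]. Qed.

Lemma letter_weight_vector j : weight_vector T (weight_char (letter_weight j)) (letter j).
Proof.
case: j => [a|i] /=.
  by apply: weight_vector_ext (e_weight a) => t; exact: weight_char_root.
apply: weight_vector_ext (weight_vector_lie torusT (vbasis_lieT i)) => t _.
by rewrite weight_char0.
Qed.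

Lemma lie_T_lincomb x : x \in lie T -> lincomb letter (fun j => if j is inr _ then true else false) x.
Proof.
move=> xT; rewrite (coord_vbasis xT); elim/big_ind: _ => [|y w Hy Hw|i _].
- exact: lincomb0.
- by rewrite -[y]scale1r; apply: lincombP.
rewrite -[_ *: _]addr0; apply: lincombP; last exact: lincomb0.
exact: (@lincomb_gen _ _ _ letter _ (inr i)).
Qed.

Lemma lincomb_letter (Q : pred J) (U : {vspace 'M[F]_n}) x :
  (forall j, Q j -> letter j \in U) -> lincomb letter Q x -> x \in U.
Proof. by move=> QU [c ->]; apply: memv_suml => j Qj; rewrite memvZ // QU. Qed.

Lemma lincomb_sumv (Q : pred J) (K : finType) (S : pred K) (U : K -> {vspace 'M[F]_n}) x :
  (forall k y, S k -> y \in U k -> lincomb letter Q y) ->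
  x \in (\sum_(k | S k) U k)%VS -> lincomb letter Q x.
Proof.
move=> UQ /memv_sumP[y yU ->]; elim/big_ind: _ => [|u w Hu Hw|k Sk].
- exact: lincomb0.
- by rewrite -[u]scale1r; apply: lincombP.
exact: UQ (yU k Sk).
Qed.

Lemma root_space_lincomb (Q : pred J) a x : Q (inl a) -> x \in root_space G T rt a ->
  lincomb letter Q x.
Proof.
move=> Qa; rewrite e_space => /vlineP[c ->]; rewrite -[_ *: _]addr0.
by apply: lincombP; [apply: (lincomb_gen _ Qa) | apply: lincomb0].
Qed.

Lemma lincomb_addv (Q : pred J) (U V : {vspace 'M[F]_n}) x :
  (forall y, y \in U -> lincomb letter Q y) -> (forall y, y \in V -> lincomb letter Q y) ->
  x \in (U + V)%VS -> lincomb letter Q x.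
Proof.
move=> UQ VQ /memv_addP[u uU [w wV ->]]; rewrite -[u]scale1r.
by apply: lincombP; [apply: UQ | apply: VQ].
Qed.

Lemma lie_lincomb x : x \in lie G -> lincomb letter xpredT x.
Proof.
rewrite triangular; apply: lincomb_addv => [y|y].
  apply: lincomb_addv => [w|w /lie_T_lincomb]; last exact: lincomb_sub.
  by apply: lincomb_sumv => a u _; apply: root_space_lincomb.
by apply: lincomb_sumv => a u _; apply: root_space_lincomb.
Qed.

(** Letters are grouped by T-weight, with [None] standing for Lie(T), so that different blocks have
    different characters even when Lie(T) has several basis vectors. *)
Let block (c : J -> F) (o : option Phi) : 'M[F]_n :=
  if o is Some a then c (inl a) *: e a else \sum_i c (inr i) *: (vbasis (lie T))`_i.

Let block_char (o : option Phi) : 'M[F]_n -> F := if o is Some a then rt a else fun=> 1.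

Let weight_vectorZ mu c x : weight_vector T mu x -> weight_vector T mu (c *: x).
Proof.
move=> wx; rewrite -[_ *: x]addr0; apply: weight_vectorD => // t _.
by rewrite mulmx0 mul0mx scaler0.
Qed.

Let block_weight c o : weight_vector T (block_char o) (block c o).
Proof.
case: o => [a|] /=; first by apply/weight_vectorZ/e_weight.
apply: weight_vector_lie => //; apply: memv_suml => i _.
by apply/memvZ/vbasis_lieT.
Qed.

Let block_char_inj o o' : (forall t, T t -> block_char o t = block_char o' t) -> o = o'.
Proof.
case: rootsPhi => roots inj _ _; case: o o' => [a|] [b|] //= eq_ab.
- by congr Some; apply: inj.
- by case: (roots a) => -[_ nontriv _] _; case: nontriv.
- case: (roots b) => -[_ nontriv _] _; case: nontriv => t Tt.
  by rewrite -eq_ab.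
Qed.

Let sum_letters (c : J -> F) : \sum_j c j *: letter j = \sum_o block c o.
Proof.
rewrite big_sumType /= addrC.
rewrite [RHS](bigD1 None) //= (reindex_omap Some id) /=; last by case.
by congr (_ + _); apply: eq_bigl => a; rewrite eqxx.
Qed.

Lemma letter_free (c : J -> F) : \sum_j c j *: letter j = 0 -> forall j, c j = 0.
Proof.
rewrite sum_letters => sum0; have block0 := weight_independence (block_weight c) block_char_inj sum0.
case=> [a|i].
  by have /eqP := block0 (Some a); rewrite /= scaler_eq0 (negPf (e_neq0 a)) orbF => /eqP.
have /freeP indep := basis_free (vbasisP (lie T)).
exact: (indep (fun i => c (inr i)) (block0 None) i).
Qed.

(** Conjugation by t minus the scalar m(t) kills x and acts on each block by a scalar; independence
    of weights makes every block with another character zero. Equal characters have equal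
    degrees. *)
Lemma weight_lincomb m x : x \in lie G -> weight_vector T (weight_char m) x ->
  lincomb letter (fun j => letter_degree j == weight_degree m) x.
Proof.
move=> /lie_lincomb[c ->]; rewrite sum_letters => wx.
have zero_or_eq o : block c o = 0 \/ forall t, T t -> block_char o t = weight_char m t.
  have [|nall] := boolp.pselect (forall t, T t -> block_char o t = weight_char m t); first by right.
  left; have [t Tt ne_t] : exists2 t, T t & block_char o t != weight_char m t.
    apply: boolp.contrapT => all_eq; apply: nall => t Tt.
    by apply/eqP/negPn/negP => ne; apply: all_eq; exists t.
  have w' o' : weight_vector T (block_char o') ((block_char o' t - weight_char m t) *: block c o').
    by apply: weight_vectorZ.
  have sum0 : \sum_o' (block_char o' t - weight_char m t) *: block c o' = 0.
    transitivity (t *m (\sum_o' block c o') *m invmx t - weight_char m t *: \sum_o' block c o').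
      rewrite mulmx_sumr mulmx_suml scaler_sumr -sumrB; apply: eq_bigr => o' _.
      by rewrite (block_weight c o') // scalerBl.
    by rewrite wx // subrr.
  have /eqP := weight_independence w' block_char_inj sum0 o.
  by rewrite scaler_eq0 subr_eq0 (negPf ne_t) => /eqP.
elim/big_ind: _ => [|y w Hy Hw|o _]; first exact: lincomb0.
  by rewrite -[y]scale1r; apply: lincombP.
have [->|eq_o] := zero_or_eq o; first exact: lincomb0.
case: o eq_o => [a|] /= eq_o.
  rewrite -[_ *: _]addr0; apply: lincombP; last exact: lincomb0.
  apply: (@lincomb_gen _ _ _ letter _ (inl a)); apply/eqP; apply: weight_degree_inj => t Tt /=.
  by rewrite -weight_char_root // eq_o.
have deg0 : weight_degree m = 0.
  rewrite -(weight_degree_inj (m := fun=> 0)) => [|t Tt]; last by rewrite weight_char0; apply: eq_o.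
  by rewrite /weight_degree big1.
elim/big_ind: _ => [|y w Hy Hw|i _]; first exact: lincomb0.
  by rewrite -[y]scale1r; apply: lincombP.
rewrite -[_ *: _]addr0; apply: lincombP; last exact: lincomb0.
apply: (@lincomb_gen _ _ _ letter _ (inr i)); rewrite deg0 /letter_degree /weight_degree big1 //.
Qed.

Let G_mul x y : G x -> G y -> G (x *m y). Proof. by case: algG => _ [_ H _]; apply: H. Qed.
Let G_one : G 1%:M. Proof. by case: algG => _ []. Qed.

Lemma letter_bracket i j :
  lincomb letter (fun k => letter_degree k == letter_degree i + letter_degree j)
    (lie_bracket (letter i) (letter j)).
Proof.
have -> : letter_degree i + letter_degree j =
    weight_degree (fun b => letter_weight i b + letter_weight j b).
  by rewrite /letter_degree /weight_degree -big_split.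
apply: weight_lincomb; first by apply: (lie_bracket_mem G_mul G_one); apply: letter_lie.
apply: weight_vector_ext (weight_vector_bracket torusT (letter_weight_vector i) (letter_weight_vector j)).
by move=> t Tt; rewrite weight_charD.
Qed.

(** Conjugation by t is multiplicative, so the p-th power of a vector of weight mu has weight
    mu^p. *)
Lemma letter_power j :
  lincomb letter (fun k => letter_degree k == letter_degree j *+ p) (letter j ^+ p).
Proof.
have -> : letter_degree j *+ p = weight_degree (fun b => letter_weight j b *+ p).
  by rewrite /letter_degree /weight_degree sumrMnl.
apply: weight_lincomb; first by apply: (lie_pchar_mem G_mul G_one char_p); apply: letter_lie.
apply: weight_vector_ext (weight_vectorX torusT p (letter_weight_vector j)) => t _.
by rewrite weight_charMn.
Qed.

Lemma pos_degree a : a \in pos_roots Pi cf -> 0 <= root_degree a.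
Proof.
rewrite inE => /forallP pos_a; apply: sumr_ge0 => b; rewrite inE => /andP[_ bPi].
by have := pos_a b; rewrite bPi.
Qed.

Lemma levi_degree a : a \in levi_roots T rt I <-> (forall b, b \in Pi :\: I -> cf a b = 0).
Proof.
split=> [|cf0].
  rewrite inE => /boolp.asboolP[m eq_m] b; rewrite inE => /andP[bI bPi].
  have := @weight_char_inj (cf a) (fun c => if c \in I then m c else 0) _ b bPi.
  rewrite (negPf bI); apply=> t Tt; rewrite -weight_char_root // eq_m // /weight_char.
  rewrite [RHS](big_setID I) /= [X in _ = _ * X]big1 ?mulr1; last first.
    by move=> c; rewrite inE => /andP[/negPf -> _]; rewrite expr0z.
  by rewrite (setIidPr IPi); apply: eq_bigr => c ->.
rewrite inE; apply/boolp.asboolP; exists (cf a) => t Tt; rewrite weight_char_root //.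
rewrite /weight_char (big_setID I) /= [X in _ * X]big1 ?mulr1; last by move=> c /cf0 ->; rewrite expr0z.
by rewrite (setIidPr IPi).
Qed.

Lemma sign_degree a : a \in pos_roots Pi cf \/ (forall b, b \in Pi -> cf a b <= 0).
Proof.
case: basePi => _ _ /(_ a) [pos_a|neg_a]; [left | by right].
by rewrite inE; apply/forallP => b; apply/implyP => /pos_a.
Qed.

(** The coefficients of a root all have the same sign, so a vanishing sum forces each coefficient
    outside [I] to vanish. *)
Lemma degree_eq0 a : root_degree a = 0 -> a \in levi_roots T rt I.
Proof.
move=> deg0; apply/levi_degree => b bPi.
case: (sign_degree a) => [|neg_a].
  rewrite inE => /forallP pos_a.
  have /eqP := deg0; rewrite psumr_eq0 => [/allP/(_ b (mem_index_enum _))|c].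
    by rewrite bPi => /eqP.
  by rewrite inE => /andP[_ cPi]; have := pos_a c; rewrite cPi.
have : - root_degree a == 0 by rewrite deg0 oppr0.
rewrite /root_degree /weight_degree -sumrN psumr_eq0 => [/allP/(_ b (mem_index_enum _))|c].
  by rewrite bPi oppr_eq0 => /eqP.
by rewrite inE oppr_ge0 => /andP[_ /neg_a].
Qed.

Lemma mem_unip_roots a : (a \in unip_roots T rt Pi cf I) = (0 < root_degree a).
Proof.
rewrite /unip_roots in_setD in_setI negb_and; apply/andP/idP => [[not_levi pos_a]|deg_a].
  rewrite pos_a orbF in not_levi; rewrite lt_neqAle pos_degree // andbT eq_sym.
  by apply: contra not_levi => /eqP /degree_eq0.
have not_levi : a \notin levi_roots T rt I.
  apply/negP => /levi_degree cf0; move: deg_a; rewrite /root_degree /weight_degree big1 //.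
rewrite not_levi; split=> //; case: (sign_degree a) => // neg_a.
move: deg_a; rewrite ltNge => /negP[]; apply: sumr_le0 => b; rewrite inE => /andP[_ /neg_a].
by [].
Qed.

Lemma opp_degree a : root_degree (opp a) = - root_degree a.
Proof.
rewrite /root_degree /weight_degree -sumrN.
apply: (@weight_degree_inj _ (fun b => - cf a b)) => t Tt.
rewrite -weight_char_root //; case: rootsPhi => _ _ _ ->//; rewrite weight_char_root //.
by rewrite /weight_char -prodfV; apply: eq_bigr => b _; rewrite invr_expz.
Qed.

Lemma opp_opp a : opp (opp a) = a.
Proof.
by case: rootsPhi => _ inj _ opp_rt; apply: inj => t Tt; rewrite !opp_rt // invrK.
Qed.

Lemma mem_parabolic j : 0 <= letter_degree j -> letter j \in parabolic G T rt Pi cf I.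
Proof.
case: j => [a|i] /= deg_j; last first.
  by apply/(subvP (addvSl _ _))/(subvP (addvSl _ _))/vbasis_lieT.
rewrite le_eqVlt in deg_j; case/orP: deg_j => [/eqP deg0|deg_pos].
  apply/(subvP (addvSl _ _))/(subvP (addvSr _ _)).
  apply: (subvP (sumv_sup a _ (subvv _))); first exact/degree_eq0/esym.
  exact: e_root_space.
apply/(subvP (addvSr _ _))/(subvP (sumv_sup a _ (subvv _))); first by rewrite mem_unip_roots.
exact: e_root_space.
Qed.

Lemma parabolic_lincomb x : x \in parabolic G T rt Pi cf I ->
  lincomb letter (fun j => 0 <= letter_degree j) x.
Proof.
apply: lincomb_addv => [y|y].
  apply: lincomb_addv => [w /lie_T_lincomb|w].
    by apply: lincomb_sub => -[//|i _]; rewrite /letter_degree /weight_degree big1.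
  apply: lincomb_sumv => a u /levi_degree cf0; apply: root_space_lincomb.
  by rewrite /letter_degree /weight_degree big1.
apply: lincomb_sumv => a u; rewrite mem_unip_roots => /ltW deg_a.
exact: root_space_lincomb.
Qed.

Lemma parabolic_lie : (parabolic G T rt Pi cf I <= lie G)%VS.
Proof.
by apply/subvP => x /parabolic_lincomb; apply: lincomb_letter => j _; apply: letter_lie.
Qed.

End RootGrading.

(** * Simplicity for a graded restricted Lie algebra of matrices *)

Section GradedRestrictedLieAlgebra.
Variables (F : fieldType) (n p : nat) (char_p : p \in [pchar F]).
Variable psi : 'M[F]_n -> F.
Hypothesis psi_linear : scalar psi.
Variables (g q : {vspace 'M[F]_n}) (J : finType) (z : J -> 'M[F]_n) (dg : J -> int).
Hypothesis qg : (q <= g)%VS.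
Hypothesis z_free : forall c : J -> F, \sum_j c j *: z j = 0 -> forall j, c j = 0.
Hypothesis z_g : forall j, z j \in g.
Hypothesis z_q : forall j, 0 <= dg j -> z j \in q.
Hypothesis g_lincomb : forall x, x \in g -> lincomb z xpredT x.
Hypothesis q_lincomb : forall x, x \in q -> lincomb z (fun j => 0 <= dg j) x.
Hypothesis z_bracket : forall i j,
  lincomb z (fun k => dg k == dg i + dg j) (lie_bracket (z i) (z j)).
Hypothesis z_power : forall j, lincomb z (fun k => dg k == dg j *+ p) (z j ^+ p).
Hypothesis psi_pos : forall j, 0 < dg j -> psi (z j) = 0.

Variables rp rn : seq J.
Hypotheses (uniq_rp : uniq rp) (uniq_rn : uniq rn).
Hypothesis mem_rp : forall j, (j \in rp) = (0 < dg j).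
Hypothesis mem_rn : forall j, (j \in rn) = (dg j < 0).
Hypothesis dg_balance : \sum_(j <- rp) dg j = - \sum_(j <- rn) dg j.

Local Notation A := (reduced_env p psi g).
Local Notation B := (reduced_env p psi q).
Local Notation xg := (fun j => rvar p psi g (z j)).
Local Notation xq := (fun j => rvar p psi q (z j)).
Local Notation incl := (@reduced_incl F n p psi q g).
Local Notation rcg := (rconst p psi g : {rmorphism F -> A}).
Local Notation rcq := (rconst p psi q : {rmorphism F -> B}).

Let inclM : {rmorphism B -> A} := HB.pack incl
    (GRing.isZmodMorphism.Build _ _ _ (@reduced_incl_is_zmod_morphism F n p psi _ _ qg))
    (GRing.isMonoidMorphism.Build _ _ _ (@reduced_incl_is_monoid_morphism F n p psi _ _ qg)).

Let rq : seq J := [seq j <- enum J | 0 <= dg j].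

Let mem_rq j : (j \in rq) = (0 <= dg j).
Proof. by rewrite mem_filter mem_enum andbT. Qed.

Let uniq_rq : uniq rq. Proof. by rewrite filter_uniq // enum_uniq. Qed.

Let mem_r j : j \in rn ++ rq.
Proof. by rewrite mem_cat mem_rn mem_rq; case: ltP. Qed.

Let uniq_r : uniq (rn ++ rq).
Proof.
rewrite cat_uniq uniq_rn uniq_rq andbT /=; apply/hasPn => j.
by rewrite mem_rq mem_rn leNgt.
Qed.

Let lincomb_memv (K : {vspace 'M[F]_n}) (Q : pred J) x :
  (forall j, Q j -> z j \in K) -> lincomb z Q x -> x \in K.
Proof. by move=> QK [c ->]; apply: memv_suml => j Qj; rewrite memvZ // QK. Qed.

Let bracket_g i j : lie_bracket (z i) (z j) \in g.
Proof. by apply: (lincomb_memv _ (z_bracket i j)) => k _. Qed.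

Let power_g j : z j ^+ p \in g.
Proof. by apply: (lincomb_memv _ (z_power j)) => k _. Qed.

Let bracket_q i j : 0 <= dg i -> 0 <= dg j -> lie_bracket (z i) (z j) \in q.
Proof.
move=> i0 j0; apply: (lincomb_memv _ (z_bracket i j)) => k /eqP dk.
by apply: z_q; rewrite dk addr_ge0.
Qed.

Let power_q j : 0 <= dg j -> z j ^+ p \in q.
Proof.
move=> j0; apply: (lincomb_memv _ (z_power j)) => k /eqP dk.
by apply: z_q; rewrite dk mulrn_wge0.
Qed.

Let xg_bracket i j : homog dg rcg xg (dg i + dg j) (xg i * xg j - xg j * xg i).
Proof.
rewrite rvar_bracket //.
apply: linspan_sub (rvar_lincomb p psi g (z_bracket i j)) => y [k /eqP dk eq_y].
by apply: linspan_gen; exists k.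
Qed.

Let xq_bracket i j : 0 <= dg i -> 0 <= dg j ->
  homog dg rcq xq (dg i + dg j) (xq i * xq j - xq j * xq i).
Proof.
move=> i0 j0; rewrite rvar_bracket; [|exact: z_q|exact: z_q|exact: bracket_q].
apply: linspan_sub (rvar_lincomb p psi q (z_bracket i j)) => y [k /eqP dk eq_y].
by apply: linspan_gen; exists k.
Qed.

Let xg_power_pos i : 0 < dg i -> homog dg rcg xg (dg i *+ p) (xg i ^+ p).
Proof.
move=> i0; rewrite rvar_pow // psi_pos // expr0n gtn_eqF ?prime_gt0 ?(pcharf_prime char_p) //.
rewrite (rmorph0 rcg) addr0.
apply: linspan_sub (rvar_lincomb p psi g (z_power i)) => y [k /eqP dk eq_y].
by apply: linspan_gen; exists k.
Qed.

Let xg_power_neg i : dg i < 0 ->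
  linspan rcg (fun y => (exists2 k, dg k = dg i *+ p & y = xg k) \/ y = 1) (xg i ^+ p).
Proof.
move=> _; rewrite rvar_pow //; apply: linspanD.
  apply: linspan_sub (rvar_lincomb p psi g (z_power i)) => y [k /eqP dk eq_y].
  by apply: linspan_gen; left; exists k.
rewrite -[rconst _ _ _ _]mulr1; apply: (linspanZ (c := rcg)).
by apply: linspan_gen; right.
Qed.

Let incl_x j : 0 <= dg j -> inclM (xq j) = xg j.
Proof. by move=> j0; apply: (reduced_incl_rvar p psi qg); apply: z_q. Qed.

Let incl_rc s : inclM (rcq s) = rcg s.
Proof. exact: (reduced_incl_rconst p psi qg). Qed.

Local Notation expo := {ffun J -> 'I_p}.

Let g_monomials (a : A) : exists c : expo -> F,
  a = \sum_d rcg (c d) * mono (rn ++ rq) xg (fun j => d j).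
Proof.
apply: (reduced_env_monomials char_p uniq_r) => [j _|x xgP|i j _ _|j _].
- exact: z_g.
- by apply: lincomb_sub (g_lincomb xgP) => j _; exact: mem_r.
- exact: bracket_g.
- exact: power_g.
Qed.

Let q_monomials (b : B) : exists c : expo -> F,
  b = \sum_d rcq (c d) * mono rq xq (fun j => d j).
Proof.
apply: (reduced_env_monomials char_p uniq_rq) => [j|x xqP|i j|j]; rewrite ?mem_rq.
- exact: z_q.
- by apply: lincomb_sub (q_lincomb xqP) => j; rewrite mem_rq.
- exact: bracket_q.
- exact: power_q.
Qed.

Let monomials_independent (c : expo -> F) :
  \sum_d rcg (c d) * mono (rn ++ rq) xg (fun j => d j) = 0 -> forall d, c d = 0.
Proof.
move=> sum0; have [tau [tau_lin tau_dual]] := dual_functionals z_free.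
pose s (d : expo) := flat (rn ++ rq) (fun j => d j).
have s_g d j : j \in s d -> z j \in g by move=> _; apply: z_g.
have s_lt d j : (count_mem j (s d) < p)%N by rewrite count_flat.
have s_inj d d' : perm_eq (s d) (s d') -> d = d'.
  move=> /permP dd'; apply/ffunP => j; apply: val_inj => /=.
  by have := dd' (pred1 j); rewrite !count_flat.
apply: (pbw_independent char_p psi_linear tau_lin tau_dual s_g s_lt s_inj).
apply: etrans sum0; apply: eq_bigr => d _; congr (_ * _).
exact: (word_flat (rn ++ rq) xg).
Qed.

Let q_ind (Q : B -> Prop) :
  (forall s, Q (rcq s)) -> (forall j, 0 <= dg j -> Q (xq j)) ->
  (forall a b, Q a -> Q b -> Q (a + b)) -> (forall a b, Q a -> Q b -> Q (a * b)) ->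
  forall b, Q b.
Proof.
move=> Qc Qx QD QM; apply: reduced_env_ind => // x /q_lincomb/(rvar_lincomb p psi q).
elim=> [|a b _ Qa _ Qb|s a _ Qa|_ [j j0 ->]].
- by have := Qc 0; rewrite rmorph0.
- exact: QD.
- exact: QM.
- exact: Qx.
Qed.

Let rcg_central s a : rcg s * a = a * rcg s. Proof. exact: rconst_central. Qed.
Let rcq_central s b : rcq s * b = b * rcq s. Proof. exact: rconst_central. Qed.

Let p_gt1 : (1 < p)%N. Proof. exact: prime_gt1 (pcharf_prime char_p). Qed.

Variables (L : lmodType B) (simpleL : simple_module L) (v : L).
Hypotheses (v_neq0 : v != 0) (gen_v : generated_by v).
Hypothesis max_v : forall j, 0 < dg j -> xq j *: v = 0.
Variables (R : F) (R_neq0 : R != 0).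
Hypothesis top_scalar : tens incl (mono rp xg (fun=> p.-1) * mono rn xg (fun=> p.-1)) v =
  tens incl (rconst p psi g R) v.

Theorem graded_induced_simple : simple_module (tensor incl L : lmodType A).
Proof.
have incl_rq j : j \in rq -> inclM (xq j) = xg j by rewrite mem_rq; apply: incl_x.
have g_span := right_module_span (incl := inclM) rcg_central incl_rc incl_rq g_monomials.
apply: (@graded_induction_simple F A B inclM rcg rcq rcg_central rcq_central incl_rc J dg p xg xq
  p_gt1 incl_x xg_bracket xq_bracket xg_power_pos xg_power_neg rp rn uniq_rp uniq_rn mem_rp
  mem_rn dg_balance q_ind g_span L simpleL v gen_v max_v R R_neq0 top_scalar).
exact: (tens1_neq0 (incl := inclM) rcg_central incl_rc uniq_r incl_rq (ltnW p_gt1) g_monomials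
  q_monomials monomials_independent v_neq0).
Qed.

End GradedRestrictedLieAlgebra.

(** * The reductive case *)

Theorem theorem2p10
  (F : closedFieldType) (p : nat) (charFp : p \in [pchar F])
  (n : nat) (G T : 'M[F]_n -> Prop)
  (redG : reductive G) (maxT : maximal_torus G T)
  (simply_connectedDG : simply_connected (derived_group G))
  (invariant_form : has_invariant_form G)
  (Phi : finType) (rt : Phi -> 'M[F]_n -> F) (co : Phi -> F -> 'M[F]_n)
  (opp : Phi -> Phi) (rootsPhi : root_system G T rt co opp)
  (Pi : {set Phi}) (cf : Phi -> Phi -> int) (basePi : root_base T rt Pi cf)
  (good_p : good_prime Pi cf p)
  (triangular : lie G = (nilrad_neg G T rt opp Pi cf + lie T
                         + nilrad_pos G T rt Pi cf)%VS)
  (e h : Phi -> 'M[F]_n) (chevalley : chevalley_basis G T rt co opp Pi e h)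
  (I : {set Phi}) (properI : I \proper Pi)
  (betas : seq Phi) (betasE : perm_eq betas (enum (unip_roots T rt Pi cf I)))
  (betas_sorted : sorted (fun a b => root_height Pi cf a <= root_height Pi cf b) betas)
  (chi : {scalar subvs_of (lie G)})
  (chi_nilrad : forall x : subvs_of (lie G),
     vsval x \in nilrad_pos G T rt Pi cf -> chi x = 0)
  (lam : {scalar subvs_of (lie T)})
  (L : lmodType (reduced_env p (on_ambient chi) (parabolic G T rt Pi cf I)))
  (simpleL : simple_module L)
  (v : L) (max_v : maximal_vector Pi cf e lam v) (gen_v : generated_by v)
  (R : F)
  (defR : tens (@reduced_incl F n p (on_ambient chi) _ (lie G))
            ((\prod_(b <- betas) rvar p (on_ambient chi) (lie G) (e b) ^+ p.-1) *
             (\prod_(b <- betas) rvar p (on_ambient chi) (lie G) (e (opp b)) ^+ p.-1)) v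
        = tens (@reduced_incl F n p (on_ambient chi) _ (lie G))
            (rconst p (on_ambient chi) (lie G) R) v)
  (R_neq0 : R != 0) :
  simple_module (induced_module G L).

Proof.
have torusT : torus T by case: maxT.
have TG : subset_of T G by case: maxT.
have algG : alg_group G by case: redG.
have e_space : forall a, root_space G T rt a = <[e a]>%VS by case: chevalley.
have IPi : I \subset Pi by exact: proper_sub.
have psi_linear : scalar (on_ambient chi) by move=> c x y; rewrite /on_ambient !linearP.
pose dgr := @letter_degree F n T Phi Pi cf I.
pose lt := letter (T := T) e.
have unip b : (b \in betas) = (0 < root_degree Pi cf I b).
  by rewrite (perm_mem betasE) mem_enum (mem_unip_roots rootsPhi basePi IPi).
have opp_inj : injective opp by apply: (can_inj (opp_opp rootsPhi)).
have opp_deg b : root_degree Pi cf I (opp b) = - root_degree Pi cf I b.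
  exact: (opp_degree rootsPhi basePi).
have uniq_b : uniq betas by rewrite (perm_uniq betasE) enum_uniq.
have unip_pos b : b \in betas -> b \in pos_roots Pi cf.
  by rewrite (perm_mem betasE) mem_enum in_setD => /andP[].
have inl_inj : injective (inl : Phi -> Phi + 'I_(\dim (lie T))) by move=> a b [].
have dgr_inr i : dgr (inr i) = 0 by rewrite /dgr /letter_degree /weight_degree big1.
have simple := @graded_induced_simple F n p charFp (on_ambient chi) psi_linear (lie G)
  (parabolic G T rt Pi cf I) _ lt dgr.
(* Both lists of letters follow the order of [betas], as the two products in [defR] do. *)
apply: (simple _ _ _ _ _ _ _ _ _ (map inl betas) (map (inl \o opp) betas)
  _ _ _ _ _ L simpleL v _ gen_v _ R R_neq0).
- exact: (parabolic_lie TG rootsPhi basePi e_space IPi).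
- exact: (letter_free torusT rootsPhi e_space).
- exact: (letter_lie TG e_space).
- exact: (mem_parabolic rootsPhi basePi e_space IPi).
- by move=> x; apply: (lie_lincomb triangular e_space).
- by move=> x; apply: (parabolic_lincomb rootsPhi basePi e_space IPi).
- exact: (letter_bracket algG torusT TG rootsPhi basePi triangular e_space).
- exact: (letter_power charFp algG torusT TG rootsPhi basePi triangular e_space).
(* A letter of positive degree is a root vector in the positive nilradical, where chi vanishes. *)
- case=> [a deg_a|i]; last by rewrite dgr_inr ltxx.
  apply: chi_nilrad; rewrite vsprojK; last exact: (letter_lie TG e_space (inl a)).
  rewrite /lt /=; apply: (subvP (sumv_sup a _ (subvv _))); last exact: (e_root_space e_space).
  by apply: unip_pos; rewrite unip.
- by rewrite (map_inj_uniq inl_inj).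
- by rewrite (map_inj_uniq (inj_comp inl_inj opp_inj)).
- case=> [a|i]; last first.
    by rewrite dgr_inr ltxx; apply/negP => /mapP[].
  by rewrite (mem_map inl_inj) unip.
- case=> [a|i]; last first.
    by rewrite dgr_inr ltxx; apply/negP => /mapP[].
  have -> : inl a = (inl \o opp) (opp a) :> Phi + 'I_(\dim (lie T)).
    by rewrite /= (opp_opp rootsPhi).
  rewrite (mem_map (inj_comp inl_inj opp_inj)) unip opp_deg oppr_gt0 /=.
  by rewrite (opp_opp rootsPhi).
(* The degrees of the two lists balance because opposite roots have opposite degrees. *)
- rewrite !big_map -sumrN; apply: eq_bigr => b _.
  by rewrite -[dgr _ in RHS]/(root_degree Pi cf I (opp b)) opp_deg opprK.
- by case: max_v.
- case=> [a deg_a|i]; last by rewrite dgr_inr ltxx.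
  by case: max_v => _ kill _; apply: kill; apply: unip_pos; rewrite unip.
by apply: etrans defR; rewrite /mono !big_map.
Qed.
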